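(* Let $k\ge1$ be an integer and, for $0<\varepsilon\le1$, let $\mathbf y(t)$ (with derivative $\dot{\mathbf y}(t)$) be the solution of $$\ddot{\mathbf y}+\frac1{\varepsilon^2}M\mathbf y=\mathbf g(\mathbf y,t),\quad t\in[0,T],\qquad \mathbf y(0)=\varepsilon^\nu\mathbf y_{\mathrm{in}},\quad \dot{\mathbf y}(0)=\varepsilon^{\nu-1}\dot{\mathbf y}_{\mathrm{in}},$$ where $M\in\mathbb R^{d\times d}$ is symmetric positive definite. Assume the bounded oscillatory energy condition $$\frac12\|\dot{\mathbf y}(t)\|^2+\frac1{2\varepsilon^2}\mathbf y(t)^\top M\mathbf y(t)\le C_0,\qquad t\in[0,T],$$ with $C_0$ independent of $\varepsilon$. Suppose the derivatives of $\mathbf g$ up to order $k$ (including $\mathbf g$ itself) are Lipschitz continuous in both $\mathbf y$ and $t$ with Lipschitz constants independent of $\varepsilon$. Let $h=T/N$ ($N$ a positive integer), $t_n=nh$, and let $\mathbf y_n,\dot{\mathbf y}_n$ be the numerical approximations produced by the $k$-th order local linear extension exponential integrator (defined in the context). Then there is a constant $C$ independent of $h$ and $\varepsilon$ such that $$\|\mathbf y_n-\mathbf y(t_n)\|+\varepsilon\|\dot{\mathbf y}_n-\dot{\mathbf y}(t_n)\|\le C\varepsilon h^{k+1},\qquad n=0,\dots,T/h.$$ In particular, if $c_0>0$ is a constant independent of $\varepsilon$, then for large time steps satisfying $h>c_0\varepsilon$ the improved estimate $$\|\mathbf y_n-\mathbf y(t_n)\|+\varepsilon\|\dot{\mathbf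 y}_n-\dot{\mathbf y}(t_n)\|\le C\varepsilon^2h^{k},\qquad n=0,\dots,T/h,$$ holds with $C$ independent of $h$ and $\varepsilon$.
   Context: **Data.** $d\ge1$, $\nu\in\mathbb R$, $T>0$ independent of $\varepsilon$, $\mathbf y(t)\in\mathbb R^d$, $\mathbf y_{\mathrm{in}},\dot{\mathbf y}_{\mathrm{in}}$ given vectors, $\mathbf g$ an $\varepsilon$-independent nonlinear function, $\|\cdot\|$ the Euclidean norm. **First-order form.** With $\mathbf p=\varepsilon\dot{\mathbf y}$, $\mathbf u=[\mathbf y^\top,\mathbf p^\top]^\top$ and $q=2d$, the problem becomes $\dot{\mathbf u}=\frac1\varepsilon A\mathbf u+\mathbf F(\mathbf u,t)$, where $$A=\begin{bmatrix}\mathbf 0&I_d\\-M&\mathbf 0\end{bmatrix}\in\mathbb R^{q\times q},\quad \mathbf F(\mathbf u,t)=\begin{bmatrix}\mathbf 0\\ \varepsilon\mathbf g(\mathbf y,t)\end{bmatrix},\quad \mathbf u(0)=\begin{bmatrix}\mathbf y(0)\\ \varepsilon\dot{\mathbf y}(0)\end{bmatrix}.$$ **Augmented system.** Put $\mathbf x=[\mathbf u^\top,t]^\top$ (components $x_1,\dots,x_{q+1}$), $A_1=\operatorname{diag}\{A,0\}$, $\mathbf f(\mathbf x)=[\mathbf F(\mathbf u,t)^\top,1]^\top$, $\mathbf x(0)=[\mathbf u(0)^\top,0]^\top$. **Multi-indices.** For $j\ge0$ let $\tilde{\mathcal I}^{[[j]]}$ be the set of nondecreasing tuples $\alpha=(\alpha_1,\dots,\alpha_j)\in\{1,\dots,q+1\}^j$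 (only the empty tuple if $j=0$). For a reference point $\hat{\mathbf x}$ and $\alpha$ of length $j$, $(\mathbf x-\hat{\mathbf x})^\alpha=\prod_{l=1}^j(x_{\alpha_l}-\hat x_{\alpha_l})$ (equal to $1$ if $j=0$); $\chi(\alpha;l)$ is $\alpha$ with its $l$-th entry removed; $\gamma(\alpha)=\prod_{r=1}^{q+1}\big(\#\{i:\alpha_i=r\}\big)!$; $\partial^\alpha/\partial\mathbf x^\alpha=\partial^j/\partial x_{\alpha_1}\cdots\partial x_{\alpha_j}$. Let $D^{[k]}=\sum_{j=0}^k|\tilde{\mathcal I}^{[[j]]}|$. The vector $\mathbf x^{[k,\hat{\mathbf x}]}$ of length $D^{[k]}$ lists all $(\mathbf x-\hat{\mathbf x})^\alpha$, $\alpha\in\bigcup_{j=0}^k\tilde{\mathcal I}^{[[j]]}$, once each; its first component is $1$, components $2,\dots,q+2$ are $\mathbf x-\hat{\mathbf x}$, the remaining ones are in any fixed order. **Matrices.** $A_1^{[k]}(\hat{\mathbf x}),A_0^{[k]}(\hat{\mathbf x})$ are the $D^{[k]}\times D^{[k]}$ matrices such that, for every $\alpha$ of length $j\le k$, the component corresponding to $\alpha$ of $A_1^{[k]}(\hat{\mathbf x})\mathbf x^{[k,\hat{\mathbf x}]}$ is (identically in $\mathbf x$) $$\sum_{l=1}^j\sum_{m=1}^{q+1}(A_1)_{\alpha_l m}(\mathbf x-\hat{\mathbf x})^{\chi(\alpha;l)}\big((x_m-\hat x_m)+\hat x_m\big),$$ and that of $A_0^{[k]}(\hat{\mathbf x})\mathbf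 x^{[k,\hat{\mathbf x}]}$ is $$\sum_{l=1}^{j}\sum_{m=0}^{k-j+1}\sum_{\beta\in\tilde{\mathcal I}^{[[m]]}}\frac1{\gamma(\beta)}\frac{\partial^{\beta}f_{\alpha_l}(\hat{\mathbf x})}{\partial\mathbf x^{\beta}}(\mathbf x-\hat{\mathbf x})^{\chi(\alpha;l)}(\mathbf x-\hat{\mathbf x})^{\beta}.$$ (The rows of the empty tuple are zero.) **Scheme.** $\mathbf X_0=\mathbf x(0)$ and $$\mathbf X_{n+1}=\mathbf X_n+\Pi_2^{q+2}\,\mathrm e^{\left(\frac1\varepsilon A_1^{[k]}(\mathbf X_n)+A_0^{[k]}(\mathbf X_n)\right)h}e_1,$$ where $e_1$ is the first canonical basis vector and $\Pi_2^{q+2}$ extracts components $2,\dots,q+2$. $\mathbf U_n$ is the vector of the first $q=2d$ components of $\mathbf X_n$; writing $\mathbf U_n=[\mathbf y_n^\top,\mathbf p_n^\top]^\top$ with $\mathbf y_n,\mathbf p_n$ of length $d$, one sets $\dot{\mathbf y}_n=\mathbf p_n/\varepsilon$. *)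

(* Defs.v *)
From HB Require Import structures.
From mathcomp Require Import all_boot all_order all_algebra.
From mathcomp Require Import all_classical all_reals all_analysis.
From mathcomp Require Import ring.

Set Implicit Arguments.
Unset Strict Implicit.
Unset Printing Implicit Defensive.

Import Order.TTheory GRing.Theory Num.Theory numFieldNormedType.Exports.
Local Open Scope classical_set_scope.
Local Open Scope ring_scope.

Definition enorm (R : realType) (n : nat) (v : 'cV[R]_n) : R :=
  Num.sqrt (\sum_i v i 0 ^+ 2).

Definition quad (R : realType) (n : nat) (M : 'M[R]_n) (v : 'cV[R]_n) : R :=
  (v^T *m M *m v) 0 0.

Definition sym_posdef (R : realType) (n : nat) (M : 'M[R]_n) : Prop :=
  M^T = M /\ forall v : 'cV[R]_n, v != 0 -> 0 < quad M v.

Definition expm (R : realType) (n : nat) (B : 'M[R]_n) : 'M[R]_n :=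
  limn (series (fun m => m`!%:R^-1 *: B ^+ m)).

(* l is the derivative at t of f restricted to A; it is one-sided at the
   endpoints when A is a closed interval. *)
Definition is_derive_on (R : realType) (V : normedModType R) (A : set R)
    (f : R -> V) (t : R) (l : V) : Prop :=
  (s - t)^-1 *: (f s - f t) @[s --> within A t^'] --> l.

(* Iterated partial derivative; the head of alpha is the outermost one. *)
Definition partial (R : realType) (n : nat) (alpha : seq 'I_n)
    (F : 'cV[R]_n -> R) : 'cV[R]_n -> R :=
  foldr (fun r G => 'D_(delta_mx r 0) G) F alpha.

(* All the partial derivatives of F of order at most k exist on A and are
   Lipschitz continuous there. *)
Definition derivs_lipschitz (R : realType) (k n : nat) (A : set 'cV[R]_n)
    (F : 'cV[R]_n -> R) : Prop :=
  (forall (alpha : seq 'I_n) (r : 'I_n) (x : 'cV[R]_n), (size alpha < k)%N ->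
     A x -> derivable (partial alpha F) x (delta_mx r 0)) /\
  (forall alpha : seq 'I_n, (size alpha <= k)%N ->
     [lipschitz partial alpha F x | x in A]).

(* g seen as a function of the stacked variable z = (y, t). *)
Definition joint (R : realType) (d : nat) (g : 'cV[R]_d -> R -> 'cV[R]_d)
    (z : 'cV[R]_(d + 1)) : 'cV[R]_d := g (usubmx z) (dsubmx z 0 0).

Definition strip (R : realType) (d : nat) (T : R) : set 'cV[R]_(d + 1) :=
  [set z | 0 <= dsubmx z 0 0 <= T].

Arguments strip {R} d T.

Definition is_solution (R : realType) (d : nat) (M : 'M[R]_d)
    (g : 'cV[R]_d -> R -> 'cV[R]_d) (eps T : R) (y0 dy0 : 'cV[R]_d)
    (y dy : R -> 'cV[R]_d) : Prop :=
  [/\ y 0 = y0, dy 0 = dy0 &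
   forall t, 0 <= t <= T -> is_derive_on `[0, T] y t (dy t) /\
     exists2 ddy : 'cV[R]_d, is_derive_on `[0, T] dy t ddy
       & ddy + (eps ^+ 2)^-1 *: (M *m y t) = g (y t) t].

Section MultiIndices.
Context {n : nat}.
Implicit Types alpha : seq 'I_n.

Definition nondecr alpha : bool := sorted leq [seq val i | i <- alpha].

Definition chi alpha (l : nat) : seq 'I_n := take l alpha ++ drop l.+1 alpha.

Definition gam alpha : nat := (\prod_(r < n) (count_mem r alpha)`!)%N.

Definition monom (R : realType) (v : 'cV[R]_n) alpha : R :=
  \prod_(i <- alpha) v i 0.

(* s lists the nondecreasing multi-indices of length at most k, starting with
   those of length 0 and 1; its size is the dimension D^[k]. *)
Definition multi_index_listing (k : nat) (s : seq (seq 'I_n)) : Prop :=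
  [/\ uniq s,
      forall alpha, (alpha \in s) = nondecr alpha && (size alpha <= k)%N &
      exists s', s = [::] :: [seq [:: i] | i <- enum 'I_n] ++ s'].

End MultiIndices.

Section LocalLinearExtension.
Context {R : realType} {n : nat} (k : nat) (s : seq (seq 'I_n)).
Local Notation D := (size s).

Definition midx (i : 'I_D) : seq 'I_n := nth [::] s i.

Definition monvec (xhat x : 'cV[R]_n) : 'cV[R]_D :=
  \col_i monom (x - xhat) (midx i).

Definition ext1_spec (A1 : 'M[R]_n) (xhat : 'cV[R]_n) (B : 'M[R]_D) : Prop :=
  forall (x : 'cV[R]_n) (i : 'I_D), let alpha := midx i in
  (B *m monvec xhat x) i 0 =
    \sum_(l < size alpha) \sum_(m < n)
       A1 (tnth (in_tuple alpha) l) m * monom (x - xhat) (chi alpha l)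
       * ((x m 0 - xhat m 0) + xhat m 0).

Definition ext0_spec (f : 'cV[R]_n -> 'cV[R]_n) (xhat : 'cV[R]_n)
    (B : 'M[R]_D) : Prop :=
  forall (x : 'cV[R]_n) (i : 'I_D), let alpha := midx i in
  (B *m monvec xhat x) i 0 =
    \sum_(l < size alpha) \sum_(m < (k - size alpha + 1).+1)
      \sum_(beta : m.-tuple 'I_n | nondecr beta)
        (gam beta)%:R^-1
        * partial beta (fun z => f z (tnth (in_tuple alpha) l) 0) xhat
        * monom (x - xhat) (chi alpha l) * monom (x - xhat) beta.

(* "The" matrices satisfying the specifications: see ext1_mxP, ext0_mxP and
   monvec_inj for existence and uniqueness. *)
Definition ext1_mx (A1 : 'M[R]_n) (xhat : 'cV[R]_n) : 'M[R]_D :=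
  xget 0 [set B | ext1_spec A1 xhat B].

Definition ext0_mx (f : 'cV[R]_n -> 'cV[R]_n) (xhat : 'cV[R]_n) : 'M[R]_D :=
  xget 0 [set B | ext0_spec f xhat B].

Definition e1 : 'cV[R]_D := \col_i ((i : nat) == 0)%:R.

(* extraction of the components 2, ..., n + 1 (1-based) *)
Definition Pi2 : 'M[R]_(n, D) := \matrix_(i, j) ((j : nat) == i.+1)%:R.

Definition LLE_step (A1 : 'M[R]_n) (f : 'cV[R]_n -> 'cV[R]_n) (eps h : R)
    (X : 'cV[R]_n) : 'cV[R]_n :=
  X + Pi2 *m (expm (h *: (eps^-1 *: ext1_mx A1 X + ext0_mx f X)) *m e1).

End LocalLinearExtension.

(* Well-posedness of ext1_mx and ext0_mx: the specifications have exactly one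
   solution. *)
Section WellPosed.
Context {R : realType} {n : nat} (k : nat) (s : seq (seq 'I_n)).
Hypothesis sP : multi_index_listing k s.
Local Notation D := (size s).

Let leqn : rel 'I_n := relpre val leq.

Let leqn_total : total leqn. Proof. by move=> i j; exact: leq_total. Qed.
Let leqn_trans : transitive leqn. Proof. by move=> i j l; exact: leq_trans. Qed.
Let leqn_anti : antisymmetric leqn.
Proof. by move=> i j; rewrite /leqn /= -eqn_leq => /eqP/val_inj. Qed.

Let nondecrE (a : seq 'I_n) : nondecr a = sorted leqn a.
Proof. by rewrite /nondecr sorted_map. Qed.

Let midx_in (i : 'I_D) : midx i \in s. Proof. exact: mem_nth. Qed.

Let size_midx (i : 'I_D) : (size (midx i) <= k)%N.
Proof. by have [_ h _] := sP; have := midx_in i; rewrite h => /andP[]. Qed.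

Let spn (P : 'cV[R]_n -> R) :=
  exists c : 'I_D -> R, forall v, P v = \sum_j c j * monom v (midx j).

Let spn0 : spn (fun=> 0).
Proof. by exists (fun=> 0) => v; rewrite big1// => j _; rewrite mul0r. Qed.

Let spnD P Q : spn P -> spn Q -> spn (fun v => P v + Q v).
Proof.
move=> [c cP] [c' cQ]; exists (fun j => c j + c' j) => v.
by rewrite cP cQ -big_split; apply: eq_bigr => j _; rewrite mulrDl.
Qed.

Let spnZ a P : spn P -> spn (fun v => a * P v).
Proof.
move=> [c cP]; exists (fun j => a * c j) => v.
by rewrite cP mulr_sumr; apply: eq_bigr => j _; rewrite mulrA.
Qed.

Let spn_sum (I : Type) (r : seq I) (p : pred I) (P : I -> 'cV[R]_n -> R) :
  (forall i, p i -> spn (P i)) -> spn (fun v => \sum_(i <- r | p i) P i v).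
Proof.
move=> h; elim: r => [|i r [c cP]].
  by case: spn0 => c cP; exists c => v; rewrite big_nil.
have [pi|npi] := boolP (p i).
  have [c' c'P] := spnD (h i pi) (ex_intro _ c cP).
  by exists c' => v; rewrite big_cons pi c'P.
by exists c => v; rewrite big_cons (negbTE npi) cP.
Qed.

Let spn_monom (a : seq 'I_n) : (size a <= k)%N -> spn (fun v => monom v a).
Proof.
move=> sa; have [us h _] := sP; pose b := sort leqn a.
have bs : b \in s by rewrite h nondecrE sort_sorted// size_sort.
have lt : (index b s < D)%N by rewrite index_mem.
exists (fun j => (j == Ordinal lt)%:R) => v.
rewrite (bigD1 (Ordinal lt))//= eqxx mul1r big1 ?addr0.
  rewrite /midx /= nth_index// /monom; apply: perm_big.
  by rewrite perm_sym; apply: permEl; exact: perm_sort.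
by move=> j /negbTE->; rewrite mul0r.
Qed.

Let size_chi (a : seq 'I_n) (l : 'I_(size a)) : (size (chi a l)).+1 = size a.
Proof.
rewrite /chi size_cat size_take size_drop ltn_ord -addnS -subSn ?ltn_ord//.
by rewrite subSS subnKC// ltnW.
Qed.

Let monom_cat (v : 'cV[R]_n) a b : monom v (a ++ b) = monom v a * monom v b.
Proof. by rewrite /monom big_cat. Qed.

Let rows (P : 'I_D -> 'cV[R]_n -> R) xhat : (forall i, spn (P i)) ->
  exists B : 'M[R]_D, forall x i, (B *m monvec s xhat x) i 0 = P i (x - xhat).
Proof.
move=> /choice[c cP]; exists (\matrix_(i, j) c i j) => x i.
by rewrite mxE cP; apply: eq_bigr => j _; rewrite !mxE.
Qed.

Lemma ext1_mxP (A1 : 'M[R]_n) (xhat : 'cV[R]_n) :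
  ext1_spec A1 xhat (ext1_mx s A1 xhat).
Proof.
apply: (@xgetPex _ 0 [set B | ext1_spec A1 xhat B]).
pose P (i : 'I_D) v := \sum_(l < size (midx i)) \sum_(m < n)
  A1 (tnth (in_tuple (midx i)) l) m * monom v (chi (midx i) l)
  * (v m 0 + xhat m 0).
have [|B BP] := @rows P xhat.
  move=> i; apply: spn_sum => l _; apply: spn_sum => m _.
  set a := A1 _ _; have sc := size_chi l.
  have c1 : (size (chi (midx i) l) <= k)%N.
    by rewrite -ltnS sc ltnW// ltnS size_midx.
  have c2 : (size (chi (midx i) l ++ [:: m]) <= k)%N.
    by rewrite size_cat addn1 sc size_midx.
  have [c cP] := spnD (spnZ a (spn_monom c2)) (spnZ (a * xhat m 0) (spn_monom c1)).
  exists c => v; rewrite -cP monom_cat /monom big_seq1; ring.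
exists B => x i /=; rewrite BP; apply: eq_bigr => l _; apply: eq_bigr => m _.
by rewrite !mxE.
Qed.

Lemma ext0_mxP (f : 'cV[R]_n -> 'cV[R]_n) (xhat : 'cV[R]_n) :
  ext0_spec k f xhat (ext0_mx k s f xhat).
Proof.
apply: (@xgetPex _ 0 [set B | ext0_spec k f xhat B]).
pose P (i : 'I_D) v := \sum_(l < size (midx i))
  \sum_(m < (k - size (midx i) + 1).+1)
  \sum_(beta : m.-tuple 'I_n | nondecr beta)
    (gam beta)%:R^-1
    * partial beta (fun z => f z (tnth (in_tuple (midx i)) l) 0) xhat
    * monom v (chi (midx i) l) * monom v beta.
have [|B BP] := @rows P xhat.
  move=> i; apply: spn_sum => l _; apply: spn_sum => m _.
  apply: spn_sum => beta _; set a := _ * partial _ _ _.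
  have sc := size_chi l.
  have c1 : (size (chi (midx i) l ++ beta) <= k)%N.
    rewrite size_cat size_tuple; have := ltn_ord m; rewrite ltnS => mk.
    apply: (leq_trans (leq_add (leqnn _) mk)).
    by rewrite addnCA addn1 sc subnK// size_midx.
  have [c cP] := spnZ a (spn_monom c1).
  by exists c => v; rewrite -cP monom_cat mulrA.
by exists B => x i /=; rewrite BP.
Qed.

Let wt (a : seq 'I_n) : nat := (\sum_(i <- a) k.+1 ^ i)%N.

Let digits_inj m (c c' : nat -> nat) :
  (forall r, c r < k.+1)%N -> (forall r, c' r < k.+1)%N ->
  (\sum_(r < m) c r * k.+1 ^ r = \sum_(r < m) c' r * k.+1 ^ r)%N ->
  forall r, (r < m)%N -> c r = c' r.
Proof.
elim: m c c' => [//|m IH] c c' cb cb'.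
rewrite !big_ord_recl /= !expn0 !muln1.
have E (b : nat -> nat) : (\sum_(i < m) b (bump 0 i) * k.+1 ^ bump 0 i =
    (\sum_(i < m) b i.+1 * k.+1 ^ i) * k.+1)%N.
  by rewrite big_distrl; apply: eq_bigr => i _; rewrite /bump /= add1n expnSr mulnA.
rewrite !E => h.
have c0 : c 0%N = c' 0%N.
  have := congr1 (modn^~ k.+1) h.
  by rewrite /= ![(_ + _ * k.+1)%N]addnC !modnMDl !modn_small.
move: h; rewrite c0 => /addnI /eqP; rewrite eqn_pmul2r// => /eqP h.
by case=> [//|r]; rewrite ltnS; apply: (IH (fun r => c r.+1) (fun r => c' r.+1)).
Qed.

Let wtE a : wt a = (\sum_(r < n) count_mem r a * k.+1 ^ r)%N.
Proof.
rewrite /wt; elim: a => [|i a IH]; first by rewrite big_nil big1.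
rewrite big_cons IH [in RHS](eq_bigr (fun r : 'I_n =>
  ((i == r) * k.+1 ^ r + count_mem r a * k.+1 ^ r)%N)); last first.
  by move=> r _; rewrite /= mulnDl.
rewrite big_split /=; congr addn; rewrite (bigD1 i)//= eqxx mul1n big1 ?addn0//.
by move=> r; rewrite eq_sym => /negbTE ->.
Qed.

Let wt_inj a b : a \in s -> b \in s -> wt a = wt b -> a = b.
Proof.
have [_ h _] := sP; rewrite !h !nondecrE => /andP[sa ka] /andP[sb kb].
rewrite !wtE => e; apply: (sorted_eq leqn_trans leqn_anti) => //.
pose c (a : seq 'I_n) (r : nat) := count (fun i : 'I_n => val i == r) a.
have cb x r : (size x <= k)%N -> (c x r < k.+1)%N.
  by rewrite ltnS; apply: leq_trans; exact: count_size.
apply/allP => i _ /=; apply/eqP.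
have := @digits_inj n (c a) (c b) (fun r => cb a r ka) (fun r => cb b r kb) e i.
exact.
Qed.

Lemma monvec_inj (xhat : 'cV[R]_n) (B B' : 'M[R]_D) :
  (forall x, B *m monvec s xhat x = B' *m monvec s xhat x) -> B = B'.
Proof.
move=> eB; apply/matrixP => i j; apply/eqP; rewrite -subr_eq0; apply/eqP.
pose p : {poly R} := \sum_r (B i r - B' i r) *: 'X^(wt (midx r)).
have p0 t : p.[t] = 0.
  have := congr1 (fun v : 'cV_D => v i 0) (eB (\col_r t ^+ (k.+1 ^ r) + xhat)).
  move=> /eqP; rewrite -subr_eq0 => /eqP; rewrite !mxE -sumrB => e.
  rewrite /p horner_sum -[RHS]e; apply: eq_bigr => r _.
  rewrite hornerZ hornerXn mulrBl !mxE addrK.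
  suff -> : monom (\col_r0 t ^+ (k.+1 ^ r0)) (midx r) = t ^+ wt (midx r) by [].
  rewrite /monom /wt; elim: (midx r) => [|x a IH].
    by rewrite !big_nil expr0.
  by rewrite !big_cons exprD IH mxE.
have {}p0 : p = 0.
  apply: (@roots_geq_poly_eq0 _ p [seq m%:R | m <- iota 0 (size p)]).
  - by apply/allP => t _; apply/rootP.
  - by rewrite map_inj_uniq ?iota_uniq// => x y /eqP; rewrite eqr_nat => /eqP.
  - by rewrite size_map size_iota.
have := congr1 (fun q : {poly R} => q`_(wt (midx j))) p0.
rewrite /p coef0 coef_sum (bigD1 j)//= coefZ coefXn eqxx mulr1 big1 ?addr0//.
move=> r rj; rewrite coefZ coefXn; case: eqP => [e|]; last by rewrite mulr0.
case/eqP: rj; apply/val_inj/eqP; have [us _ _] := sP.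
by rewrite -(nth_uniq [::] (ltn_ord r) (ltn_ord j) us) -/(midx r) -/(midx j)
  (wt_inj (midx_in _) (midx_in _) (esym e)).
Qed.

End WellPosed.

Lemma multi_index_listing_ex (n k : nat) : (1 <= k)%N ->
  exists s : seq (seq 'I_n), multi_index_listing k s.
Proof.
move=> k1.
pose tl := flatten [seq [seq tval t | t : m.-tuple 'I_n <- enum {: m.-tuple 'I_n} & nondecr t]
  | m <- iota 0 k.+1].
have tlP (a : seq 'I_n) : (a \in tl) = nondecr a && (size a <= k)%N.
  apply/flatten_mapP/andP => [[m]|[na sa]].
    rewrite mem_iota /= add0n ltnS => mk /mapP[t].
    by rewrite mem_filter => /andP[nt _] ->; rewrite size_tuple.
  exists (size a); first by rewrite mem_iota /= add0n ltnS.
  by apply/mapP; exists (in_tuple a); rewrite // mem_filter mem_enum na.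
pose hd := [::] :: [seq [:: i] | i <- enum 'I_n].
have hdP (a : seq 'I_n) : a \in hd -> nondecr a && (size a <= k)%N.
  by rewrite inE => /orP[/eqP->//|/mapP[i _ ->]]; rewrite /= k1.
exists (hd ++ [seq a <- undup tl | a \notin hd]); split.
- rewrite cat_uniq filter_uniq ?undup_uniq// andbT; apply/andP; split.
    rewrite /hd cons_uniq; apply/andP; split; first by apply/mapP => -[].
    by rewrite map_inj_uniq ?enum_uniq// => i j [].
  by apply/hasPn => a; rewrite mem_filter => /andP[].
- move=> a; rewrite mem_cat mem_filter mem_undup tlP.
  by have [/hdP|] := boolP (a \in hd).
- by exists [seq a <- undup tl | a \notin hd].
Qed.

Section Oscillator.
Context {R : realType} {d : nat}.
Local Notation N := (d + d + 1)%N.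

Definition osc_A (M : 'M[R]_d) : 'M[R]_(d + d) :=
  block_mx 0 1%:M (- M) 0.

Definition osc_A1 (M : 'M[R]_d) : 'M[R]_N :=
  block_mx (osc_A M) 0 0 0.

Definition ypart (x : 'cV[R]_N) : 'cV[R]_d := usubmx (usubmx x).
Definition ppart (x : 'cV[R]_N) : 'cV[R]_d := dsubmx (usubmx x).
Definition tpart (x : 'cV[R]_N) : R := dsubmx x 0 0.

Definition osc_f (g : 'cV[R]_d -> R -> 'cV[R]_d) (eps : R) (x : 'cV[R]_N) :
    'cV[R]_N :=
  col_mx (col_mx 0 (eps *: g (ypart x) (tpart x))) 1%:M.

Definition osc_x0 (eps : R) (y0 dy0 : 'cV[R]_d) : 'cV[R]_N :=
  col_mx (col_mx y0 (eps *: dy0)) 0.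

Definition LLE (k : nat) (s : seq (seq 'I_N)) (M : 'M[R]_d)
    (g : 'cV[R]_d -> R -> 'cV[R]_d) (eps h : R) (y0 dy0 : 'cV[R]_d) (j : nat) :
    'cV[R]_N :=
  iter j (LLE_step k s (osc_A1 M) (osc_f g eps) eps h) (osc_x0 eps y0 dy0).

Definition LLE_error (k : nat) (s : seq (seq 'I_N)) (M : 'M[R]_d)
    (g : 'cV[R]_d -> R -> 'cV[R]_d) (eps h : R) (y0 dy0 : 'cV[R]_d)
    (y dy : R -> 'cV[R]_d) (j : nat) : R :=
  let X := LLE k s M g eps h y0 dy0 j in
  enorm (ypart X - y (j%:R * h)) +
  eps * enorm (eps^-1 *: ppart X - dy (j%:R * h)).

End Oscillator.

(* Main.v *)
(* Along the exact solution x, centre the monomials of degree at most k at the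
   numerical value X_n and subtract exp(s B) e_1, with B = A_1/eps + A_0 the matrix
   of the scheme. The difference e satisfies e' = B e + defect, where the defect
   only contains Taylor remainders of the nonlinearity and is
   O(eps |x - X_n|^(k+1)), because g enters multiplied by eps. The numerical
   solution stays O(eps) in (y, p), hence up to bounded terms B is K/eps where K is
   the extension matrix of A_1 centred at 0. The flow of K is the action of the
   energy preserving flow of A_1 on monomials, so it is bounded, and e is
   controlled uniformly in eps. The components of degree one then solve a linear
   equation with the skew stiff part A/eps, and the energy norm turns it into the
   recursion u_(n+1) <= (1 + C h) u_n + C eps h^(k+2), the time component of the
   error being zero. For the second bound the defect is integrated by parts against
   the oscillation: A^-1 costs a factor eps and differentiates the defect, which
   lowers its order in h by one. *)

(* Each step needs two estimates, as neither suffices alone. Boundedness of the flow of K controls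
   all monomial components, but with a multiplicative constant that cannot be iterated over T/h
   steps. The energy norm propagates the degree-one components with factor exactly 1, but their
   equation contains the higher components; the first bound therefore enters the second only as a
   forcing, with a factor eps. Powers of h appear because the energy condition makes A_1 x / eps
   bounded: the exact solution moves with a speed independent of eps, so |x - X_n| is O(h) plus the
   current error. The constants depend on a bound rho for the ratio of the error to eps, which is
   part of what is to be proved; the recursion has to break this circle. Since g is controlled only
   for t in [0, T], with order-k derivatives merely Lipschitz, symmetry of mixed derivatives and the
   Taylor formula are proved on this slab by mean value arguments along one coordinate at a time. In
   the second bound the boundary terms are estimated within each step: at both ends the Taylor
   remainder is O(h^(k+1)), which already contains the factor h needed for summation. *)
Require Import Defs.
From mathcomp Require Import all_boot all_order all_algebra.
From mathcomp Require Import all_classical all_reals all_analysis.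
From mathcomp Require Import ring lra zify.

Set Implicit Arguments.
Unset Strict Implicit.
Unset Printing Implicit Defensive.

Import Order.TTheory GRing.Theory Num.Theory numFieldNormedType.Exports.
Local Open Scope classical_set_scope.
Local Open Scope ring_scope.

(** * Derivatives on an interval *)

Section DeriveOn.
Context {R : realType}.
Implicit Types (A B : set R) (f g : R -> R) (t l m : R).

Lemma is_derive_onP A f t l : is_derive_on A f t l <->
  (f s - f t) / (s - t) @[s --> within A t^'] --> l.
Proof.
rewrite /is_derive_on; split; apply: cvg_trans; apply: near_eq_cvg;
  by apply: nearW => s; rewrite /= mulrC.
Qed.

Lemma eq_near_cvg (T U : topologicalType) (F : set_system T) {FF : Filter F}
    (f g : T -> U) (l : U) :
  g @ F --> l -> (\forall x \near F, f x = g x) -> f @ F --> l.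
Proof.
move=> gl fg; apply: cvg_trans gl; apply: near_eq_cvg.
by apply: filterS fg => x ->.
Qed.

Lemma within_dnbhs_cvg A f t : f s @[s --> within A t^'] --> f t ->
  f s @[s --> within A (nbhs t)] --> f t.
Proof.
move=> /cvgrPdist_lt h; apply/cvgrPdist_lt => e e0.
have := h e e0; rewrite !near_withinE near_simpl; apply: filterS => s hs As.
by have [->|st] := eqVneq s t; [rewrite subrr normr0|exact: hs].
Qed.

Lemma is_derive_on_cont A f t l : is_derive_on A f t l ->
  f s @[s --> within A t^'] --> f t.
Proof.
move=> /is_derive_onP h.
have idc : (fun s : R => s - t) @ within A t^' --> (0 : R).
  rewrite -[X in _ --> X](subrr t); apply: cvgB; last exact: cvg_cst.
  by move=> P Pt; apply: cvg_within; exact: nbhs_dnbhs.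
have H := [elaborate cvgD (cvgM h idc) (cvg_cst (f t))].
rewrite mulr0 add0r in H; apply: (eq_near_cvg H); rewrite near_withinE.
near=> s => As /=; rewrite fctE /= divfK ?subrK// subr_eq0.
by near: s; exact: nbhs_dnbhs_neq.
Unshelve. all: by end_near. Qed.

Lemma is_derive_on_within_cont A f t l : is_derive_on A f t l ->
  f s @[s --> within A (nbhs t)] --> f t.
Proof. by move=> /is_derive_on_cont/within_dnbhs_cvg. Qed.

Lemma is_derive_on_subset A B f t l : B `<=` A ->
  is_derive_on A f t l -> is_derive_on B f t l.
Proof.
move=> BA; apply: cvg_trans; apply: cvg_app; exact: within_subset.
Qed.

Lemma is_derive_on_eq A f g t l : (forall s, A s -> f s = g s) -> A t ->
  is_derive_on A f t l -> is_derive_on A g t l.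
Proof.
move=> fg At; apply: cvg_trans; apply: near_eq_cvg; rewrite near_withinE.
by apply: nearW => s As; rewrite !fg.
Qed.

Lemma is_derive_on_is_derive A f t l : is_derive t 1 f l -> is_derive_on A f t l.
Proof.
move=> /is_derive1_caratheodory[g [fg gc <-]]; apply/is_derive_onP.
apply: (@cvg_trans _ (g @ within A t^')); last first.
  apply: cvg_trans gc; apply: cvg_app.
  by move=> P Pt; apply: cvg_within; exact: nbhs_dnbhs.
apply: near_eq_cvg; rewrite near_withinE.
near=> s => As /=; rewrite fg mulfK // subr_eq0.
by near: s; exact: nbhs_dnbhs_neq.
Unshelve. all: by end_near. Qed.

Lemma is_derive_on_cst A t l : is_derive_on A (fun=> l) t 0.
Proof. by apply: is_derive_on_is_derive; exact: is_derive_cst. Qed.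

Lemma is_derive_on_id A t : is_derive_on A id t 1.
Proof. by apply: is_derive_on_is_derive; exact: is_derive_id. Qed.

Lemma is_derive_onD A f g t l m : is_derive_on A f t l -> is_derive_on A g t m ->
  is_derive_on A (fun s => f s + g s) t (l + m).
Proof.
move=> /is_derive_onP hf /is_derive_onP hg; apply/is_derive_onP.
have H := [elaborate cvgD hf hg].
apply: (eq_near_cvg H).
by apply: nearW => s /=; rewrite -mulrDl opprD addrACA.
Qed.

Lemma is_derive_onM A f g t l m : is_derive_on A f t l -> is_derive_on A g t m ->
  is_derive_on A (fun s => f s * g s) t (l * g t + f t * m).
Proof.
move=> hf hg; have gc := is_derive_on_cont hg.
move: hf hg => /is_derive_onP hf /is_derive_onP hg; apply/is_derive_onP.
have H := [elaborate cvgD (cvgM hf gc) (cvgM (cvg_cst (f t)) hg)].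
apply: (eq_near_cvg H).
by apply: nearW => s; rewrite fctE /=; ring.
Qed.

Lemma is_derive_onZ A f t l m : is_derive_on A f t l ->
  is_derive_on A (fun s => m * f s) t (m * l).
Proof.
by move=> hf; have := is_derive_onM (is_derive_on_cst A t m) hf; rewrite mul0r add0r.
Qed.

Lemma is_derive_onN A f t l : is_derive_on A f t l ->
  is_derive_on A (fun s => - f s) t (- l).
Proof.
move=> /(@is_derive_onZ _ _ _ _ (-1)); rewrite mulN1r.
by congr is_derive_on; apply/funext => s; rewrite mulN1r.
Qed.

Lemma is_derive_onB A f g t l m : is_derive_on A f t l -> is_derive_on A g t m ->
  is_derive_on A (fun s => f s - g s) t (l - m).
Proof. by move=> hf /is_derive_onN; exact: is_derive_onD. Qed.

Lemma is_derive_on_sum (I : Type) (r : seq I) (P : pred I) A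
    (f : I -> R -> R) (l : I -> R) t :
  (forall i, P i -> is_derive_on A (f i) t (l i)) ->
  is_derive_on A (fun s => \sum_(i <- r | P i) f i s) t (\sum_(i <- r | P i) l i).
Proof.
move=> h; elim: r => [|i r IH].
  rewrite big_nil (_ : (fun s => _) = fun=> 0); first exact: is_derive_on_cst.
  by apply/funext => s; rewrite big_nil.
rewrite (_ : (fun s => _) = (fun s => (if P i then f i s else 0) +
  \sum_(j <- r | P j) f j s)); last first.
  by apply/funext => s; rewrite big_cons; case: ifP => // _; rewrite add0r.
rewrite big_cons; case: ifPn => Pi.
  by apply: is_derive_onD => //; exact: h.
rewrite -[X in is_derive_on _ _ _ X]add0r; apply: is_derive_onD => //.
exact: is_derive_on_cst.
Qed.

Lemma is_derive_on_comp A f g t l m : is_derive (f t) 1 g m ->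
  is_derive_on A f t l -> is_derive_on A (fun s => g (f s)) t (m * l).
Proof.
move=> /is_derive1_caratheodory[g1 [gg1 g1c <-]] hf.
have fc := is_derive_on_cont hf; move/is_derive_onP: hf => hf.
apply/is_derive_onP.
have g1f : g1 (f s) @[s --> within A t^'] --> g1 (f t).
  exact: cvg_comp fc g1c.
have H := [elaborate cvgM g1f hf].
apply: (eq_near_cvg H).
by apply: nearW => s /=; rewrite gg1 mulrA.
Qed.

Lemma is_derive_on_coord n A (F : R -> 'cV[R]_n) t L i :
  is_derive_on A F t L -> is_derive_on A (fun s => F s i 0) t (L i 0).
Proof.
rewrite /is_derive_on => h.
have := cvg_comp _ _ h (@coord_continuous R n 1 i 0 L).
by apply: cvg_trans; apply: near_eq_cvg; apply: nearW => s; rewrite /= !mxE.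
Qed.

Lemma is_derive_on_interior A f t l : nbhs t A -> is_derive_on A f t l ->
  is_derive t 1 f l.
Proof.
move=> At /is_derive_onP ht; apply/is_derive1_caratheodory.
exists (fun z => if z == t then l else (f z - f t) / (z - t)); split.
- move=> z; case: eqP => [->|/eqP]; first by rewrite !subrr mulr0.
  by rewrite -subr_eq0 => /divfK->.
- apply/cvgrPdist_lt => e e0; move/cvgrPdist_lt : ht => /(_ e e0).
  rewrite near_withinE near_simpl eqxx.
  rewrite /dnbhs near_withinE => ht.
  near=> s; case: (eqVneq s t) => [_|st]; first by rewrite subrr normr0.
  by move: st; near: s; apply: filterS2 ht At => s hs As st; apply: hs.
- by rewrite eqxx.
Unshelve. all: by end_near. Qed.

(** A derivative relative to [[a, b]] is two-sided at interior points and gives continuity up to the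
    ends, which is what the usual mean value theorem asks for. *)
Lemma MVT_on a b f f' : a <= b ->
  (forall t, a <= t <= b -> is_derive_on `[a, b] f t (f' t)) ->
  exists2 c, a <= c <= b & f b - f a = f' c * (b - a).
Proof.
move=> ab h.
have [|||c] := @MVT_segment R f f' a b => //.
- move=> x xab; apply: (@is_derive_on_interior `[a, b]).
    by apply: filterS (near_in_itvoo xab) => s; exact: subset_itv_oo_cc.
  by apply: h; move: xab; rewrite in_itv /= => /andP[ax xb]; rewrite !ltW.
- apply/subspace_continuousP => x xab.
  by apply: is_derive_on_within_cont; apply: h; move: xab; rewrite /= in_itv.
- by rewrite in_itv /=; exists c.
Qed.

End DeriveOn.

(** * Growth estimates from the mean value theorem *)

Section Growth.
Context {R : realType}.

Lemma MVT_on_le (a b B : R) (f f' : R -> R) : a <= b ->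
  (forall t, a <= t <= b -> is_derive_on `[a, b] f t (f' t)) ->
  (forall t, a <= t <= b -> `|f' t| <= B) -> `|f b - f a| <= B * (b - a).
Proof.
move=> ab h hB; have [c cab ->] := MVT_on ab h.
by rewrite normrM (ger0_norm (_ : 0 <= b - a)) ?subr_ge0// ler_wpM2r ?subr_ge0// hB.
Qed.

(* The regularisation [sqrt (phi + eta^2)] is differentiable even where [phi]
   vanishes. *)
Lemma sqrt_growth (a b c B : R) (phi phi' : R -> R) : a <= b -> 0 <= c -> 0 <= B ->
  (forall t, a <= t <= b -> is_derive_on `[a, b] phi t (phi' t)) ->
  (forall t, a <= t <= b -> 0 <= phi t) ->
  (forall t, a <= t <= b ->
     phi' t <= 2 * Num.sqrt (phi t) * (c * Num.sqrt (phi t) + B)) ->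
  Num.sqrt (phi b) <= expR (c * (b - a)) * (Num.sqrt (phi a) + B * (b - a)).
Proof.
move=> ab c0 B0 dphi phi0 phile; apply/ler_addgt0Pr => e e0.
(* Chosen so that the regularisation costs exactly [e] after multiplication by the final
   exponential. *)
pose eta := e / expR (c * (b - a)).
have eta0 : 0 < eta by rewrite divr_gt0// expR_gt0.
pose s t := Num.sqrt (phi t + eta ^+ 2).
have pos t : a <= t <= b -> 0 < phi t + eta ^+ 2.
  by move=> tab; rewrite ltr_wpDl ?phi0// exprn_gt0.
pose E t := expR (- c * (t - a)).
(* [psi] is nonincreasing: the hypothesis gives [s' <= c s + B], the decaying factor [E] cancels
   [c s], and [E <= 1] leaves [E B - B <= 0]. *)
pose psi t := E t * s t - B * t.
pose psi' t := (E t * - c) * s t + E t * ((2 * s t)^-1 * phi' t) - B.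
have dpsi t : a <= t <= b -> is_derive_on `[a, b] psi t (psi' t).
  move=> tab; apply: is_derive_onB; last first.
    by rewrite -[X in is_derive_on _ _ _ X]mulr1; apply/is_derive_onZ/is_derive_on_id.
  apply: is_derive_onM.
    apply: (@is_derive_on_comp _ _ (fun t => - c * (t - a)) expR).
    rewrite -[X in is_derive_on _ _ _ X]mulr1; apply: is_derive_onZ.
    rewrite -[X in is_derive_on _ _ _ X]subr0; apply: is_derive_onB.
      exact: is_derive_on_id.
    exact: is_derive_on_cst.
  apply: (@is_derive_on_comp _ _ (fun t => phi t + eta ^+ 2) Num.sqrt).
    by apply: is_derive1_sqrt; exact: pos.
  rewrite -[X in is_derive_on _ _ _ X]addr0; apply: is_derive_onD; first exact: dphi.
  exact: is_derive_on_cst.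
have psi'_le0 t : a <= t <= b -> psi' t <= 0.
  move=> tab; rewrite /psi'.
  have st0 : 0 < s t by rewrite sqrtr_gt0 pos.
  have E0 : 0 < E t by exact: expR_gt0.
  have E1 : E t <= 1.
    rewrite /E -expR0 ler_expR mulNr oppr_le0 mulr_ge0// subr_ge0.
    by case/andP: tab.
  have rs : Num.sqrt (phi t) <= s t.
    by rewrite ler_wsqrtr// lerDl sqr_ge0.
  have r0 := sqrtr_ge0 (phi t).
  have ph := phile t tab.
  set r := Num.sqrt _ in rs r0 ph.
  have k : (2 * s t)^-1 * phi' t <= c * s t + B.
    rewrite mulrC ler_pdivrMr ?mulr_gt0//; apply: (le_trans ph).
    have -> : (c * s t + B) * (2 * s t) = 2 * s t * (c * s t + B) by ring.
    apply: ler_pM; rewrite ?mulr_ge0 ?addr_ge0 ?mulr_ge0//.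
    - by rewrite ler_pM2l.
    - by rewrite lerD2r ler_wpM2l.
  have : E t * ((2 * s t)^-1 * phi' t) <= E t * (c * s t + B) by rewrite ler_pM2l.
  have : E t * B <= B by rewrite ler_piMl.
  nra.
have [d dab] := MVT_on ab dpsi.
move=> /eqP; rewrite subr_eq => /eqP psib.
have : psi b <= psi a.
  by rewrite psib gerDr mulr_le0_ge0 ?psi'_le0 ?subr_ge0.
rewrite /psi {2}/E subrr mulr0 expR0 mul1r => h.
have sb : Num.sqrt (phi b) <= s b by rewrite ler_wsqrtr// lerDl sqr_ge0.
have sa : s a <= Num.sqrt (phi a) + eta.
  rewrite -(ler_pXn2r (n := 2)) ?nnegrE ?addr_ge0 ?sqrtr_ge0 ?(ltW eta0)//.
  have aab : a <= a <= b by rewrite lexx.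
  rewrite sqr_sqrtr ?(ltW (pos _ _))// sqrrD sqr_sqrtr ?phi0//.
  by rewrite lerD2r lerDl mulrn_wge0// mulr_ge0 ?sqrtr_ge0// ltW.
have Eb : expR (c * (b - a)) * E b = 1 by rewrite -expRD mulNr subrr expR0.
apply: (le_trans sb); rewrite -[s b]mul1r -Eb -mulrA.
have -> : expR (c * (b - a)) * (Num.sqrt (phi a) + B * (b - a)) + e =
   expR (c * (b - a)) * (Num.sqrt (phi a) + eta + B * (b - a)).
  rewrite /eta; field; exact: lt0r_neq0 (expR_gt0 _).
rewrite ler_pM2l ?expR_gt0//; lra.
Qed.

End Growth.

(** * Matrix exponential and linear equations *)

Section MatrixNorm.
Context {R : realType} {m n : nat}.
Implicit Types A : 'M[R]_(m, n).

Lemma ler_mx_norm_coord A i j : `|A i j| <= `|A|.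
Proof.
rewrite [leRHS]/Num.norm /= mx_normrE.
exact: (le_bigmax _ (fun ij : 'I_m * 'I_n => `|A ij.1 ij.2|) (i, j)).
Qed.

Lemma mx_norm_le A b : 0 <= b -> (forall i j, `|A i j| <= b) -> `|A| <= b.
Proof.
by move=> b0 h; rewrite [leLHS]/Num.norm /= mx_normrE bigmax_le// => i _; exact: h.
Qed.

Lemma cvg_mx (T : Type) (F : set_system T) {FF : Filter F} (f : T -> 'M[R]_(m, n))
    (L : 'M[R]_(m, n)) :
  (forall i j, f x i j @[x --> F] --> L i j) -> f x @[x --> F] --> L.
Proof.
move=> h; apply/cvgrPdist_le => e e0; near=> x.
apply: mx_norm_le => [|i j]; first exact: ltW.
rewrite !mxE; move: i j; near: x.
apply: filter_forall => i; apply: filter_forall => j.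
by have /cvgrPdist_le := h i j; apply.
Unshelve. all: by end_near. Qed.

End MatrixNorm.

Lemma mulmx_norm_coord (R : realType) m n p (A : 'M[R]_(m, n)) (B : 'M[R]_(n, p)) i j
    a b : 0 <= a -> 
  (forall i j, `|A i j| <= a) -> (forall i j, `|B i j| <= b) ->
  `|(A *m B) i j| <= n%:R * (a * b).
Proof.
move=> a0 hA hB; rewrite mxE; apply: (le_trans (ler_norm_sum _ _ _)).
apply: (@le_trans _ _ (\sum_(k < n) a * b)).
  by apply: ler_sum => k _; rewrite normrM ler_pM.
by rewrite sumr_const card_ord mulr_natl.
Qed.

Lemma exprmxZ (R : realType) n (B : 'M[R]_n) t m : (t *: B) ^+ m = t ^+ m *: B ^+ m.
Proof.
elim: m => [|m IH]; first by rewrite !expr0 scale1r.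
by rewrite !exprS IH -[_ * _]/(_ *m _) -scalemxAl -scalemxAr scalerA.
Qed.

Lemma cvg_rsum (R : realType) (T I : Type) (F : set_system T) {FF : Filter F}
    (r : seq I) (f : I -> T -> R) (l : I -> R) :
  (forall i, f i x @[x --> F] --> l i) ->
  \sum_(i <- r) f i x @[x --> F] --> \sum_(i <- r) l i.
Proof.
move=> h; elim: r => [|i r IH].
  rewrite big_nil (_ : (fun x => _) = fun=> 0); first exact: cvg_cst.
  by apply/funext => x; rewrite big_nil.
rewrite big_cons (_ : (fun x => _) = fun x => f i x + \sum_(j <- r) f j x).
  exact: cvgD.
by apply/funext => x; rewrite big_cons.
Qed.

Lemma cvg_pseries_sum (R : realType) n (a : 'I_n -> R) (c : 'I_n -> nat -> R) t :
  (forall l, cvgn (pseries (c l) t)) ->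
  pseries (fun m => \sum_l a l * c l m) t @ \oo -->
    \sum_l a l * limn (pseries (c l) t).
Proof.
move=> h.
rewrite (_ : pseries _ t = fun k => \sum_l a l * pseries (c l) t k).
  by apply: cvg_rsum => l; apply: cvgMl_tmp; exact: h.
apply/funext => k; rewrite /pseries /series /=.
under [RHS]eq_bigr do rewrite mulr_sumr.
rewrite exchange_big /=; apply: eq_bigr => m _; rewrite mulr_suml.
by apply: eq_bigr => l _; rewrite mulrA.
Qed.

Section Expm.
Context {R : realType} {n : nat} (B : 'M[R]_n).

(** Entrywise, the exponential of [t *: B] is a scalar power series in [t] with these coefficients,
    so it can be differentiated by the termwise theorem for real power series. *)
Definition expm_coef i j (m : nat) : R := m`!%:R^-1 * (B ^+ m) i j.

Lemma expmx_coord_le : exists2 b, 0 <= b &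
  forall m i j, `|(B ^+ m) i j| <= b ^+ m.
Proof.
exists (n%:R * `|B|) => [|m]; first by rewrite mulr_ge0.
elim: m => [|m IH] i j.
  by rewrite expr0 mxE; case: eqP; rewrite ?normr1 ?normr0.
rewrite exprS -[_ * _]/(_ *m _).
rewrite [leRHS]exprS -mulrA.
apply: mulmx_norm_coord => //; exact: ler_mx_norm_coord.
Qed.

Lemma is_cvg_expm_coef i j t : cvgn (pseries (expm_coef i j) t).
Proof.
have [b b0 hb] := expmx_coord_le.
apply: normed_cvg; apply: (series_le_cvg _ _ _ (is_cvg_series_exp_coeff (b * `|t|))).
- by move=> m /=.
- by move=> m; rewrite /exp_coeff /= mulr_ge0// ?invr_ge0// exprn_ge0// mulr_ge0.
- move=> m; rewrite /exp_coeff /expm_coef /= normrM normrX normrM ger0_norm ?invr_ge0//.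
  by rewrite exprMn [leRHS]mulrC mulrA ler_wpM2r ?exprn_ge0// ler_wpM2l ?invr_ge0.
Qed.

Lemma expmE t i j : expm (t *: B) i j = limn (pseries (expm_coef i j) t).
Proof.
pose L := \matrix_(i, j) limn (pseries (expm_coef i j) t).
suff -> : expm (t *: B) = L by rewrite mxE.
apply/cvg_lim; first exact: norm_hausdorff; apply: cvg_mx => {}i {}j; rewrite mxE.
apply: (eq_near_cvg (is_cvg_expm_coef (i := i) (j := j) (t := t))).
apply: nearW => k.
rewrite /pseries /series /= summxE; apply: eq_bigr => m _.
by rewrite exprmxZ !mxE /expm_coef mulrCA mulrC.
Qed.

Lemma pseries_diffs_expm i j : pseries_diffs (expm_coef i j) =
  (fun m => \sum_l B i l * expm_coef l j m).
Proof.
apply/funext => m; rewrite /pseries_diffs /expm_coef exprS -[B * _]/(B *m _) mxE.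
rewrite factS natrM invfM !mulrA divff ?mul1r ?pnatr_eq0// mulr_sumr.
by apply: eq_bigr => l _; rewrite mulrCA.
Qed.

End Expm.

Lemma is_derive_expm (R : realType) n (B : 'M[R]_n) i j (t : R) :
  is_derive t 1 (fun t => expm (t *: B) i j) ((B *m expm (t *: B)) i j).
Proof.
have H l K : pseries (expm_coef B l j) K @ \oo --> limn (pseries (expm_coef B l j) K).
  exact: is_cvg_expm_coef.
(* Termwise differentiation requires convergence of the first and second derived series. Each
   derivation multiplies the coefficients by [B], so both reduce to the original series. *)
have dH l K : pseries (pseries_diffs (expm_coef B l j)) K @ \oo -->
    \sum_p B l p * limn (pseries (expm_coef B p j) K).
  by rewrite pseries_diffs_expm; exact: cvg_pseries_sum.
have ddH K : cvgn (pseries (pseries_diffs (pseries_diffs (expm_coef B i j))) K).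
  apply/cvg_ex; exists (\sum_p B i p * limn (pseries (pseries_diffs (expm_coef B p j)) K)).
  rewrite (_ : pseries_diffs (pseries_diffs _) =
      fun m => \sum_l B i l * pseries_diffs (expm_coef B l j) m).
    by apply: cvg_pseries_sum => p; apply/cvg_ex; eexists; exact: dH.
  apply/funext => m; rewrite {1}/pseries_diffs pseries_diffs_expm mulr_sumr.
  by apply: eq_bigr => l _; rewrite mulrCA.
rewrite (_ : (fun t => expm (t *: B) i j) = fun t => limn (pseries (expm_coef B i j) t));
  last by apply/funext => u; rewrite expmE.
rewrite (_ : (B *m _) i j = limn (pseries (pseries_diffs (expm_coef B i j)) t)).
  apply: (@pseries_snd_diffs _ _ (`|t| + 1)) (ddH _) _.
  - exact: is_cvg_expm_coef.
  - by apply/cvg_ex; eexists; exact: (dH i).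
  - by rewrite [ltRHS]ger0_norm ?ltrDl// addr_ge0.
rewrite mxE; symmetry.
under eq_bigr do rewrite expmE.
by apply/cvg_lim; [exact: Rhausdorff|exact: (dH i)].
Qed.

Lemma expm0 (R : realType) n : expm (0 : 'M[R]_n) = 1%:M.
Proof.
apply/matrixP => i j; rewrite -(scale0r 0) expmE; apply/cvg_lim; first exact: norm_hausdorff.
apply: (@cvg_near_cst _ _ _ _ _) => //.
exists 1%N => // k /= k1; rewrite /pseries /series /=.
rewrite big_ltn// big_nat_cond big1 => [|m /andP[/andP[m0 _] _]].
  by rewrite /expm_coef fact0 invr1 !expr0 mulr1 mul1r addr0.
by rewrite -(prednK m0) exprS mul0r mulr0.
Qed.

Section ExpmGroup.
Context {R : realType} {n : nat} (B : 'M[R]_n).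
Implicit Types (A : set R) (e de : R -> 'cV[R]_n) (t c a : R).

Lemma expm_comm t : expm (t *: B) *m B = B *m expm (t *: B).
Proof.
have ccv i j : cvgn (pseries (expm_coef B i j) t) by exact: is_cvg_expm_coef.
apply/matrixP => i j; rewrite !mxE.
transitivity (\sum_l B l j * limn (pseries (expm_coef B i l) t)).
  by apply: eq_bigr => l _; rewrite expmE mulrC.
have h1 := @cvg_pseries_sum R n (fun l => B l j) _ t (fun l => ccv i l).
have h2 := @cvg_pseries_sum R n (fun l => B i l) _ t (fun l => ccv l j).
under [RHS]eq_bigr do rewrite expmE.
apply: (cvg_unique _ h1); first exact: norm_hausdorff.
suff -> : (fun m => \sum_l B l j * expm_coef B i l m) =
  (fun m => \sum_l B i l * expm_coef B l j m) by exact: h2.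
apply/funext => m; rewrite /expm_coef.
transitivity (m`!%:R^-1 * (B *m B ^+ m) i j); last first.
  by rewrite mxE mulr_sumr; apply: eq_bigr => l _; rewrite mulrCA.
have -> : B *m B ^+ m = B ^+ m *m B by rewrite -[LHS]exprS exprSr.
by rewrite mxE mulr_sumr; apply: eq_bigr => l _; ring.
Qed.

(* Variation of constants in differential form. *)
Lemma is_derive_on_expm_mul A e de c a t i :
  (forall j, is_derive_on A (fun s => e s j 0) t (de t j 0)) ->
  is_derive_on A (fun s => (expm ((c * (s - a)) *: B) *m e s) i 0) t
    ((expm ((c * (t - a)) *: B) *m (de t + c *: (B *m e t))) i 0).
Proof.
move=> he; have dlin : is_derive_on A (fun s => c * (s - a)) t c.
  rewrite -[X in is_derive_on _ _ _ X]mulr1; apply: is_derive_onZ.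
  rewrite -[X in is_derive_on _ _ _ X]subr0; apply: is_derive_onB.
    exact: is_derive_on_id.
  exact: is_derive_on_cst.
pose E s := expm ((c * (s - a)) *: B).
have dE l : is_derive_on A (fun s => E s i l) t ((B *m E t) i l * c).
  apply: (@is_derive_on_comp _ _ (fun s => c * (s - a)) (fun s => expm (s *: B) i l)) => //.
  exact: is_derive_expm.
rewrite (_ : (fun s => _) = fun s => \sum_l E s i l * e s l 0); last first.
  by apply/funext => s; rewrite mxE.
rewrite (_ : (expm _ *m _) i 0 =
    \sum_l ((B *m E t) i l * c * e t l 0 + E t i l * de t l 0)).
  by apply: is_derive_on_sum => l _; exact: is_derive_onM.
rewrite -/(E t) mulmxDr mxE addrC big_split /=; congr (_ + _); last by rewrite mxE.
rewrite -scalemxAr mxE mulmxA expm_comm mxE mulr_sumr.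
by apply: eq_bigr => l _; rewrite /E; ring.
Qed.

Lemma is_derive_on_cst_eq (f : R -> R) s t :
  (forall r, is_derive_on setT f r 0) -> f s = f t.
Proof.
move=> h; wlog st : s t / s <= t.
  by move=> H; case: (leP s t) => [/H //|/ltW/H].
have [r _|r _] := @MVT_on R s t f (fun=> 0) st.
  by apply: is_derive_on_subset (h r).
by rewrite mul0r => /eqP; rewrite subr_eq0 => /eqP.
Qed.

Lemma ode_expm e t :
  (forall s i, is_derive_on setT (fun s => e s i 0) s ((B *m e s) i 0)) ->
  expm (- t *: B) *m e t = e 0.
Proof.
move=> he; apply/colP => i.
have := @is_derive_on_cst_eq (fun s => (expm ((-1 * (s - 0)) *: B) *m e s) i 0) t 0.
rewrite !subr0 mulr0 mulN1r scale0r expm0 mul1mx; apply => r.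
have := @is_derive_on_expm_mul setT e (fun s => B *m e s) (-1) 0 r i (he r).
by rewrite scaleN1r subrr mulmx0 mxE.
Qed.

(** Every column of [expm (t *: B)] solves [e' = B e], so [ode_expm] returns its value at 0, a
    column of the identity. This replaces a Cauchy product of series. *)
Lemma expm_mulN t : expm (- t *: B) *m expm (t *: B) = 1%:M.
Proof.
have h j : expm (- t *: B) *m col j (expm (t *: B)) = col j 1%:M.
  rewrite (@ode_expm (fun s => col j (expm (s *: B)))) ?scale0r ?expm0// => s i.
  rewrite (_ : (B *m _) i 0 = (B *m expm (s *: B)) i j).
    rewrite (_ : (fun _ => _) = fun s => expm (s *: B) i j).
      by apply: is_derive_on_is_derive; exact: is_derive_expm.
    by apply/funext => u; rewrite mxE.
  by rewrite colE mulmxA -colE mxE.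
apply/matrixP => i j; have /colP/(_ i) := h j.
by rewrite colE mulmxA -colE !mxE.
Qed.

Lemma ode_expmE e t :
  (forall s i, is_derive_on setT (fun s => e s i 0) s ((B *m e s) i 0)) ->
  e t = expm (t *: B) *m e 0.
Proof.
move=> he; have h := ode_expm t he.
have hN : expm (t *: B) *m expm (- t *: B) = 1%:M by have := expm_mulN (- t); rewrite opprK.
by rewrite -[LHS]mul1mx -hN -mulmxA; congr (_ *m _); exact: h.
Qed.

End ExpmGroup.

(** * Energy estimates *)

Section PosDef.
Context {R : realType} {n : nat}.
Implicit Types (G A : 'M[R]_n) (u v w : 'cV[R]_n).

Definition bil G u v : R := (u^T *m G *m v) 0 0.

Lemma bilDr G u v w : bil G u (v + w) = bil G u v + bil G u w.
Proof. by rewrite /bil mulmxDr mxE. Qed.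

Lemma bilZr G u c v : bil G u (c *: v) = c * bil G u v.
Proof. by rewrite /bil -scalemxAr mxE. Qed.

Lemma bilC G u v : G^T = G -> bil G u v = bil G v u.
Proof.
move=> GT; rewrite /bil (_ : u^T *m G *m v = (v^T *m G *m u)^T) 1?mxE//.
by rewrite !trmx_mul trmxK GT mulmxA.
Qed.

Lemma bilE G u v : bil G u v = \sum_j \sum_i u i 0 * G i j * v j 0.
Proof.
rewrite /bil mxE; apply: eq_bigr => j _; rewrite mxE mulr_suml.
by apply: eq_bigr => i _; rewrite mxE.
Qed.

Lemma unitmx_ker A : (forall v, A *m v = 0 -> v = 0) -> A \in unitmx.
Proof.
move=> h; rewrite unitmxE unitfE -det_tr; apply/det0P => -[v v0 /(congr1 trmx)].
rewrite trmx_mul trmxK trmx0 => /h /(congr1 trmx); rewrite trmxK trmx0.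
by move/eqP; rewrite (negbTE v0).
Qed.

Section SymPosDef.
Variable G : 'M[R]_n.
Hypothesis hG : sym_posdef G.

Lemma quad_ge0 v : 0 <= quad G v.
Proof.
have [_ h] := hG; have [->|/h/ltW//] := eqVneq v 0.
by rewrite /quad mulmx0 mxE.
Qed.

Lemma quad_eq0 v : quad G v = 0 -> v = 0.
Proof.
have [_ h] := hG; have [->//|/h/gt_eqF] := eqVneq v 0.
by move=> /eqP.
Qed.

Lemma posdef_unit : G \in unitmx.
Proof.
apply: unitmx_ker => v Gv; apply: quad_eq0.
by rewrite /quad -mulmxA Gv mulmx0 mxE.
Qed.

Lemma quadD u v c : quad G (u + c *: v) = quad G u + 2 * c * bil G u v + c ^+ 2 * quad G v.
Proof.
have [GT _] := hG.
rewrite -![quad G _]/(bil G _ _) bilDr bilZr bilC// [X in _ + c * X]bilC// !bilDr !bilZr.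
rewrite (bilC v u)//; ring.
Qed.

Lemma bil_CS u v : `|bil G u v| <= Num.sqrt (quad G u) * Num.sqrt (quad G v).
Proof.
rewrite -sqrtrM ?quad_ge0// -sqrtr_sqr ler_wsqrtr//.
have [v0|v0] := eqVneq (quad G v) 0.
  by rewrite (quad_eq0 v0) /quad /bil !mulmx0 mxE mulr0 expr2 mulr0.
have qv : 0 < quad G v by rewrite lt0r v0 quad_ge0.
(* The point of the line through [u] in direction [v] at which [quad G] is minimal. *)
have := quad_ge0 (u + (- bil G u v / quad G v) *: v); rewrite quadD => h.
rewrite -subr_ge0.
have -> : quad G u * quad G v - bil G u v ^+ 2 = quad G v * (quad G u +
    2 * (- bil G u v / quad G v) * bil G u v + (- bil G u v / quad G v) ^+ 2 * quad G v).
  by field.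
by rewrite mulr_ge0// ltW.
Qed.

(** The coordinate [v i 0] is the [G]-inner product of [v] with [invmx G *m delta_mx i 0], so
    Cauchy-Schwarz gives coercivity without eigenvalues or compactness. *)
Lemma posdef_coercive : exists2 c, 0 <= c & forall v, `|v| <= c * Num.sqrt (quad G v).
Proof.
have Gu := posdef_unit; have [GT _] := hG.
pose b i := Num.sqrt (quad G (invmx G *m delta_mx i 0)).
exists (\sum_i b i) => [|v]; first by apply: sumr_ge0 => i _; exact: sqrtr_ge0.
have s0 : 0 <= \sum_i b i by apply: sumr_ge0 => i _; exact: sqrtr_ge0.
apply: mx_norm_le => [|i j]; first by rewrite mulr_ge0// sqrtr_ge0.
rewrite (ord1 j).
have -> : v i 0 = bil G (invmx G *m delta_mx i 0) v.
  by rewrite bilC// /bil -mulmxA mulKVmx// -colE !mxE.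
apply: (le_trans (bil_CS _ _)); rewrite ler_wpM2r ?sqrtr_ge0//.
by rewrite (bigD1 i)//= lerDl sumr_ge0// => k _; exact: sqrtr_ge0.
Qed.

Lemma sqrt_quad_bound : exists2 c, 0 <= c & forall v, Num.sqrt (quad G v) <= c * `|v|.
Proof.
pose S := \sum_j \sum_i `|G i j|.
have S0 : 0 <= S by apply: sumr_ge0 => i _; apply: sumr_ge0.
(* [1 + S] stands in for the square root of [S], since [S <= (1 + S) ^+ 2]. *)
exists (1 + S) => [|v]; first by rewrite addr_ge0.
have c0 : 0 <= (1 + S) * `|v| by rewrite mulr_ge0// addr_ge0.
rewrite -[leRHS]ger0_norm// -sqrtr_sqr ler_wsqrtr//.
rewrite -[quad G v]/(bil G v v) bilE (@le_trans _ _ (S * `|v| ^+ 2))//.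
  rewrite mulr_suml ler_sum// => j _; rewrite mulr_suml ler_sum// => i _.
  apply: (le_trans (ler_norm _)); rewrite !normrM mulrAC mulrC ler_wpM2l//.
  by rewrite expr2 ler_pM// ler_mx_norm_coord.
rewrite exprMn ler_wpM2r ?exprn_ge0//; nra.
Qed.

(* Energy estimate: [A] is skew for the inner product [G], so the stiff term
   [c *: A *m e] does no work. *)
Lemma skew_growth A (c a b r : R) (e de : R -> 'cV[R]_n) : a <= b -> 0 <= r ->
  (forall v, bil G v (A *m v) = 0) ->
  (forall t i, a <= t <= b -> is_derive_on `[a, b] (fun s => e s i 0) t (de t i 0)) ->
  (forall t, a <= t <= b -> Num.sqrt (quad G (de t - c *: (A *m e t))) <= r) ->
  Num.sqrt (quad G (e b)) <= Num.sqrt (quad G (e a)) + r * (b - a).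
Proof.
move=> ab r0 skew dE hr; have [GT _] := hG.
have := @sqrt_growth R a b 0 r (fun t => quad G (e t)) (fun t => 2 * bil G (e t) (de t)) ab.
rewrite !mul0r expR0 mul1r; apply => //.
- move=> t tab.
  rewrite (_ : (fun _ => _) = fun s => \sum_j \sum_i e s i 0 * G i j * e s j 0); last first.
    by apply/funext => s; rewrite -bilE.
  rewrite (_ : 2 * _ = \sum_j \sum_i (de t i 0 * G i j * e t j 0 + e t i 0 * G i j * de t j 0)).
    apply: is_derive_on_sum => j _; apply: is_derive_on_sum => i _.
    apply: is_derive_onM; last exact: dE.
    by rewrite mulrC (_ : (fun _ => _) = fun s => G i j * e s i 0);
      [apply: is_derive_onZ; exact: dE|apply/funext => s; rewrite mulrC].
  under eq_bigr do rewrite big_split /=.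
  by rewrite big_split /= -!bilE (bilC _ _ GT) mulr2n mulrDl mul1r.
- by move=> t _; exact: quad_ge0.
- move=> t tab; rewrite mul0r add0r -mulrA ler_pM2l//.
  have -> : bil G (e t) (de t) = bil G (e t) (de t - c *: (A *m e t)).
    by rewrite -scaleNr bilDr bilZr skew mulr0 addr0.
  apply: (le_trans (ler_norm _)); apply: (le_trans (bil_CS _ _)).
  by rewrite ler_wpM2l ?sqrtr_ge0// hr.
Qed.

End SymPosDef.
End PosDef.

Lemma mulmx_norm (R : realType) m n p (A : 'M[R]_(m, n)) (B : 'M[R]_(n, p)) :
  `|A *m B| <= n%:R * (`|A| * `|B|).
Proof.
apply: mx_norm_le => [|i j]; first by rewrite !mulr_ge0.
by apply: mulmx_norm_coord => //; exact: ler_mx_norm_coord.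
Qed.

(** The substitution [q = exp (- lam (s - a) K) e] removes the stiff term, and passing between [q]
    and [e] costs only the bound [kap] on the flow. Hence [C] is fixed before [lam], which will be
    the unbounded parameter [eps^-1]. *)
Lemma stable_growth (R : realType) D (K : 'M[R]_D) (kap : R) :
  (forall t, `|expm (t *: K)| <= kap) ->
  exists2 C, 0 <= C & forall (c r lam a b : R) (e de : R -> 'cV[R]_D),
    a <= b -> 0 <= c -> 0 <= r ->
    (forall t i, a <= t <= b -> is_derive_on `[a, b] (fun s => e s i 0) t (de t i 0)) ->
    (forall t, a <= t <= b -> `|de t - lam *: (K *m e t)| <= c * `|e t| + r) ->
    `|e b| <= C * expR (C * c * (b - a)) * (`|e a| + r * (b - a)).
Proof.
move=> hK; have kap0 : 0 <= kap by apply: le_trans (hK 0).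
pose m : R := D%:R; pose k := m * kap.
have m0 : 0 <= m by []; have k0 : 0 <= k by rewrite mulr_ge0.
(* The first summand covers the passages between [e] and [q], between sup and Euclidean norm, and
   the forcing; the second is the growth rate. Their sum serves in both places where [C] occurs. *)
exists (k * m * (1 + k) + m * k ^+ 2).
  by rewrite addr_ge0// ?mulr_ge0// ?addr_ge0// exprn_ge0.
move=> c r lam a b e de ab c0 r0 dE hr.
pose q s := expm ((- lam * (s - a)) *: K) *m e s.
pose dq s := expm ((- lam * (s - a)) *: K) *m (de s + - lam *: (K *m e s)).
have dQ t i : a <= t <= b -> is_derive_on `[a, b] (fun s => q s i 0) t (dq t i 0).
  by move=> tab; apply: is_derive_on_expm_mul => j; exact: dE.
(* The Euclidean square is used because the sup norm is not differentiable. *)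
pose phi s := \sum_i q s i 0 ^+ 2.
have phi0 s : 0 <= phi s by apply: sumr_ge0 => i _; exact: sqr_ge0.
have qphi s : `|q s| <= Num.sqrt (phi s).
  apply: mx_norm_le => [|i j]; first exact: sqrtr_ge0.
  rewrite (ord1 j) -sqrtr_sqr ler_wsqrtr// /phi (bigD1 i)//= lerDl.
  by apply: sumr_ge0 => l _; exact: sqr_ge0.
have eq s : e s = expm ((lam * (s - a)) *: K) *m q s.
  by rewrite /q mulmxA mulNr -{1}[lam * _]opprK expm_mulN mul1mx.
have ephi s : `|e s| <= k * Num.sqrt (phi s).
  rewrite [in leLHS]eq; apply: (le_trans (mulmx_norm _ _)).
  by rewrite -mulrA ler_wpM2l// ler_pM.
have dqle s : a <= s <= b -> `|dq s| <= k * (c * k * Num.sqrt (phi s) + r).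
  move=> sab; apply: (le_trans (mulmx_norm _ _)).
  rewrite /k -mulrA ler_wpM2l// ler_pM//.
  rewrite scaleNr; apply: (le_trans (hr _ sab)).
  by rewrite lerD2r -mulrA ler_wpM2l.
have mk0 : 0 <= m * k ^+ 2 * c by rewrite ?mulr_ge0// exprn_ge0.
have mk1 : 0 <= m * k * r by rewrite ?mulr_ge0.
have H : Num.sqrt (phi b) <= expR (m * k ^+ 2 * c * (b - a)) *
    (Num.sqrt (phi a) + m * k * r * (b - a)).
apply: (@sqrt_growth R a b _ _ phi
  (fun s => \sum_i (2 * (q s i 0 * dq s i 0)))) => //.
- move=> t tab; apply: is_derive_on_sum => i _.
  rewrite mulr2n mulrDl mul1r {1}mulrC.
  rewrite (_ : (fun _ => _) = fun s => q s i 0 * q s i 0); last first.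
    by apply/funext => s; rewrite expr2.
  by apply: is_derive_onM; exact: dQ.
- move=> t tab; set s := Num.sqrt _.
  have s0 : 0 <= s by exact: sqrtr_ge0.
  apply: (@le_trans _ _ (\sum_(i < D) 2 * (s * (k * (c * k * s + r))))).
    apply: ler_sum => i _; rewrite ler_pM2l// (le_trans (ler_norm _))// normrM ler_pM//.
      by apply: (le_trans (ler_mx_norm_coord _ _ _)); exact: qphi.
    by apply: (le_trans (ler_mx_norm_coord _ _ _)); exact: dqle.
  rewrite sumr_const card_ord -[leLHS]mulr_natl -/m le_eqVlt; apply/orP; left.
  by apply/eqP; ring.
have qa : Num.sqrt (phi a) <= m * `|e a|.
  have ma : 0 <= m * `|e a| by rewrite mulr_ge0.
  rewrite -[leRHS]ger0_norm// -sqrtr_sqr ler_wsqrtr//.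
  apply: (@le_trans _ _ (\sum_(i < D) `|e a| ^+ 2)).
    apply: ler_sum => i _; rewrite -real_normK ?num_real// lerXn2r ?nnegrE//.
    rewrite /q subrr mulr0 scale0r expm0 mul1mx; exact: ler_mx_norm_coord.
  rewrite sumr_const card_ord -[leLHS]mulr_natl -/m exprMn ler_wpM2r ?exprn_ge0//.
  by rewrite /m expr2 -natrM ler_nat; case: (D) => // D'; rewrite leq_pmulr.
apply: (le_trans (ephi b)).
have E0 := expR_ge0 (m * k ^+ 2 * c * (b - a)).
have ba : 0 <= b - a by rewrite subr_ge0.
have C0 : 0 <= k * m * (1 + k) by rewrite !mulr_ge0// addr_ge0.
have C1 : 0 <= m * k ^+ 2 by rewrite mulr_ge0// exprn_ge0.
have W0 : 0 <= `|e a| + r * (b - a) by rewrite addr_ge0// mulr_ge0.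
apply: (@le_trans _ _ (k * m * (1 + k) * expR (m * k ^+ 2 * c * (b - a)) * (`|e a| + r * (b - a)))).
  have -> : k * m * (1 + k) * expR (m * k ^+ 2 * c * (b - a)) * (`|e a| + r * (b - a))
    = k * (expR (m * k ^+ 2 * c * (b - a)) * (m * (1 + k) * (`|e a| + r * (b - a)))) by ring.
  rewrite ler_wpM2l//; apply: (le_trans H); rewrite ler_wpM2l//.
  have := mulr_ge0 (mulr_ge0 m0 k0) (normr_ge0 (e a)).
  have := mulr_ge0 m0 (mulr_ge0 r0 ba).
  nra.
apply: ler_pM => //; first by rewrite mulr_ge0.
apply: ler_pM => //; first by rewrite lerDl.
by rewrite ler_expR ler_wpM2r// ler_wpM2r// lerDr.
Qed.

(** * Monomials and the extension matrices *)

Section Sorting.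
Context {n : nat}.
Implicit Types a b : seq 'I_n.

Definition ord_leq : rel 'I_n := relpre val leq.

Lemma ord_leq_total : total ord_leq. Proof. by move=> i j; exact: leq_total. Qed.
Lemma ord_leq_trans : transitive ord_leq. Proof. by move=> i j l; exact: leq_trans. Qed.
Lemma ord_leq_anti : antisymmetric ord_leq.
Proof. by move=> i j; rewrite /ord_leq /= -eqn_leq => /eqP/val_inj. Qed.

Lemma nondecrE a : nondecr a = sorted ord_leq a.
Proof. by rewrite /nondecr sorted_map. Qed.

Lemma nondecr_sort a : nondecr (sort ord_leq a).
Proof. by rewrite nondecrE sort_sorted//; exact: ord_leq_total. Qed.

Lemma sort_nondecr a : nondecr a -> sort ord_leq a = a.
Proof. by rewrite nondecrE; apply: sorted_sort; exact: ord_leq_trans. Qed.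

Lemma sort_perm a b : perm_eq a b -> sort ord_leq a = sort ord_leq b.
Proof.
move/perm_sortP; apply.
- exact: ord_leq_total.
- exact: ord_leq_trans.
- exact: ord_leq_anti.
Qed.

Lemma chi0 i a : chi (i :: a) 0 = a.
Proof. by rewrite /chi /= drop0. Qed.

Lemma chiS i a l : chi (i :: a) l.+1 = i :: chi a l.
Proof. by []. Qed.

Lemma size_chi a (l : 'I_(size a)) : (size (chi a l)).+1 = size a.
Proof.
rewrite /chi size_cat size_take size_drop ltn_ord -addnS -subSn ?ltn_ord//.
by rewrite subSS subnKC// ltnW.
Qed.

Lemma tnth_cons (i : 'I_n) a l : tnth (in_tuple (i :: a)) (lift ord0 l) = tnth (in_tuple a) l.
Proof. by rewrite !(tnth_nth i). Qed.

Lemma perm_chi a (l : 'I_(size a)) : perm_eq (tnth (in_tuple a) l :: chi a l) a.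
Proof.
elim: a l => [[]//|i a IH] l; case: (unliftP ord0 l) => [m|] ->; last first.
  by rewrite chi0.
rewrite tnth_cons lift0 chiS.
have /permPl e := perm_catCA [:: tnth (in_tuple a) m] [:: i] (chi a m).
by apply: (perm_trans e); rewrite /= perm_cons; exact: IH.
Qed.

End Sorting.

Section Monomials.
Context {R : realType} {n : nat}.
Implicit Types (a b : seq 'I_n) (v x : 'cV[R]_n).

Lemma monom_nil v : monom v [::] = 1.
Proof. by rewrite /monom big_nil. Qed.

Lemma monom_cons v i a : monom v (i :: a) = v i 0 * monom v a.
Proof. by rewrite /monom big_cons. Qed.

Lemma monom_cat v a b : monom v (a ++ b) = monom v a * monom v b.
Proof. by rewrite /monom big_cat. Qed.

Lemma monom_perm v a b : perm_eq a b -> monom v a = monom v b.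
Proof. exact: perm_big. Qed.

Lemma monom_le v a r : `|v| <= r -> `|monom v a| <= r ^+ size a.
Proof.
move=> vr; elim: a => [|i a IH]; first by rewrite monom_nil normr1.
rewrite monom_cons normrM exprS ler_pM// (le_trans _ vr)//.
exact: ler_mx_norm_coord.
Qed.

Lemma is_derive_on_monom (A : set R) (v dv : R -> 'cV[R]_n) t a :
  (forall i, is_derive_on A (fun s => v s i 0) t (dv t i 0)) ->
  is_derive_on A (fun s => monom (v s) a) t
    (\sum_(l < size a) monom (v t) (chi a l) * dv t (tnth (in_tuple a) l) 0).
Proof.
move=> hv; elim: a => [|i a IH].
  rewrite big_ord0 (_ : (fun _ => _) = fun=> 1); first exact: is_derive_on_cst.
  by apply/funext => s; rewrite monom_nil.
rewrite (_ : (fun _ => _) = fun s => v s i 0 * monom (v s) a); last first.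
  by apply/funext => s; rewrite monom_cons.
rewrite big_ord_recl /= chi0 (tnth_nth i) /= [_ * dv t i 0]mulrC.
rewrite (eq_bigr (fun l : 'I_(size a) => v t i 0 *
  (monom (v t) (chi a l) * dv t (tnth (in_tuple a) l) 0))) => [|l _].
  by rewrite -mulr_sumr; exact: is_derive_onM.
by rewrite tnth_cons /bump /= add1n chiS monom_cons mulrA.
Qed.

End Monomials.

Section ExtensionMatrices.
Context {R : realType} {n : nat} (k : nat) (s : seq (seq 'I_n)).
Hypothesis sP : multi_index_listing k s.
Local Notation D := (size s).
Implicit Types (w : 'cV[R]_D) (a : seq 'I_n) (x xhat : 'cV[R]_n).

(** Sorting makes a coordinate available for every list, in particular for the unsorted
    concatenations [chi alpha l ++ beta] produced by the matrices. A list longer than [k] gets the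
    value 0. *)
Definition entry w a : R := \sum_j (midx j == sort ord_leq a)%:R * w j 0.

Lemma midx_nondecr (i : 'I_D) : nondecr (midx i).
Proof. by have [_ h _] := sP; have := mem_nth [::] (ltn_ord i); rewrite h => /andP[]. Qed.

Lemma size_midx (i : 'I_D) : (size (midx i) <= k)%N.
Proof. by have [_ h _] := sP; have := mem_nth [::] (ltn_ord i); rewrite h => /andP[]. Qed.

Lemma midx_inj (i j : 'I_D) : midx i = midx j -> i = j.
Proof.
have [us _ _] := sP; move=> /eqP; rewrite /midx nth_uniq// => /eqP; exact: val_inj.
Qed.

Lemma entry_midx w i : entry w (midx i) = w i 0.
Proof.
rewrite /entry sort_nondecr ?midx_nondecr// (bigD1 i)//= eqxx mul1r big1 ?addr0//.
move=> j ji; case: eqP => [/midx_inj e|_]; last by rewrite mul0r.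
by rewrite e eqxx in ji.
Qed.

Lemma midx_ex a : (size a <= k)%N -> exists i : 'I_D, midx i = sort ord_leq a.
Proof.
move=> ak; have [_ h _] := sP.
have sas : sort ord_leq a \in s by rewrite h nondecr_sort size_sort.
have lt : (index (sort ord_leq a) s < D)%N by rewrite index_mem.
by exists (Ordinal lt); rewrite /midx nth_index.
Qed.

Lemma entry_perm w a b : perm_eq a b -> entry w a = entry w b.
Proof. by move=> ab; rewrite /entry (sort_perm ab). Qed.

Lemma entry_monvec x xhat a : (size a <= k)%N ->
  entry (monvec s xhat x) a = monom (x - xhat) a.
Proof.
move=> /midx_ex[i ia].
rewrite (@entry_perm _ a (midx i)); last by rewrite ia perm_sym; apply: permEl; exact: perm_sort.
rewrite entry_midx mxE; apply: monom_perm.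
by rewrite ia; apply: permEl; exact: perm_sort.
Qed.

Lemma entry_le w a : `|entry w a| <= D%:R * `|w|.
Proof.
apply: (le_trans (ler_norm_sum _ _ _)).
apply: (@le_trans _ _ (\sum_(j < D) `|w|)); last by rewrite sumr_const card_ord mulr_natl.
apply: ler_sum => j _.
rewrite normrM; case: eqP => _; rewrite ?normr1 ?normr0 ?mul1r ?mul0r//.
exact: ler_mx_norm_coord.
Qed.

Definition linform (f : 'cV[R]_D -> R) := exists c : 'I_D -> R, forall w, f w = \sum_j c j * w j 0.

Lemma linform_entry a : linform (entry^~ a).
Proof. by exists (fun j => (midx j == sort ord_leq a)%:R). Qed.

Lemma linformD f g : linform f -> linform g -> linform (fun w => f w + g w).
Proof.
move=> [c cf] [c' cg]; exists (fun j => c j + c' j) => w.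
by rewrite cf cg -big_split; apply: eq_bigr => j _; rewrite mulrDl.
Qed.

Lemma linformZ f c : linform f -> linform (fun w => c * f w).
Proof.
move=> [c' cf]; exists (fun j => c * c' j) => w.
by rewrite cf mulr_sumr; apply: eq_bigr => j _; rewrite mulrA.
Qed.

Lemma linform_sum (I : Type) (r : seq I) (P : pred I) f :
  (forall i, P i -> linform (f i)) -> linform (fun w => \sum_(i <- r | P i) f i w).
Proof.
move=> h; elim: r => [|i r [c cP]].
  by exists (fun=> 0) => w; rewrite big_nil big1// => j _; rewrite mul0r.
have [Pi|nPi] := boolP (P i); last by exists c => w; rewrite big_cons (negbTE nPi).
have [c' c'P] := linformD (h i Pi) (ex_intro _ c cP).
by exists c' => w; rewrite big_cons Pi.
Qed.

(** The matrices are specified only on vectors of monomials, whereas the error vector is not one. As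
    a matrix is determined by its action on monomials, [monvec_inj] extends the formula to all
    vectors. *)
Lemma mulmx_linform (B : 'M[R]_D) xhat (P : 'I_D -> 'cV[R]_D -> R) :
  (forall i, linform (P i)) ->
  (forall x i, (B *m monvec s xhat x) i 0 = P i (monvec s xhat x)) ->
  forall w i, (B *m w) i 0 = P i w.
Proof.
move=> /choice[c cP] hB w i.
suff -> : B = \matrix_(i, j) c i j.
  by rewrite mxE cP; apply: eq_bigr => j _; rewrite mxE.
apply: (monvec_inj sP (xhat := xhat)) => x; apply/colP => j.
by rewrite hB cP mxE; apply: eq_bigr => l _; rewrite !mxE.
Qed.

Lemma size_chi_le (i : 'I_D) (l : 'I_(size (midx i))) : (size (chi (midx i) l) <= k)%N.
Proof. by rewrite -ltnS size_chi ltnW// ltnS size_midx. Qed.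

Lemma ext1_mul (A1 : 'M[R]_n) xhat w i :
  (ext1_mx s A1 xhat *m w) i 0 =
  \sum_(l < size (midx i)) \sum_(m < n) A1 (tnth (in_tuple (midx i)) l) m *
    (entry w (chi (midx i) l ++ [:: m]) + xhat m 0 * entry w (chi (midx i) l)).
Proof.
pose P (i : 'I_D) w := \sum_(l < size (midx i)) \sum_(m < n)
  A1 (tnth (in_tuple (midx i)) l) m *
    (entry w (chi (midx i) l ++ [:: m]) + xhat m 0 * entry w (chi (midx i) l)).
apply: (@mulmx_linform _ xhat P) => [{}i|x {}i].
  apply: linform_sum => l _; apply: linform_sum => m _; apply: linformZ.
  by apply: linformD; [|apply: linformZ]; exact: linform_entry.
rewrite (ext1_mxP sP A1 xhat); apply: eq_bigr => l _; apply: eq_bigr => m _.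
have sz : (size (chi (midx i) l ++ [:: m]) <= k)%N.
  by rewrite (size_cat (chi _ _)) addn1 size_chi size_midx.
rewrite !entry_monvec ?size_chi_le//.
rewrite monom_cat monom_cons monom_nil !mxE; ring.
Qed.

Lemma ext0_mul (f : 'cV[R]_n -> 'cV[R]_n) xhat w i :
  (ext0_mx k s f xhat *m w) i 0 =
  \sum_(l < size (midx i)) \sum_(m < (k - size (midx i) + 1).+1)
    \sum_(beta : m.-tuple 'I_n | nondecr beta)
      (gam beta)%:R^-1
      * partial beta (fun z => f z (tnth (in_tuple (midx i)) l) 0) xhat
      * entry w (chi (midx i) l ++ beta).
Proof.
pose P (i : 'I_D) w := \sum_(l < size (midx i)) \sum_(m < (k - size (midx i) + 1).+1)
    \sum_(beta : m.-tuple 'I_n | nondecr beta)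
      (gam beta)%:R^-1
      * partial beta (fun z => f z (tnth (in_tuple (midx i)) l) 0) xhat
      * entry w (chi (midx i) l ++ beta).
apply: (@mulmx_linform _ xhat P) => [{}i|x {}i].
  apply: linform_sum => l _; apply: linform_sum => m _; apply: linform_sum => beta _.
  exact/linformZ/linform_entry.
rewrite (ext0_mxP sP f xhat); apply: eq_bigr => l _; apply: eq_bigr => m _.
apply: eq_bigr => beta _.
rewrite entry_monvec ?monom_cat ?mulrA// (size_cat (chi _ _)) size_tuple.
have := ltn_ord m; rewrite ltnS => mk.
apply: (leq_trans (leq_add (leqnn _) mk)).
by rewrite addnCA addn1 size_chi subnK// size_midx.
Qed.

(** Moving the centre adds only terms proportional to [A1 *m xhat]. This is what lets the matrix of
    every step be compared with a single one: the difference stays bounded after division by [eps]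
    when [A1 *m xhat] is O(eps). *)
Lemma ext1_mul0 (A1 : 'M[R]_n) xhat w i :
  (ext1_mx s A1 xhat *m w) i 0 = (ext1_mx s A1 0 *m w) i 0 +
  \sum_(l < size (midx i)) (A1 *m xhat) (tnth (in_tuple (midx i)) l) 0 *
     entry w (chi (midx i) l).
Proof.
rewrite !ext1_mul -big_split /=; apply: eq_bigr => l _.
rewrite mxE mulr_suml -big_split /=; apply: eq_bigr => m _.
rewrite mxE; ring.
Qed.

End ExtensionMatrices.

(** Duality in finite dimension: a subspace with trivial annihilator is the whole space. *)
Lemma subspace_full (R : fieldType) D (P : 'cV[R]_D -> Prop) :
  P 0 -> (forall c u v, P u -> P v -> P (c *: u + v)) ->
  (forall b : 'rV[R]_D, (forall v, P v -> b *m v = 0) -> b = 0) ->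
  forall v, P v.
Proof.
move=> P0 PD Pann.
(* [P] is a bare predicate; it is represented by a matrix [U] of maximal rank whose row space
   satisfies it. *)
pose Q r := `[< exists U : 'M[R]_D, \rank U = r /\ forall u : 'rV_D, (u <= U)%MS -> P u^T >].
have Qex : exists r, Q r.
  exists 0%N; apply/asboolP; exists 0; split; first exact: mxrank0.
  by move=> u; rewrite submx0 => /eqP->; rewrite trmx0.
have Qb r : Q r -> (r <= D)%N by move=> /asboolP[U [<- _]]; exact: rank_leq_row.
case: (ex_maxnP Qex Qb) => r /asboolP[U [rU PU]] rmax v.
suff vU : (v^T <= U)%MS by have := PU _ vU; rewrite trmxK.
apply: contrapT => /negP vU.
have PleU w : P w -> (w^T <= U)%MS.
  move=> Pw; apply: contrapT => /negP wU.
  have : Q (\rank (U + w^T)%MS).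
    apply/asboolP; exists (U + w^T)%MS; split => // u /sub_addsmxP[[c1 c2] /= ->].
    rewrite linearD /= addrC; have /eqP := mx11_scalar c2; move/eqP ->.
    rewrite mul_scalar_mx linearZ /= trmxK; apply: PD => //.
    by apply: PU; exact: submxMl.
  move=> /rmax; rewrite -rU leqNgt => /negP; apply.
  apply: rank_ltmx; rewrite ltmxE addsmxSl; apply/negP => UwU; case/negP: wU.
  exact: submx_trans (addsmxSr _ _) UwU.
case/negP: vU; rewrite submxE; apply/eqP/matrixP => i j.
(* By maximality every vector of [P] lies in the row space of [U], so each column of the cokernel
   annihilates [P]. *)
have bj : (col j (cokermx U))^T = 0.
  apply: Pann => w /PleU; rewrite submxE => /eqP wU.
  by rewrite -[LHS]trmxK trmx_mul trmxK colE mulmxA wU mul0mx trmx0.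
have cj : col j (cokermx U) = 0 by rewrite -[LHS]trmxK bj trmx0.
have : col j (v^T *m cokermx U) = 0 by rewrite colE -mulmxA -colE cj mulmx0.
by move=> /colP/(_ i); rewrite !mxE.
Qed.

Section BoundedFlow.
Context {R : realType} {n : nat} (k : nat) (s : seq (seq 'I_n)).
Hypothesis sP : multi_index_listing k s.
Local Notation D := (size s).

(** By Leibniz' rule the monomials along the flow of [A1] solve the linear equation of the extension
    matrix centred at 0; [ode_expmE] identifies the two sides. *)
Lemma expm_monvec (A1 : 'M[R]_n) (v : 'cV[R]_n) t :
  expm (t *: ext1_mx s A1 0) *m monvec s 0 v = monvec s 0 (expm (t *: A1) *m v).
Proof.
pose w u := monvec s 0 (expm (u *: A1) *m v).
have w0 : w 0 = monvec s 0 v by rewrite /w scale0r expm0 mul1mx.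
rewrite -w0 -[RHS]/(w t); symmetry; apply: ode_expmE => u i.
rewrite (ext1_mxP sP A1 0).
rewrite (_ : (fun _ => _) = fun r => monom (expm (r *: A1) *m v) (midx i)); last first.
  by apply/funext => r; rewrite mxE subr0.
have dv r j : is_derive_on setT (fun r => (expm (r *: A1) *m v) j 0) r
    ((A1 *m (expm (r *: A1) *m v)) j 0).
  rewrite (_ : (fun _ => _) = fun r => \sum_l expm (r *: A1) j l * v l 0); last first.
    by apply/funext => u'; rewrite mxE.
  rewrite mulmxA mxE; apply: is_derive_on_sum => l _.
  rewrite -[X in is_derive_on _ _ _ X]addr0 -[X in _ + X](mulr0 (expm (r *: A1) j l)).
  apply: is_derive_onM; last exact: is_derive_on_cst.
  by apply: is_derive_on_is_derive; exact: is_derive_expm.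
have := @is_derive_on_monom R n setT (fun r => expm (r *: A1) *m v)
   (fun r => A1 *m (expm (r *: A1) *m v)) u (midx i) (dv u).
congr is_derive_on; apply: eq_bigr => l _; rewrite subr0 mxE mulr_sumr.
by apply: eq_bigr => m _; rewrite subrK; ring.
Qed.

(* [ext1_mx s A1 0] generates the action of the flow of [A1] on monomials, and
   the vectors of monomials span the whole space. *)
Lemma bounded_expm_ext1 (A1 : 'M[R]_n) :
  (forall v : 'cV[R]_n, exists C, forall t, `|expm (t *: A1) *m v| <= C) ->
  exists kap, forall t, `|expm (t *: ext1_mx s A1 0)| <= kap.
Proof.
move=> hA; pose K := ext1_mx s A1 0.
have H : forall w : 'cV[R]_D, exists C, forall t, `|expm (t *: K) *m w| <= C.
  apply: subspace_full.
  - by exists 0 => t; rewrite mulmx0 normr0.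
  - move=> c u v [Cu hu] [Cv hv]; exists (`|c| * Cu + Cv) => t.
    rewrite mulmxDr -scalemxAr (le_trans (ler_normD _ _))// lerD// normrZ.
    by rewrite ler_wpM2l.
  (* A functional killing all vectors of monomials is copied into every row of a square matrix, so
     that [monvec_inj] forces it to vanish. *)
  - move=> b hb; apply/rowP => j; rewrite mxE.
    pose B : 'M[R]_D := \matrix_(i, l) b 0 l.
    suff B0 : B = 0 by have := congr1 (fun X : 'M[R]_D => X j j) B0; rewrite !mxE.
    apply: (monvec_inj sP (xhat := 0)) => x; rewrite mul0mx; apply/colP => i.
    suff bx : b *m monvec s 0 x = 0.
      have := congr1 (fun X : 'M[R]_1 => X 0 0) bx; rewrite !mxE => bx0.
      by rewrite -[RHS]bx0; apply: eq_bigr => l _; rewrite !mxE.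
    apply: hb.
    (* [r >= 1] lets the single power [r ^+ k] bound the monomials of all degrees up to [k]. *)
    have [C hC] := hA x; pose r := 1 + `|C|; exists (r ^+ k) => t.
    rewrite expm_monvec; apply: mx_norm_le => [|p q]; first by rewrite exprn_ge0// addr_ge0.
    rewrite mxE subr0; apply: (le_trans (monom_le _ (_ : _ <= r))).
      by apply: (le_trans (hC t)); rewrite (le_trans (ler_norm _))// lerDr.
    by rewrite ler_weXn2l ?lerDl// size_midx.
have /choice[C hC] := fun j => H (delta_mx j 0).
have C0 j : 0 <= C j by apply: le_trans (hC j 0).
exists (\sum_j C j) => t; apply: mx_norm_le => [|i j]; first exact: sumr_ge0.
have := hC j t; rewrite -colE => /(le_trans (ler_mx_norm_coord _ i 0)).
rewrite mxE => /le_trans; apply; rewrite (bigD1 j)//= lerDl; exact: sumr_ge0.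
Qed.

End BoundedFlow.

(** * Taylor expansion on a slab *)

Lemma is_derive_on_unique (R : realType) (a b t l m : R) (f : R -> R) :
  a < b -> a <= t <= b ->
  is_derive_on `[a, b] f t l -> is_derive_on `[a, b] f t m -> l = m.
Proof.
move=> ab /andP[at_ tb] hl hm.
(* The punctured trace of [[a, b]] is nontrivial: a nearby point is taken to the right of [t], or to
   the left when [t = b]. *)
suff PF : ProperFilter (within `[a, b] t^').
  by apply: (cvg_unique _ hl hm); exact: norm_hausdorff.
apply: Build_ProperFilter_ex => P.
rewrite /within /= => /nbhs_ballP[e /= e0 he].
have [tb'|bt] := ltP t b.
- pose s := t + Num.min (e / 2) (b - t).
  have m0 : 0 < Num.min (e / 2) (b - t) by rewrite lt_min divr_gt0//= subr_gt0.
  have me : Num.min (e / 2) (b - t) <= e / 2 by rewrite ge_min lexx.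
  have mb : Num.min (e / 2) (b - t) <= b - t by rewrite ge_min lexx orbT.
  exists s; apply: he.
  + by rewrite /ball /= /s opprD addNKr normrN gtr0_norm//; lra.
  + by rewrite /s gt_eqF// ltrDl.
  + by rewrite /= in_itv /= /s; apply/andP; split; lra.
- pose s := t - Num.min (e / 2) (t - a).
  have m0 : 0 < Num.min (e / 2) (t - a).
    by rewrite lt_min divr_gt0//= subr_gt0; lra.
  have me : Num.min (e / 2) (t - a) <= e / 2 by rewrite ge_min lexx.
  have mb : Num.min (e / 2) (t - a) <= t - a by rewrite ge_min lexx orbT.
  exists s; apply: he.
  + by rewrite /ball /= /s opprB addrC subrK gtr0_norm//; lra.
  + by rewrite /s lt_eqF// gtrDl oppr_lt0.
  + by rewrite /= in_itv /= /s; apply/andP; split; lra.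
Qed.

Section Coordinates.
Context {R : realType} {n : nat}.
Implicit Types (x z : 'cV[R]_n) (G : 'cV[R]_n -> R) (r i j : 'I_n).

Lemma is_derive_line G x r (u : R) : derivable G (x + u *: delta_mx r 0) (delta_mx r 0) ->
  is_derive u 1 (fun u => G (x + u *: delta_mx r 0))
    ('D_(delta_mx r 0) G (x + u *: delta_mx r 0)).
Proof.
move=> dG.
have E : (fun h : R => h^-1 *: (((fun u => G (x + u *: delta_mx r 0)) \o shift u) (h *: 1)
     - G (x + u *: delta_mx r 0))) =
  (fun h => h^-1 *: ((G \o shift (x + u *: delta_mx r 0)) (h *: delta_mx r 0)
     - G (x + u *: delta_mx r 0))).
  apply/funext => h /=; rewrite -[h *: (1 : R)]/(h * 1) mulr1.
  by rewrite scalerDl addrCA.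
by split; rewrite /derivable /derive ?E.
Qed.

Lemma coord_MVT G x r (d : R) :
  (forall th, 0 <= th <= 1 -> derivable G (x + (th * d) *: delta_mx r 0) (delta_mx r 0)) ->
  exists2 th, 0 <= th <= 1 &
    G (x + d *: delta_mx r 0) - G x =
    'D_(delta_mx r 0) G (x + (th * d) *: delta_mx r 0) * d.
Proof.
move=> dG.
have [|th th01] := @MVT_on R 0 1 (fun th => G (x + (th * d) *: delta_mx r 0))
  (fun th => 'D_(delta_mx r 0) G (x + (th * d) *: delta_mx r 0) * d) ler01.
  move=> t t01.
  apply: (@is_derive_on_comp _ _ (fun th => th * d) (fun u => G (x + u *: delta_mx r 0))).
    by apply: is_derive_line; exact: dG.
  rewrite (_ : (fun _ => _) = fun s => d * s); last by apply/funext => s; rewrite mulrC.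
  by rewrite -[X in is_derive_on _ _ _ X]mulr1; apply/is_derive_onZ/is_derive_on_id.
by rewrite mul1r mul0r scale0r addr0 subr0 mulr1; exists th.
Qed.

End Coordinates.

(** * Partial derivatives on the slab and their symmetry *)

Section Slab.
Context {R : realType} {n : nat} (i0 : 'I_n) (T : R).
Hypothesis T0 : 0 < T.
Implicit Types (x z : 'cV[R]_n) (G : 'cV[R]_n -> R) (r i j : 'I_n).
Local Notation e_ r := (delta_mx r 0 : 'cV[R]_n).

Definition slab : set 'cV[R]_n := [set z | 0 <= z i0 0 <= T].

(** From any point there is room [T / 2] in one of the two time directions; the sign [sg] points
    inwards, also from the faces. *)
Lemma slab_step x : slab x -> exists2 sg : R, `|sg| = 1 &
  forall u, 0 <= u <= T / 2 -> 0 <= x i0 0 + sg * u <= T.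
Proof.
rewrite /slab /= => /andP[x0 xT]; have [xle|xgt] := leP (x i0 0) (T / 2).
  by exists 1; [rewrite normr1|move=> u /andP[u0 uT]; apply/andP; split; lra].
by exists (-1); [rewrite normrN1|move=> u /andP[u0 uT]; apply/andP; split; lra].
Qed.

Lemma coord_line x r (u : R) i : (x + u *: e_ r) i 0 = x i 0 + (i == r)%:R * u.
Proof. by rewrite !mxE eqxx andbT mulrC. Qed.

(** On a face the two functions are compared on one side only. Both being derivable there, the
    inward one-sided derivative determines the full one. *)
Lemma derive_slab_eq G H x r : (forall z, slab z -> G z = H z) -> slab x ->
  derivable G x (e_ r) -> derivable H x (e_ r) -> 'D_(e_ r) G x = 'D_(e_ r) H x.
Proof.
move=> GH xS dG dH; have [sg sg1 hsg] := slab_step xS.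
have sg0 : sg != 0 by rewrite -normr_eq0 sg1 oner_eq0.
have line (F : 'cV[R]_n -> R) : derivable F x (e_ r) ->
   is_derive_on `[0, T / 2] (fun u => F (x + (sg * u) *: e_ r)) 0 ('D_(e_ r) F x * sg).
  move=> dF.
  apply: (@is_derive_on_comp _ _ (fun u => sg * u) (fun u => F (x + u *: e_ r))).
    have h := @is_derive_line R n F x r 0; rewrite scale0r addr0 in h.
    by rewrite mulr0; exact: (h dF).
  by rewrite -[X in is_derive_on _ _ _ X]mulr1; apply/is_derive_onZ/is_derive_on_id.
apply: (mulIf sg0); apply: (@is_derive_on_unique R 0 (T / 2) 0 _ _ _ _ _ (line G dG)).
- by rewrite divr_gt0.
- by rewrite lexx divr_ge0// ltW.
apply: is_derive_on_eq (line H dH).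
  move=> u; rewrite /= in_itv /= => u0T; rewrite GH// /slab /= coord_line.
  by case: eqP => _; rewrite ?mul1r ?mul0r ?addr0//; exact: hsg.
by rewrite /= in_itv /= lexx divr_ge0// ltW.
Qed.

(** The second difference over a small square with corner [x], pointing into the slab, equals a
    mixed derivative at a nearby point for either order of the variables. The Lipschitz bound then
    moves both points to [x]. *)
Lemma schwarz G i j x (L : R) : slab x -> i != j ->
  (forall z r, slab z -> derivable G z (e_ r)) ->
  (forall z r r', slab z -> derivable ('D_(e_ r) G) z (e_ r')) ->
  (forall z z' r r', slab z -> slab z' ->
     `|'D_(e_ r) ('D_(e_ r') G) z - 'D_(e_ r) ('D_(e_ r') G) z'| <= L * `|z - z'|) ->
  'D_(e_ i) ('D_(e_ j) G) x = 'D_(e_ j) ('D_(e_ i) G) x.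
Proof.
move=> xS ij dG ddG lip; have [sg sg1 hsg] := slab_step xS.
have inS : forall (a b s : R) (i j : 'I_n), i != j -> 0 <= s <= T / 2 -> 0 <= a <= 1 -> 0 <= b <= 1 ->
    slab (x + (a * (sg * s)) *: e_ i + (b * (sg * s)) *: e_ j).
  clear i j ij => a b s i j ij /andP[s0 sT] /andP[a0 a1] /andP[b0 b1]; rewrite /slab /= !coord_line -addrA.
  have H c : 0 <= c <= 1 -> 0 <= c * s <= T / 2.
    by move=> /andP[c0 c1]; rewrite mulr_ge0//= (le_trans _ sT)// ler_piMl.
  have Ha := hsg _ (H a _); have Hb := hsg _ (H b _).
  rewrite a0 a1 b0 b1 in Ha Hb.
  have [ei|_] := eqVneq i0 i; have [ej|_] := eqVneq i0 j; rewrite /= ?mul0r ?mul1r ?addr0 ?add0r//.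
  - by move: ij; rewrite -ei -ej eqxx.
  - by rewrite mulrCA Ha.
  - by rewrite mulrCA Hb.
have key : forall (s : R) (i j : 'I_n), i != j -> 0 < s -> s <= T / 2 ->
  exists2 p, slab p /\ `|p - x| <= s &
   G (x + (sg * s) *: e_ i + (sg * s) *: e_ j) - G (x + (sg * s) *: e_ i)
   - (G (x + (sg * s) *: e_ j) - G x) = 'D_(e_ j) ('D_(e_ i) G) p * (sg * s) ^+ 2.
  clear i j ij => s i j ij s0 sT; pose d := sg * s.
  have s0T : 0 <= s <= T / 2 by rewrite ltW.
  have [|th th01] := @MVT_on R 0 1
    (fun th => G (x + d *: e_ j + (th * d) *: e_ i) - G (x + (th * d) *: e_ i))
    (fun th => 'D_(e_ i) G (x + d *: e_ j + (th * d) *: e_ i) * d -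
       'D_(e_ i) G (x + (th * d) *: e_ i) * d) ler01.
    have lin t : is_derive_on `[0, 1] (fun th => th * d) t d.
      rewrite (_ : (fun _ => _) = fun s => d * s); last by apply/funext => u; rewrite mulrC.
      by rewrite -[X in is_derive_on _ _ _ X]mulr1; apply/is_derive_onZ/is_derive_on_id.
    move=> t t01; apply: is_derive_onB.
      apply: (@is_derive_on_comp _ _ (fun th => th * d) (fun u => G (x + d *: e_ j + u *: e_ i))) => //.
      apply: is_derive_line; apply: dG; rewrite addrAC.
      by have := inS t 1 s i j ij s0T t01; rewrite mul1r; apply; rewrite ler01 lexx.
    apply: (@is_derive_on_comp _ _ (fun th => th * d) (fun u => G (x + u *: e_ i))) => //.
    apply: is_derive_line; apply: dG.
    have := inS t 0 s i j ij s0T t01; rewrite mul0r scale0r addr0; apply; by rewrite lexx ler01.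
  rewrite subr0 mulr1 mul1r mul0r scale0r !addr0 => E.
  have [|th' th'01] := @coord_MVT R n ('D_(e_ i) G) (x + (th * d) *: e_ i) j d.
    by move=> u u01; apply: ddG; apply: inS.
  move=> E'.
  exists (x + (th * d) *: e_ i + (th' * d) *: e_ j).
    split; first exact: inS.
    apply: mx_norm_le => [|l q]; first exact: ltW.
    rewrite (ord1 q) mxE !coord_line mxE.
    have dn c : 0 <= c <= 1 -> `|c * d| <= s.
      move=> /andP[c0 c1]; rewrite !normrM sg1 mul1r (gtr0_norm s0) ger0_norm//.
      by rewrite ler_piMl// ltW.
    have -> : x l 0 + (l == i)%:R * (th * d) + (l == j)%:R * (th' * d) - x l 0 =
       (l == i)%:R * (th * d) + (l == j)%:R * (th' * d) by ring.
    have [li|_] := eqVneq l i; have [lj|_] := eqVneq l j; rewrite /= ?mul0r ?mul1r ?addr0 ?add0r//.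
    - by move: ij; rewrite -li -lj eqxx.
    - exact: dn.
    - exact: dn.
    - by rewrite normr0 ltW.
  rewrite -/d [x + d *: e_ i + _]addrAC.
  have -> : G (x + d *: e_ j + d *: e_ i) - G (x + d *: e_ i) - (G (x + d *: e_ j) - G x) =
     ('D_(e_ i) G (x + (th * d) *: e_ i + d *: e_ j) - 'D_(e_ i) G (x + (th * d) *: e_ i)) * d.
    by rewrite mulrBl [X in 'D_(e_ i) G X * d - _]addrAC -E.
  by rewrite E' -mulrA -expr2.
apply/eqP; rewrite -subr_eq0 -normr_le0; apply/ler_addgt0Pr => e e0; rewrite add0r.
(* The first term keeps the square inside the slab, the second makes each of the two Lipschitz
   errors at most [e / 2]; [1 + |L|] is positive whatever the sign of [L]. *)
pose s := Num.min (T / 2) (e / (2 * (1 + `|L|))).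
have L0 : 0 < 1 + `|L| by rewrite ltr_wpDr.
have s0 : 0 < s by rewrite lt_min !divr_gt0// mulr_gt0.
have sT : s <= T / 2 by rewrite ge_min lexx.
have se : s <= e / (2 * (1 + `|L|)) by rewrite ge_min lexx orbT.
have Ls : (1 + `|L|) * s <= e / 2.
  have -> : e / 2 = (1 + `|L|) * (e / (2 * (1 + `|L|))) by field; exact: lt0r_neq0.
  by apply: ler_wpM2l => //; exact: ltW.
have aux (a a' b c q : R) : a = a' -> `|a - c| <= q -> `|a' - b| <= q -> q <= e / 2 ->
    `|b - c| <= e.
  move=> -> h1 h2 h3; have -> : b - c = - (a' - b) + (a' - c) by ring.
  by apply: (le_trans (ler_normD _ _)); rewrite normrN; lra.
clearbody s; have [p [pS px] hp] := key s i j ij s0 sT.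
have [|p' [p'S p'x] hp'] := key s j i _ s0 sT; first by rewrite eq_sym.
have E : 'D_(e_ j) ('D_(e_ i) G) p = 'D_(e_ i) ('D_(e_ j) G) p'.
  have d0 : (sg * s) ^+ 2 != 0.
    rewrite expf_neq0// mulf_neq0//; last by rewrite gt_eqF.
    by rewrite -normr_eq0 sg1 oner_eq0.
  apply: (mulIf d0); apply: (etrans (esym hp)); apply: (etrans _ hp').
  have aux2 (a b c q : R) : a - b - (c - q) = a - c - (b - q) by ring.
  by rewrite aux2 (addrAC x).
have lipx z r r' : slab z -> `|z - x| <= s -> `|'D_(e_ r) ('D_(e_ r') G) z - 'D_(e_ r) ('D_(e_ r') G) x|
    <= (1 + `|L|) * s.
  move=> zS zx; apply: (le_trans (lip _ _ _ _ zS xS)).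
  have LL : L <= 1 + `|L| by apply: (le_trans (ler_norm L)); rewrite lerDr ler01.
  apply: (@le_trans _ _ ((1 + `|L|) * `|z - x|)); first exact: ler_wpM2r.
  by apply: ler_wpM2l => //; exact: ltW.
have h1 := lipx p j i pS px; have h2 := lipx p' i j p'S p'x.
exact: aux E h1 h2 Ls.
Qed.

(* Changing the coordinates one at a time keeps the path inside the slab. *)
Lemma slab_path_bound (rho : 'cV[R]_n -> R) x xh (B : R) : slab x -> slab xh -> 0 <= B ->
  (forall z r, slab z -> `|z - xh| <= `|x - xh| ->
     derivable rho z (e_ r) /\ `|'D_(e_ r) rho z| <= B) ->
  `|rho x - rho xh| <= n%:R * (B * `|x - xh|).
Proof.
move=> xS xhS B0 hrho.
pose z (j : nat) : 'cV[R]_n := \col_i (if (i < j)%N then x i 0 else xh i 0).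
have z0 : z 0 = xh by apply/colP => i; rewrite mxE.
have zn : z n = x by apply/colP => i; rewrite mxE ltn_ord.
suff H (j : nat) : (j <= n)%N -> `|rho (z j) - rho xh| <= j%:R * (B * `|x - xh|).
  by have := H n (leqnn n); rewrite zn.
elim: j => [|j IH] jn; first by rewrite z0 subrr normr0 mul0r.
have zS : z j.+1 = z j + (x (Ordinal jn) 0 - xh (Ordinal jn) 0) *: e_ (Ordinal jn).
  apply/colP => i; rewrite coord_line !mxE.
  have [->|ij] := eqVneq i (Ordinal jn).
    by rewrite /= ltnSn ltnn mul1r addrCA subrr addr0.
  rewrite mul0r addr0 ltnS leq_eqVlt.
  by move: ij; rewrite -val_eqE /= => /negbTE ->.
set r := Ordinal jn in zS; set d := _ - _ in zS.
have mid th : 0 <= th <= 1 -> slab (z j + (th * d) *: e_ r) /\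
    `|z j + (th * d) *: e_ r - xh| <= `|x - xh|.
  move=> /andP[th0 th1].
  have E i : exists2 la, 0 <= la <= 1 &
      (z j + (th * d) *: e_ r) i 0 = xh i 0 + la * (x i 0 - xh i 0).
    rewrite coord_line mxE; have [->|ir] := eqVneq i r.
      exists th; first by rewrite th0.
      by rewrite /= ltnn mul1r.
    case: ifP => _; [exists 1|exists 0]; rewrite ?ler01 ?lexx //= mul0r; ring.
  split.
    have [la /andP[la0 la1]] := E i0; rewrite /slab /= => ->.
    move: xS xhS; rewrite /slab /= => /andP[a0 aT] /andP[b0 bT].
    apply/andP; split; nra.
  apply: mx_norm_le => // i q; rewrite (ord1 q) !mxE.
  have [la /andP[la0 la1]] := E i; rewrite !mxE => ->.
  rewrite addrC addKr normrM ger0_norm// (@le_trans _ _ `|x i 0 - xh i 0|)//.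
    by rewrite ler_piMl.
  by have := ler_mx_norm_coord (x - xh) i 0; rewrite !mxE.
have [|th th01 E] := @coord_MVT R n rho (z j) r d.
  by move=> th /mid[h1 h2]; have [] := hrho _ r h1 h2.
have [h1 h2] := mid _ th01; have [_ h3] := hrho _ r h1 h2.
have -> : rho (z j.+1) - rho xh = (rho (z j.+1) - rho (z j)) + (rho (z j) - rho xh) by ring.
rewrite zS E mulrS mulrDl mul1r; apply: (le_trans (ler_normD _ _)).
apply: lerD; last exact: IH (ltnW jn).
rewrite normrM; apply: ler_pM => //.
by have := ler_mx_norm_coord (x - xh) r 0; rewrite !mxE.
Qed.

Section Smooth.
Variables (k : nat) (L : R) (F : 'cV[R]_n -> R).

Definition smooth_on :=
  (forall (alpha : seq 'I_n) r x, (size alpha < k)%N -> slab x ->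
     derivable (partial alpha F) x (e_ r)) /\
  (forall (alpha : seq 'I_n) x y, (size alpha <= k)%N -> slab x -> slab y ->
     `|partial alpha F x - partial alpha F y| <= L * `|x - y|).

Hypothesis FS : smooth_on.

Lemma partial_swap i j (g : seq 'I_n) x : (size g < k.-1)%N -> slab x ->
  partial [:: i, j & g] F x = partial [:: j, i & g] F x.
Proof.
move=> gk xS; have [->//|ij] := eqVneq i j; have [dF lF] := FS.
have gk2 : ((size g).+2 <= k)%N by rewrite -ltn_predRL.
apply: (@schwarz (partial g F) i j x L) => // [z r zS|z r r' zS|z z' r r' zS z'S].
- by apply: dF => //; rewrite (leq_trans _ gk2)// ltnW.
- by apply: (dF (r :: g)).
- exact: (lF [:: r, r' & g]).
Qed.

(** Bubbling [i] inwards requires swaps below outer derivatives. The induction hypothesis is an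
    equality on the slab only, so each outer derivative is taken through [derive_slab_eq]. *)
Lemma partial_move i (b1 b2 : seq 'I_n) x : (size (b1 ++ b2) < k)%N -> slab x ->
  partial (i :: b1 ++ b2) F x = partial (b1 ++ i :: b2) F x.
Proof.
have [dF lF] := FS.
elim: b1 x => [//|j b1 IH] x bk xS; rewrite [LHS]partial_swap//; last first.
  by rewrite ltn_predRL.
apply: derive_slab_eq => //.
- by move=> z zS; apply: IH => //; exact: ltnW.
- exact: (dF (i :: b1 ++ b2)).
- by apply: dF => //; move: bk; rewrite /= !size_cat /= addnS.
Qed.

Lemma partial_perm (a b : seq 'I_n) x : perm_eq a b -> (size a <= k)%N -> slab x ->
  partial a F x = partial b F x.
Proof.
have [dF lF] := FS.
elim: a b x => [|i a IH] b x ab ak xS.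
  by move: ab; rewrite perm_sym => /perm_nilP ->.
have ib : i \in b by rewrite -(perm_mem ab) mem_head.
have [b1 [b2 E]] : exists b1 b2, b = b1 ++ i :: b2.
  by case/splitPr: ib => b1 b2; exists b1, b2.
have ab' : perm_eq a (b1 ++ b2).
  move: ab; rewrite E -(cat1s i b2) => ab.
  have /permPl e := perm_catCA b1 [:: i] b2.
  by have := perm_trans ab e; rewrite /= perm_cons.
have sab := perm_size ab'.
rewrite E -partial_move//; last by rewrite -sab.
apply: derive_slab_eq => //.
- by move=> z zS; apply: IH => //; exact: ltnW.
- exact: dF.
- by apply: dF => //; rewrite -sab.
Qed.

End Smooth.

End Slab.

(** * Taylor polynomials over nondecreasing multi-indices *)

Section TaylorPolynomial.
Context {R : realType} {n : nat}.
Implicit Types (a b : seq 'I_n) (v w x xh : 'cV[R]_n) (c : seq 'I_n -> R).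

Lemma gam_cons (r : 'I_n) a : gam (r :: a) = ((count_mem r a).+1 * gam a)%N.
Proof.
rewrite /gam (bigD1 r)//= [in RHS](bigD1 r)//= eqxx add1n factS mulnA; congr muln.
by apply: eq_bigr => i ir; rewrite eq_sym (negbTE ir) add0n.
Qed.

Lemma gam_perm a b : perm_eq a b -> gam a = gam b.
Proof. by move=> /permP ab; apply: eq_bigr => r _; rewrite ab. Qed.

Lemma gam_gt0 a : (0 < gam a)%N.
Proof. by apply: prodn_gt0 => r; exact: fact_gt0. Qed.

Lemma sum_count (G : 'I_n -> R) a :
  \sum_(i <- a) G i = \sum_r (count_mem r a)%:R * G r.
Proof.
elim: a => [|i a IH]; first by rewrite big_nil big1// => r _; rewrite mul0r.
rewrite big_cons IH [in RHS](bigD1 i)//= eqxx add1n mulrS mulrDl mul1r -addrA.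
congr (_ + _); rewrite (bigD1 i)//=; congr (_ + _).
by apply: eq_bigr => r ri; rewrite eq_sym (negbTE ri) add0n.
Qed.

Lemma chi_perm_rem a (l : 'I_(size a)) :
  perm_eq (chi a l) (rem (tnth (in_tuple a) l) a).
Proof.
have la : tnth (in_tuple a) l \in a by exact: mem_tnth.
rewrite -(perm_cons (tnth (in_tuple a) l)).
exact: perm_trans (perm_chi l) (perm_to_rem la).
Qed.

(** Positions are regrouped by letter: removing any occurrence of [r] leaves the same monomial,
    whence the multiplicity. *)
Lemma sum_chi v w a :
  \sum_(l < size a) monom v (chi a l) * w (tnth (in_tuple a) l) 0 =
  \sum_r w r 0 * ((count_mem r a)%:R * monom v (rem r a)).
Proof.
rewrite (eq_bigr (fun l : 'I_(size a) => (fun r => monom v (rem r a) * w r 0)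
   (tnth (in_tuple a) l))) => [|l _]; last by rewrite (monom_perm v (chi_perm_rem l)).
rewrite -(big_tnth _ _ a xpredT (fun r => monom v (rem r a) * w r 0)) sum_count.
by apply: eq_bigr => r _; ring.
Qed.

(** The coefficients are an arbitrary function of the multi-index so that the class is closed under
    differentiation: the derivative in direction [r] lowers the degree and replaces [c] by
    [fun b => c (r :: b)]. *)
Definition taylor (m : nat) c v : R :=
  \sum_(j < m.+1) \sum_(beta : j.-tuple 'I_n | nondecr beta)
    (gam beta)%:R^-1 * c beta * monom v beta.

(** Inserting [r] and sorting is a bijection onto the nondecreasing tuples containing [r], with
    inverse [rem r]. The factor [count_mem r beta] cancels the one by which [gam] grows under
    insertion. *)
Lemma nondecr_insert j (r : 'I_n) c v :
  (forall a, size a = j.+1 -> c a = c (sort ord_leq a)) ->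
  \sum_(beta : j.+1.-tuple 'I_n | nondecr beta)
     (gam beta)%:R^-1 * c beta * ((count_mem r beta)%:R * monom v (rem r beta)) =
  \sum_(beta : j.-tuple 'I_n | nondecr beta)
     (gam beta)%:R^-1 * c (r :: beta) * monom v beta.
Proof.
move=> cS; rewrite (bigID (fun beta : j.+1.-tuple 'I_n => r \in (beta : seq _))) /=.
rewrite [X in _ + X]big1 ?addr0; last first.
  by move=> beta /andP[_ /count_memPn ->]; rewrite mul0r mulr0.
have hP (b : j.-tuple 'I_n) : size (sort ord_leq (r :: b)) == j.+1.
  by rewrite size_sort /= size_tuple.
pose h (b : j.-tuple 'I_n) : j.+1.-tuple 'I_n := Tuple (hP b).
(* The default tuple is reached only when [r] does not occur in [b], a case already discarded. *)
pose h' (b : j.+1.-tuple 'I_n) : j.-tuple 'I_n := insubd (nseq_tuple j r) (rem r b).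
have h'E (b : j.+1.-tuple 'I_n) : r \in (b : seq _) -> h' b = rem r b :> seq _.
  by move=> rb; rewrite /h' val_insubd size_rem// size_tuple eqxx.
have rh (b : j.-tuple 'I_n) : r \in (h b : seq _) by rewrite /= mem_sort mem_head.
have prem (b : j.-tuple 'I_n) : perm_eq (rem r (h b)) b.
  rewrite -(perm_cons r) perm_sym; apply: perm_trans (perm_to_rem (rh b)).
  by rewrite perm_sym; apply: permEl; exact: perm_sort.
rewrite (reindex_onto h h') => [|b /andP[nb rb]]; last first.
  apply: val_inj; rewrite /= h'E//.
  rewrite (@sort_perm _ (r :: rem r b) b) ?sort_nondecr//.
  by rewrite perm_sym; exact: perm_to_rem.
apply: eq_big => [b|b /andP[/andP[nb _] /eqP hb]].
  rewrite rh andbT nondecr_sort /=; apply/eqP/idP => [<-|nb].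
    rewrite nondecrE h'E//; apply: (subseq_sorted ord_leq_trans (rem_subseq _ _)).
    by rewrite -nondecrE nondecr_sort.
  apply: val_inj; rewrite /= h'E//.
  apply: (sorted_eq ord_leq_trans ord_leq_anti) => //; last by rewrite -nondecrE.
  apply: (subseq_sorted ord_leq_trans (rem_subseq _ _)).
  by rewrite -nondecrE nondecr_sort.
have ph : perm_eq (h b) (r :: b) by apply: permEl; exact: perm_sort.
rewrite (gam_perm ph) gam_cons (permP ph) /= eqxx add1n (monom_perm v (prem b)).
rewrite -cS /= ?size_tuple// natrM invfM.
have N0 : (count_mem r b).+1%:R != 0 :> R by rewrite pnatr_eq0.
have N1 : (gam b)%:R != 0 :> R by rewrite pnatr_eq0 -lt0n gam_gt0.
move: (_.+1%:R) N0 ((gam b)%:R) N1 => C N0 g N1.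
by field; rewrite N1 N0.
Qed.

Lemma is_derive_on_taylor (A : set R) m c (v dv : R -> 'cV[R]_n) t :
  (forall a, (size a <= m.+1)%N -> c a = c (sort ord_leq a)) ->
  (forall i, is_derive_on A (fun s => v s i 0) t (dv t i 0)) ->
  is_derive_on A (fun s => taylor m.+1 c (v s)) t
    (\sum_r dv t r 0 * taylor m (fun b => c (r :: b)) (v t)).
Proof.
move=> cS hv.
rewrite (_ : \sum_r _ = \sum_(j < m.+2) \sum_(beta : j.-tuple 'I_n | nondecr beta)
    (gam beta)%:R^-1 * c beta *
     \sum_(l < size beta) monom (v t) (chi beta l) * dv t (tnth (in_tuple beta) l) 0).
  apply: is_derive_on_sum => j _; apply: is_derive_on_sum => beta _.
  by apply: is_derive_onZ; exact: is_derive_on_monom.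
rewrite big_ord_recl [X in _ = X + _]big1 ?add0r; last first.
  by move=> b _; rewrite (size0nil (size_tuple b)) big_ord0 mulr0.
under [RHS]eq_bigr => j _.
  under eq_bigr => b _ do rewrite sum_chi mulr_sumr.
  rewrite exchange_big /=.
  under eq_bigr => r _.
    under eq_bigr => b _ do rewrite mulrCA.
    rewrite -mulr_sumr nondecr_insert; last first.
      by move=> a aj; apply: cS; rewrite aj; exact: ltn_ord j.
    over.
  over.
rewrite exchange_big /=; apply: eq_bigr => r _; rewrite -mulr_sumr; congr (_ * _).
Qed.

Lemma taylor_ext m c c' v : (forall a, (size a <= m)%N -> c a = c' a) ->
  taylor m c v = taylor m c' v.
Proof.
move=> cc; apply: eq_bigr => j _; apply: eq_bigr => b _; rewrite cc// size_tuple.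
by rewrite -ltnS.
Qed.

Lemma taylor0 c v : taylor 0 c v = c [::].
Proof.
rewrite /taylor big_ord1 (big_pred1 [tuple]) => [|b]; last first.
  by rewrite [b]tuple0 /= eqxx.
rewrite monom_nil mulr1 /gam big1 ?invr1 ?mul1r// => r _ /=.
Qed.

Lemma taylor_at0 m c : taylor m c 0 = c [::].
Proof.
rewrite /taylor big_ord_recl [X in _ + X]big1 ?addr0 => [|j _]; last first.
  rewrite big1// => b _; rewrite (tuple_eta b) monom_cons mxE; ring.
by have := taylor0 c 0; rewrite /taylor big_ord1.
Qed.

Lemma is_derive_coord (P : 'cV[R]_n -> R) z r l :
  is_derive_on setT (fun u => P (z + u *: delta_mx r 0)) 0 l ->
  is_derive z (delta_mx r 0) P l.
Proof.
move=> /(is_derive_on_interior filterT) h.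
have E : (fun h : R => h^-1 *: (((fun u => P (z + u *: delta_mx r 0)) \o shift 0) (h *: 1)
     - P (z + 0 *: delta_mx r 0))) =
  (fun h => h^-1 *: ((P \o shift z) (h *: delta_mx r 0) - P z)).
  apply/funext => u /=; rewrite -[u *: (1 : R)]/(u * 1) mulr1 scale0r !addr0.
  by rewrite [z + _]addrC.
case: h => d1 d2; split; first by rewrite /derivable -E.
by rewrite -d2 /derive E.
Qed.

End TaylorPolynomial.

(** * Taylor remainder and chain rule with Lipschitz derivatives *)

Section TaylorRemainder.
Context {R : realType} {n : nat} (i0 : 'I_n) (T : R).
Hypothesis T0 : 0 < T.
Variables (k : nat) (L : R) (F : 'cV[R]_n -> R).
Hypothesis L0 : 0 <= L.
Hypothesis FS : smooth_on i0 T k L F.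
Implicit Types (a b : seq 'I_n) (x xh z : 'cV[R]_n).

(** The coefficients of the Taylor expansion of [partial a F]; since the head of a list is the
    outermost derivative, [b] comes before [a]. *)
Definition jet (a : seq 'I_n) xh (b : seq 'I_n) : R := partial (b ++ a) F xh.

Lemma jet_sort a xh b : slab i0 T xh -> (size b + size a <= k)%N ->
  jet a xh b = jet a xh (sort ord_leq b).
Proof.
move=> xS bk; apply: (partial_perm T0 FS) => //; last by rewrite size_cat.
by rewrite perm_cat2r perm_sym; apply: permEl; exact: perm_sort.
Qed.

(** Induction on the degree: each partial derivative of the remainder of [partial a F] is the
    remainder, one degree lower, of a further partial derivative. [slab_path_bound] integrates it at
    the cost of a factor [n], and degree 0 is the Lipschitz condition. *)
Lemma taylor_remainder m a x xh : (size a + m <= k)%N -> slab i0 T x -> slab i0 T xh ->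
  `|partial a F x - taylor m (jet a xh) (x - xh)| <= n%:R ^+ m * L * `|x - xh| ^+ m.+1.
Proof.
have [dF lF] := FS.
elim: m a x => [|m IH] a x am xS xhS.
  by rewrite taylor0 expr0 mul1r expr1 /jet cat0s; apply: lF => //; rewrite addn0 in am.
pose rho z := partial a F z - taylor m.+1 (jet a xh) (z - xh).
have rho0 : rho xh = 0 by rewrite /rho subrr taylor_at0 /jet cat0s subrr.
have := @slab_path_bound R n i0 T rho x xh (n%:R ^+ m * L * `|x - xh| ^+ m.+1) xS xhS.
rewrite rho0 subr0.
have -> : n%:R ^+ m.+1 * L * `|x - xh| ^+ m.+2 =
    n%:R * (n%:R ^+ m * L * `|x - xh| ^+ m.+1 * `|x - xh|) by rewrite !exprS; ring.
apply; first by rewrite !mulr_ge0 ?exprn_ge0.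
move=> z r zS zx.
have ak : (size a < k)%N by rewrite (leq_trans _ am)// addnS ltnS leq_addr.
have dP : is_derive z (delta_mx r 0) (fun z => taylor m.+1 (jet a xh) (z - xh))
    (taylor m (fun b => jet a xh (r :: b)) (z - xh)).
  apply: is_derive_coord.
  have lin i : is_derive_on setT (fun u => (z + u *: delta_mx r 0 - xh) i 0) 0
      ((delta_mx r 0 : 'cV[R]_n) i 0).
    rewrite (_ : (fun _ => _) = fun u => (z i 0 - xh i 0) + (delta_mx r 0 : 'cV[R]_n) i 0 * u).
      rewrite -[X in is_derive_on _ _ _ X]add0r; apply: is_derive_onD.
        exact: is_derive_on_cst.
      rewrite -[X in is_derive_on _ _ _ X]mulr1; apply: is_derive_onZ.
      exact: is_derive_on_id.
    by apply/funext => u; rewrite !mxE; ring.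
  have := @is_derive_on_taylor R n setT m (jet a xh) (fun u => z + u *: delta_mx r 0 - xh)
    (fun=> delta_mx r 0) 0 _ lin.
  rewrite scale0r addr0 (bigD1 r)//= mxE !eqxx mul1r big1 ?addr0.
    apply=> b bm; apply: jet_sort => //.
    by rewrite addnC (leq_trans _ am)// leq_add2l.
  by move=> i ir; rewrite mxE (negbTE ir) mul0r.
have dA : is_derive z (delta_mx r 0) (partial a F) (partial (r :: a) F z).
  by apply/derivableP/dF.
have dR : is_derive z (delta_mx r 0) rho (partial (r :: a) F z -
    taylor m (fun b => jet a xh (r :: b)) (z - xh)) by exact: is_deriveB.
split; first by case: dR.
have -> : 'D_(delta_mx r 0) rho z = partial (r :: a) F z -
    taylor m (fun b => jet a xh (r :: b)) (z - xh) by case: dR.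
(* Differentiating the polynomial puts [r] outermost, while the jet of [partial (r :: a) F] has it
   inside [b]; symmetry of the derivatives reconciles them. *)
rewrite (@taylor_ext _ _ _ _ (jet (r :: a) xh)) => [|b bm]; last first.
  apply: (@partial_move R n i0 T T0 k L F FS r b a xh) => //.
  by rewrite size_cat (leq_trans _ am)// addnC addnS ltnS leq_add2l.
apply: (le_trans (IH (r :: a) z _ zS xhS)); first by rewrite /= addSnnS.
apply: ler_wpM2l; first by rewrite mulr_ge0// exprn_ge0.
by apply: lerXn2r => //; rewrite nnegrE.
Qed.

Lemma is_derive_on_squeeze (A : set R) (f q : R -> R) t C : q t = 0 -> f t = 0 ->
  is_derive_on A q t 0 -> (forall s, A s -> `|f s| <= C * q s) -> is_derive_on A f t 0.
Proof.
move=> qt ft /is_derive_onP hq hf; apply/is_derive_onP.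
rewrite qt ft in hq *.
have h : C * ((q s - 0) / (s - t)) @[s --> within A t^'] --> C * 0 by exact: cvgMl_tmp.
rewrite mulr0 in h.
apply/cvgrPdist_lt => e e0; move/cvgrPdist_lt : h => /(_ e e0).
rewrite !near_withinE near_simpl; apply: filterS => s hs ts As.
have := hs ts As; rewrite !sub0r !normrN !subr0; move=> h; apply: le_lt_trans h.
rewrite mulrA !normrM ler_wpM2r//.
by apply: (le_trans (hf s As)); rewrite -normrM ler_norm.
Qed.

(** Partial derivatives alone give no chain rule; here it follows from the first-order Taylor
    formula, whose remainder is quadratic because the first derivatives are Lipschitz. *)
Lemma is_derive_on_smooth (A : set R) (x dx : R -> 'cV[R]_n) t : (0 < k)%N -> A t ->
  (forall s, A s -> slab i0 T (x s)) ->
  (forall i, is_derive_on A (fun s => x s i 0) t (dx t i 0)) ->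
  is_derive_on A (fun s => F (x s)) t
    (\sum_r dx t r 0 * 'D_(delta_mx r 0) F (x t)).
Proof.
move=> k0 At xS hx.
have dP : is_derive_on A (fun s => taylor 1 (jet [::] (x t)) (x s - x t)) t
    (\sum_r dx t r 0 * taylor 0 (fun b => jet [::] (x t) (r :: b)) (x t - x t)).
  apply: is_derive_on_taylor => [a a1|i].
    by apply: jet_sort; [exact: xS|rewrite addn0 (leq_trans a1)].
  rewrite (_ : (fun _ => _) = fun s => x s i 0 - x t i 0).
    rewrite -[X in is_derive_on _ _ _ X]subr0; apply: is_derive_onB => //.
    exact: is_derive_on_cst.
  by apply/funext => s; rewrite !mxE.
pose err s := F (x s) - taylor 1 (jet [::] (x t)) (x s - x t).
have err0 : err t = 0 by rewrite /err subrr taylor_at0 /jet subrr.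
(* A differentiable majorant of the squared sup norm, with zero derivative at [t]. *)
pose q s := \sum_i (x s i 0 - x t i 0) * (x s i 0 - x t i 0).
have q0 : q t = 0 by rewrite /q big1// => i _; rewrite subrr mul0r.
have derr : is_derive_on A err t 0.
  apply: (@is_derive_on_squeeze A err q t (n%:R * L)) => //.
    rewrite (_ : 0 = \sum_i ((dx t i 0 - 0) * (x t i 0 - x t i 0) + (x t i 0 - x t i 0) * (dx t i 0 - 0))).
      apply: is_derive_on_sum => i _; apply: is_derive_onM; apply: is_derive_onB => //;
      exact: is_derive_on_cst.
    by rewrite big1// => i _; rewrite subrr; ring.
  move=> s As; have := @taylor_remainder 1 [::] (x s) (x t) k0 (xS s As) (xS t At).
  move=> /le_trans; apply; rewrite expr1; apply: ler_wpM2l; first by rewrite mulr_ge0.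
  have qs0 : 0 <= q s by apply: sumr_ge0 => i _; rewrite -expr2 sqr_ge0.
  rewrite -[q s]sqr_sqrtr// lerXn2r ?nnegrE ?sqrtr_ge0//.
  apply: mx_norm_le => [|i j]; first exact: sqrtr_ge0.
  rewrite (ord1 j) -sqrtr_sqr ler_wsqrtr// /q (bigD1 i)//= !mxE -expr2 lerDl.
  by apply: sumr_ge0 => l _; rewrite -expr2 sqr_ge0.
have := is_derive_onD dP derr; rewrite addr0 subrr.
rewrite (_ : (fun _ => _) = fun s => F (x s)); last by apply/funext => s; rewrite /err addrC subrK.
by under eq_bigr do rewrite taylor0.
Qed.

End TaylorRemainder.

(** * The nonlinearity in phase space *)

Lemma fin_uniform_bound (R : realType) (I : finType) (P : I -> R -> Prop) :
  (forall i, exists2 M, 0 <= M & P i M) ->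
  (forall i M M', M <= M' -> P i M -> P i M') ->
  exists2 M, 0 <= M & forall i, P i M.
Proof.
move=> h mono; have /choice[f hf] : forall i, exists M, 0 <= M /\ P i M.
  by move=> i; have [M M0 PM] := h i; exists M.
exists (\sum_i f i); first by apply: sumr_ge0 => i _; case: (hf i).
move=> i; apply: (mono i (f i)); last by case: (hf i).
by rewrite (bigD1 i)//= lerDl; apply: sumr_ge0 => j _; case: (hf j).
Qed.

Lemma seq_uniform_bound (R : realType) (n k : nat) (P : seq 'I_n -> R -> Prop) :
  (forall a, (size a <= k)%N -> exists2 M, 0 <= M & P a M) ->
  (forall a M M', M <= M' -> P a M -> P a M') ->
  exists2 M, 0 <= M & forall a, (size a <= k)%N -> P a M.
Proof.
move=> h mono.
have [||M M0 hM] := @fin_uniform_bound R 'I_k.+1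
    (fun m M => forall t : m.-tuple 'I_n, P t M).
- move=> m; apply: (@fin_uniform_bound R {: m.-tuple 'I_n} (fun t M => P t M)).
    by move=> t; apply: h; rewrite size_tuple -ltnS.
  by move=> t M M'; exact: mono.
- by move=> m M M' MM' hM t; apply: mono MM' _; exact: hM.
exists M => // a ak; rewrite -ltnS in ak.
exact: (hM (Ordinal ak) (in_tuple a)).
Qed.

Section PartialScale.
Context {R : realType} {n : nat}.

(** Where [G] is not derivable, neither is its nonzero multiple, and both sides take the default
    value 0. Jets of [eps] times the force can thus be computed without derivability conditions. *)
Lemma deriveZ_neq0 (G : 'cV[R]_n -> R) (c : R) x v : c != 0 ->
  'D_v (fun z => c * G z) x = c * 'D_v G x.
Proof.
move=> c0; have [dG|ndG] := pselect (derivable G x v).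
  exact: (@deriveZ R _ _ G c x v dG).
have ndcG : ~ derivable (fun z => c * G z) x v.
  move=> h; apply: ndG; have h' := @derivableZ R _ _ (fun z => c * G z) c^-1 x v h.
  have E : G = c^-1 \*: (fun z => c * G z) by apply/funext => z; rewrite /= [RHS]mulKf.
  rewrite E; exact: h'.
by rewrite /derive (dvgP ndG) (dvgP ndcG) mulr0.
Qed.

Lemma partialZ (a : seq 'I_n) (G : 'cV[R]_n -> R) (c : R) : c != 0 ->
  partial a (fun z => c * G z) = fun z => c * partial a G z.
Proof.
move=> c0; elim: a => [//|r a IH]; rewrite /= IH.
by apply/funext => z; rewrite deriveZ_neq0.
Qed.

Lemma partial_cst (a : seq 'I_n) (c : R) :
  partial a (fun _ : 'cV[R]_n => c) = fun=> (a == [::])%:R * c.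
Proof.
elim: a => [|r a IH]; first by apply/funext => z; rewrite mul1r.
by rewrite /= IH; apply/funext => z; rewrite mul0r; exact: derive_cst.
Qed.

End PartialScale.

Section Reindex.
Context {R : realType} {d : nat}.
Local Notation N := (d + d + 1)%N.

Definition yt_index (j : 'I_(d + 1)) : 'I_N :=
  match fintype.split j with
  | inl a => lshift 1 (lshift d a)
  | inr b => rshift (d + d) b
  end.

Lemma yt_index_inj : injective yt_index.
Proof.
move=> i j; rewrite /yt_index -{2}(splitK i) -{2}(splitK j).
case: (fintype.split i) => a; case: (fintype.split j) => b /= /eqP.
- by rewrite eq_lshift eq_lshift => /eqP ->.
- by rewrite eq_lrshift.
- by rewrite eq_rlshift.
- by rewrite eq_rshift => /eqP ->.
Qed.

Definition yt_part (z : 'cV[R]_N) : 'cV[R]_(d + 1) := \col_j z (yt_index j) 0.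

Lemma usub_yt z : usubmx (yt_part z) = ypart z.
Proof.
apply/colP => i; rewrite !mxE /yt_index.
by have := unsplitK (inl i : 'I_d + 'I_1) => /= ->.
Qed.

Lemma dsub_yt z : dsubmx (yt_part z) 0 0 = tpart z.
Proof.
rewrite /tpart !mxE /yt_index.
by have := unsplitK (inr 0 : 'I_d + 'I_1) => /= ->.
Qed.

Lemma yt_partD z w : yt_part (z + w) = yt_part z + yt_part w.
Proof. by apply/colP => i; rewrite !mxE. Qed.

Lemma yt_partZ c z : yt_part (c *: z) = c *: yt_part z.
Proof. by apply/colP => i; rewrite !mxE. Qed.

Lemma yt_part_norm z w : `|yt_part z - yt_part w| <= `|z - w|.
Proof.
apply: mx_norm_le => // i j; rewrite !mxE.
by have := ler_mx_norm_coord (z - w) (yt_index i) 0; rewrite !mxE.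
Qed.

Lemma yt_delta (r : 'I_N) : yt_part (delta_mx r 0) = 0 \/
  exists r', yt_part (delta_mx r 0) = delta_mx r' 0.
Proof.
have [/existsP[j /eqP rj]|/existsPn h] := boolP [exists j, r == yt_index j].
  right; exists j; apply/colP => i; rewrite !mxE rj !andbT.
  by rewrite (inj_eq yt_index_inj).
by left; apply/colP => i; rewrite !mxE eq_sym (negbTE (h i)).
Qed.

Lemma growth_yt (G : 'cV[R]_(d + 1) -> R) z r :
  (fun h : R => h^-1 *: (((G \o yt_part) \o shift z) (h *: delta_mx r 0) - (G \o yt_part) z)) =
  (fun h : R => h^-1 *: ((G \o shift (yt_part z)) (h *: yt_part (delta_mx r 0)) - G (yt_part z))).
Proof. by apply/funext => h; rewrite /= yt_partD yt_partZ. Qed.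

Lemma derive_yt (G : 'cV[R]_(d + 1) -> R) z r :
  'D_(delta_mx r 0) (G \o yt_part) z = 'D_(yt_part (delta_mx r 0)) G (yt_part z).
Proof. by rewrite /derive growth_yt. Qed.

Lemma derivable_yt (G : 'cV[R]_(d + 1) -> R) z r :
  derivable G (yt_part z) (yt_part (delta_mx r 0)) ->
  derivable (G \o yt_part) z (delta_mx r 0).
Proof. by rewrite /derivable growth_yt. Qed.

(** A basis direction of phase space projects either to a basis direction in (y, t) or, for the
    momentum [p], to 0; in the latter case the derivative vanishes identically. *)
Lemma partial_yt (G : 'cV[R]_(d + 1) -> R) (a : seq 'I_N) :
  (exists2 b, size b = size a & partial a (G \o yt_part) = partial b G \o yt_part) \/
  partial a (G \o yt_part) = fun=> 0.
Proof.
elim: a => [|r a [[b sb IH]|IH]]; first by left; exists [::].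
- have [r0|[r' r'E]] := yt_delta r.
    right; rewrite /= IH; apply/funext => z.
    by rewrite derive_yt r0 derive0.
  left; exists (r' :: b); first by rewrite /= sb.
  by rewrite /= IH; apply/funext => z; rewrite derive_yt r'E.
- by right; rewrite /= IH; apply/funext => z; exact: derive_cst.
Qed.

Definition t_index : 'I_N := rshift (d + d) (0 : 'I_1).

Lemma slab_yt T z : slab t_index T z = strip d T (yt_part z).
Proof. by rewrite /slab /strip /= dsub_yt /tpart mxE. Qed.

Lemma smooth_on_yt (T : R) (k : nat) (G : 'cV[R]_(d + 1) -> R) :
  derivs_lipschitz k (strip d T) G ->
  exists2 L, 0 <= L & smooth_on t_index T k L (G \o yt_part).
Proof.
move=> [dG lG].
have [||L L0 hL] := @seq_uniform_bound R (d + 1) k (fun a M => forall x y,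
   strip d T x -> strip d T y -> `|partial a G x - partial a G y| <= M * `|x - y|).
- move=> a ak; have /pinfty_ex_gt0[M M0 hM] := lG a ak.
  exists M; first exact: ltW.
  by move=> x y xS yS; apply: (hM (x, y)); split.
- move=> a M M' MM' h x y xS yS; apply: (le_trans (h x y xS yS)).
  exact: ler_wpM2r.
exists L => //; split.
- move=> a r x ak; rewrite slab_yt => xS.
  have [[b sb ->]|->] := partial_yt G a; last exact: derivable_cst.
  apply: derivable_yt; have [->|[r' ->]] := yt_delta r; first exact: derivable0.
  by apply: dG => //; rewrite sb.
- move=> a x y ak; rewrite !slab_yt => xS yS.
  have [[b sb ->]|->] := partial_yt G a.
    apply: (le_trans (hL b _ _ _ xS yS)); first by rewrite sb.
    by apply: ler_wpM2l => //; exact: yt_part_norm.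
  by rewrite subrr normr0 mulr_ge0.
Qed.

End Reindex.

(** * The error of the monomials *)

Section Listing.
Context {R : realType} {n : nat} (k : nat) (s : seq (seq 'I_n)).
Hypothesis sP : multi_index_listing k s.
Local Notation D := (size s).
Implicit Types (w : 'cV[R]_D).

Lemma midx0 (i : 'I_D) : (midx i == [::]) = ((i : nat) == 0%N).
Proof.
have [us _ [s' sE]] := sP.
have s0 : nth [::] s 0 = [::] by rewrite sE.
have D0 : (0 < D)%N by rewrite sE.
by rewrite /midx -{2}s0 nth_uniq.
Qed.

Lemma nth_listing (r : 'I_n) : (r.+1 < D)%N /\ nth [::] s r.+1 = [:: r].
Proof.
have [us _ [s' sE]] := sP; rewrite sE /=; split.
  by rewrite ltnS size_cat size_map size_enum_ord (leq_trans (ltn_ord r))// leq_addr.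
rewrite nth_cat size_map size_enum_ord ltn_ord (nth_map r) ?size_enum_ord//.
by rewrite nth_ord_enum.
Qed.

Lemma Pi2_entry w r : (Pi2 s *m w) r 0 = entry w [:: r].
Proof.
have [lt rE] := nth_listing r; rewrite /Pi2 mxE.
have <- : midx (Ordinal lt) = [:: r] by [].
rewrite (entry_midx sP) (bigD1 (Ordinal lt))//= mxE eqxx mul1r big1 ?addr0//.
by move=> j; rewrite -val_eqE /= mxE => /negbTE ->; rewrite mul0r.
Qed.

Lemma Pi2_e1 : Pi2 s *m e1 s = 0 :> 'cV[R]_n.
Proof.
apply/colP => r; rewrite mxE [RHS]mxE big1// => j _; rewrite !mxE.
by case: eqP => [->|_]; rewrite ?mulr0 ?mul0r.
Qed.

Lemma Pi2_monvec (X x : 'cV[R]_n) : (0 < k)%N -> Pi2 s *m monvec s X x = x - X.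
Proof.
move=> k0; apply/colP => r; rewrite Pi2_entry (entry_monvec sP)//.
by rewrite monom_cons monom_nil mulr1.
Qed.

(** [e1] is the vector of monomials at the centre, so only monomials of positive degree contribute,
    each with a factor of size at most [|x - X|]. *)
Lemma monvec_e1 (X x : 'cV[R]_n) rho : `|x - X| <= rho ->
  `|monvec s X x - e1 s| <= (1 + rho) ^+ k * `|x - X|.
Proof.
move=> xr; have rho0 : 0 <= rho by apply: le_trans xr.
have r1 : 1 <= (1 + rho) ^+ k by rewrite exprn_ege1// lerDl.
apply: mx_norm_le => [|i j]; first by rewrite mulr_ge0// (le_trans _ r1).
rewrite (ord1 j) !mxE -midx0.
have := size_midx sP i; case: (midx i) => [|r a] /= ak.
  by rewrite monom_nil mulr1n subrr normr0 mulr_ge0// (le_trans _ r1).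
rewrite subr0 monom_cons normrM mulrC; apply: ler_pM => //.
  apply: (le_trans (monom_le _ (_ : _ <= 1 + rho))).
    by rewrite (le_trans xr)// lerDr.
  by rewrite ler_weXn2l ?lerDl// ltnW.
exact: ler_mx_norm_coord.
Qed.

End Listing.

Section ErrorODE.
Context {R : realType} {n : nat} (k : nat) (s : seq (seq 'I_n)).
Hypothesis sP : multi_index_listing k s.
Local Notation D := (size s).
Variables (A1 : 'M[R]_n) (f : 'cV[R]_n -> 'cV[R]_n) (eps a b : R) (X : 'cV[R]_n).
Variables (x : R -> 'cV[R]_n).
Let dx t := eps^-1 *: (A1 *m x t) + f (x t).
Hypothesis dxP : forall t i, a <= t <= b -> is_derive_on `[a, b] (fun s => x s i 0) t (dx t i 0).

Definition fjet (r : 'I_n) (be : seq 'I_n) : R := partial be (fun z => f z r 0) X.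

Definition ext_mx : 'M[R]_D := eps^-1 *: ext1_mx s A1 X + ext0_mx k s f X.

Definition mon_error t : 'cV[R]_D :=
  monvec s X (x t) - expm ((t - a) *: ext_mx) *m e1 s.

(** A row of degree [j] multiplies a monomial of degree [j - 1] by the remainder of a Taylor
    polynomial of degree [k - j + 1], so all nonconstant rows have the same order [k + 1] in the
    distance to [X]. *)
Definition defect t : 'cV[R]_D := \col_i
  \sum_(l < size (midx i)) monom (x t - X) (chi (midx i) l) *
    (f (x t) (tnth (in_tuple (midx i)) l) 0 -
     taylor (k - size (midx i) + 1) (fjet (tnth (in_tuple (midx i)) l)) (x t - X)).

Definition dmon_error t : 'cV[R]_D := ext_mx *m mon_error t + defect t.

(** On true vectors of monomials the two matrices reproduce Leibniz' rule along the equation, except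
    that [f] is replaced by its truncated Taylor polynomial. *)
Lemma is_derive_on_mon_error t i : a <= t <= b ->
  is_derive_on `[a, b] (fun s => mon_error s i 0) t (dmon_error t i 0).
Proof.
move=> tab.
have dz : is_derive_on `[a, b] (fun u => (expm ((u - a) *: ext_mx) *m e1 s) i 0) t
    ((ext_mx *m (expm ((t - a) *: ext_mx) *m e1 s)) i 0).
  have := @is_derive_on_expm_mul R D ext_mx `[a, b] (fun=> e1 s) (fun=> 0) 1 a t i _.
  rewrite add0r scale1r mulmxA expm_comm -mulmxA mul1r.
  rewrite (_ : (fun _ => _) = fun u => (expm ((u - a) *: ext_mx) *m e1 s) i 0).
    by apply=> j; rewrite [X in is_derive_on _ _ _ X]mxE; exact: is_derive_on_cst.
  by apply/funext => u; rewrite mul1r.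
have dm : is_derive_on `[a, b] (fun u => monvec s X (x u) i 0) t
    ((ext_mx *m monvec s X (x t) + defect t) i 0).
  have dxX j : is_derive_on `[a, b] (fun u => (x u - X) j 0) t (dx t j 0).
    rewrite (_ : (fun _ => _) = fun u => x u j 0 - X j 0).
      rewrite -[X in is_derive_on _ _ _ X]subr0; apply: is_derive_onB; first exact: dxP.
      exact: is_derive_on_cst.
    by apply/funext => u; rewrite !mxE.
  rewrite (_ : (fun _ => _) = fun u => monom (x u - X) (midx i)).
    have := is_derive_on_monom (a := midx i) dxX; congr is_derive_on.
    rewrite mxE mulmxDl mxE -scalemxAl mxE (ext1_mxP sP A1 X) (ext0_mxP sP f X) mxE.
    rewrite mulr_sumr -!big_split /=; apply: eq_bigr => l _.
    set r := tnth _ l.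
    rewrite (_ : \sum_(m < (k - size (midx i) + 1).+1) _ =
       monom (x t - X) (chi (midx i) l) *
         taylor (k - size (midx i) + 1) (fjet r) (x t - X)); last first.
      rewrite /taylor mulr_sumr; apply: eq_bigr => m _.
      rewrite mulr_sumr; apply: eq_bigr => be _; rewrite /fjet; ring.
    rewrite (_ : \sum_(m < n) _ = monom (x t - X) (chi (midx i) l) * (A1 *m x t) r 0).
      rewrite /dx !mxE; ring.
    by rewrite mxE mulr_sumr; apply: eq_bigr => m _; rewrite subrK; ring.
  by apply/funext => u; rewrite mxE.
have := is_derive_onB dm dz.
rewrite (_ : (fun _ => _) = fun u => mon_error u i 0); last first.
  by apply/funext => u; rewrite !mxE.
by congr is_derive_on; rewrite /dmon_error /mon_error mulmxBr !mxE; ring.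
Qed.

Hypothesis k0 : (0 < k)%N.

Lemma LLE_step_error : x b - LLE_step k s A1 f eps (b - a) X = Pi2 s *m mon_error b.
Proof.
by rewrite /LLE_step mulmxBr (Pi2_monvec sP)// opprD addrA.
Qed.

Lemma mon_error_init : mon_error a = monvec s X (x a) - e1 s.
Proof. by rewrite /mon_error subrr scale0r expm0 mul1mx. Qed.

(** The rows of the empty tuple vanish and the constant monomial is 1 initially on both sides. This
    removes the shift by [X] from the degree-one rows, and later the constant term of the time
    equation. *)
Lemma mon_error_nil t : a <= t <= b -> entry (mon_error t) [::] = 0.
Proof.
move=> /andP[at_ tb]; have [i iE] := midx_ex sP (isT : (size [::] <= k)%N).
have {}iE : midx i = [::] by rewrite iE.
rewrite -iE (entry_midx sP).
have i0 : midx i == [::] by rewrite iE.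
have d0 u : a <= u <= b -> dmon_error u i 0 = 0.
  move=> uab; rewrite /dmon_error mxE mulmxDl mxE -scalemxAl mxE (ext1_mul sP).
  by rewrite (ext0_mul sP) mxE; move/eqP: i0 => ->; rewrite !big_ord0 mulr0 !addr0.
have sub : `[a, t] `<=` `[a, b].
  by apply: subset_itvl; rewrite bnd_simp.
have := @MVT_on_le R a t 0 (fun u => mon_error u i 0) (fun u => dmon_error u i 0) at_.
rewrite mul0r normr_le0 subr_eq0 => H.
have -> : mon_error t i 0 = mon_error a i 0.
  apply/eqP; apply: H => [u|u] /andP[au ut].
    apply: is_derive_on_subset sub _; apply: is_derive_on_mon_error.
    by rewrite au (le_trans ut).
  by rewrite d0 ?normr0// au (le_trans ut).
rewrite mon_error_init !mxE -(midx0 sP) i0.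
by move/eqP: i0 => ->; rewrite monom_nil subrr.
Qed.

Definition lin_rest r t : R := \sum_(m < k.+1) \sum_(be : m.-tuple 'I_n | nondecr be)
   (gam be)%:R^-1 * fjet r be * entry (mon_error t) be.

Definition point_defect r t : R := f (x t) r 0 - taylor k (fjet r) (x t - X).

(** In a row of degree one, [chi] is empty and the shift of the centre multiplies the vanishing
    constant entry. Only the unshifted stiff matrix remains, which is what the energy estimate
    needs; higher monomials enter through [lin_rest] alone. *)
Lemma is_derive_on_point_error r t : a <= t <= b ->
  is_derive_on `[a, b] (fun u => (Pi2 s *m mon_error u) r 0) t
    (eps^-1 * (A1 *m (Pi2 s *m mon_error t)) r 0 + lin_rest r t + point_defect r t).
Proof.
move=> tab; have [lt rE] := nth_listing sP r; pose i := Ordinal lt.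
have iE : midx i = [:: r] by [].
rewrite (_ : (fun _ => _) = fun u => mon_error u i 0); last first.
  by apply/funext => u; rewrite (Pi2_entry sP) -iE (entry_midx sP).
have := @is_derive_on_mon_error t i tab; congr is_derive_on.
rewrite /dmon_error mxE mulmxDl mxE -scalemxAl mxE (ext1_mul sP) (ext0_mul sP) [defect _ _ _]mxE.
rewrite iE !big_ord1 /= chi0 monom_nil mul1r (tnth_nth r) /= subn1 addn1 prednK//.
rewrite mon_error_nil//; congr (_ + _ + _); congr (_ * _).
by rewrite mxE; apply: eq_bigr => m _; rewrite mulr0 addr0 (Pi2_entry sP).
Qed.

End ErrorODE.

Section ErrorBounds.
Context {R : realType} {n : nat} (k : nat) (s : seq (seq 'I_n)).
Hypothesis sP : multi_index_listing k s.
Local Notation D := (size s).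

Definition tuple_count : R := \sum_(m < k.+1) #|{: m.-tuple 'I_n}|%:R.

Lemma tuple_count_ge0 : 0 <= tuple_count. Proof. exact: sumr_ge0. Qed.

Lemma multi_sum_le m (Phi : seq 'I_n -> R) B : (m <= k)%N -> 0 <= B ->
  (forall be, (size be <= k)%N -> `|Phi be| <= B) ->
  `|\sum_(j < m.+1) \sum_(be : j.-tuple 'I_n | nondecr be) (gam be)%:R^-1 * Phi be|
  <= tuple_count * B.
Proof.
move=> mk B0 hP; apply: (le_trans (ler_norm_sum _ _ _)).
pose G j : R := #|{: j.-tuple 'I_n}|%:R * B.
have inner (j : nat) : (j <= k)%N -> `|\sum_(be : j.-tuple 'I_n | nondecr be)
    (gam be)%:R^-1 * Phi be| <= G j.
  move=> jk; apply: (le_trans (ler_norm_sum _ _ _)).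
  apply: (@le_trans _ _ (\sum_(be : j.-tuple 'I_n | nondecr be) B)).
    apply: ler_sum => be _; rewrite normrM ger0_norm ?invr_ge0//.
    rewrite -[leRHS]mul1r ler_pM ?invr_ge0 ?hP ?size_tuple//.
    by rewrite invf_le1 ?ltr0n ?gam_gt0// ler1n gam_gt0.
  apply: (@le_trans _ _ (\sum_(be : j.-tuple 'I_n) B)).
    by rewrite [leRHS](bigID (fun be : j.-tuple 'I_n => nondecr be)) /= lerDl sumr_ge0.
  by rewrite sumr_const /G mulr_natl.
apply: (@le_trans _ _ (\sum_(j < m.+1) G j)).
  by apply: ler_sum => j _; apply: inner; rewrite (leq_trans _ mk)// -ltnS.
rewrite /tuple_count mulr_suml -(big_mkord xpredT G) -(big_mkord xpredT G).
rewrite [leRHS](big_cat_nat (n := m.+1))//= lerDl.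
by apply: sumr_ge0 => j _; rewrite mulr_ge0.
Qed.

Lemma ext0_le (f : 'cV[R]_n -> 'cV[R]_n) X F (w : 'cV[R]_D) : 0 <= F ->
  (forall r be, (size be <= k)%N -> `|fjet f X r be| <= F) ->
  `|ext0_mx k s f X *m w| <= k%:R * (tuple_count * (F * (D%:R * `|w|))).
Proof.
move=> F0 hF; have c0 := tuple_count_ge0.
have W0 : 0 <= F * (D%:R * `|w|) by rewrite !mulr_ge0.
apply: mx_norm_le => [|i j]; first by rewrite !mulr_ge0.
rewrite (ord1 j) (ext0_mul sP); apply: (le_trans (ler_norm_sum _ _ _)).
apply: (@le_trans _ _ (\sum_(l < size (midx i)) tuple_count * (F * (D%:R * `|w|)))).
  apply: ler_sum => l _; set r := tnth _ l.
  have := @multi_sum_le (k - size (midx i) + 1)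
    (fun be => fjet f X r be * entry w (chi (midx i) l ++ be)) (F * (D%:R * `|w|)).
  under eq_bigr do under eq_bigr do rewrite mulrA.
  apply=> //.
    have := ltn_ord l; have := size_midx sP i; lia.
  by move=> be bk; rewrite normrM ler_pM// ?hF// entry_le.
rewrite sumr_const card_ord -[leLHS]mulr_natl ler_wpM2r// ?mulr_ge0//.
by rewrite ler_nat size_midx.
Qed.

Lemma lin_rest_le (A1 : 'M[R]_n) (f : 'cV[R]_n -> 'cV[R]_n) eps a X x r t F : 0 <= F ->
  (forall be, (size be <= k)%N -> `|fjet f X r be| <= F) ->
  `|lin_rest k s A1 f eps a X x r t| <=
    tuple_count * (F * (D%:R * `|mon_error k s A1 f eps a X x t|)).
Proof.
move=> F0 hF; rewrite /lin_rest; set w := mon_error _ _ _ _ _ _ _ _ _.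
under eq_bigr do under eq_bigr do rewrite -mulrA.
apply: (@multi_sum_le k (fun be => fjet f X r be * entry w be)) => //.
  by rewrite !mulr_ge0.
by move=> be bk; rewrite normrM ler_pM// ?hF// entry_le.
Qed.

Lemma defect_le (f : 'cV[R]_n -> 'cV[R]_n) X x t v q : 0 <= q -> `|x t - X| <= v ->
  (forall r j, (j <= k)%N ->
     `|f (x t) r 0 - taylor j (fjet f X r) (x t - X)| <= q * v ^+ j.+1) ->
  `|defect k s f X x t| <= k%:R * (q * v ^+ k.+1).
Proof.
move=> q0 xv hr; have v0 : 0 <= v by apply: le_trans xv.
have W0 : 0 <= q * v ^+ k.+1 by rewrite mulr_ge0// exprn_ge0.
apply: mx_norm_le => [|i j]; first by rewrite mulr_ge0.
rewrite mxE; apply: (le_trans (ler_norm_sum _ _ _)).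
apply: (@le_trans _ _ (\sum_(l < size (midx i)) q * v ^+ k.+1)).
  apply: ler_sum => l _; rewrite normrM.
  have sk := size_midx sP i; have sl := ltn_ord l; have sc := size_chi l.
  have -> : k.+1 = (size (chi (midx i) l) + (k - size (midx i) + 1).+1)%N by lia.
  rewrite exprD mulrCA; apply: ler_pM => //; first exact: monom_le.
  by apply: hr; lia.
rewrite sumr_const card_ord -[leLHS]mulr_natl ler_wpM2r//.
by rewrite ler_nat size_midx.
Qed.

(** The matrix of the scheme differs from [eps^-1] times the extension matrix at 0 by the centre
    shift, bounded by [cX] because [A1 *m X] is O(eps), and by [ext0_mx], bounded through the jets.
    [C] is fixed before [f], [eps] and [X]. *)
Lemma mon_error_growth (A1 : 'M[R]_n) kap :
  (forall t, `|expm (t *: ext1_mx s A1 0)| <= kap) ->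
  exists2 C, 0 <= C & forall (f : 'cV[R]_n -> 'cV[R]_n) (eps a b : R) (X : 'cV[R]_n)
      (x : R -> 'cV[R]_n) (cX F del : R),
    (forall t i, a <= t <= b -> is_derive_on `[a, b] (fun s => x s i 0) t
       ((eps^-1 *: (A1 *m x t) + f (x t)) i 0)) ->
    0 < eps -> 0 <= cX -> 0 <= F -> 0 <= del ->
    `|A1 *m X| <= eps * cX ->
    (forall r be, (size be <= k)%N -> `|fjet f X r be| <= F) ->
    (forall t, a <= t <= b -> `|defect k s f X x t| <= del) ->
    forall t, a <= t <= b -> `|mon_error k s A1 f eps a X x t| <=
      C * expR (C * (cX + F) * (b - a)) *
      (`|mon_error k s A1 f eps a X x a| + del * (b - a)).
Proof.
move=> /stable_growth[C0 C00 hC0].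
have c0 := tuple_count_ge0.
pose c1 := k%:R * D%:R * (1 + tuple_count).
have c10 : 0 <= c1 by rewrite !mulr_ge0// addr_ge0.
exists (C0 + C0 * c1); first by rewrite addr_ge0// mulr_ge0.
move=> f eps a b X x cX F del dx e0 cX0 F0 del0 hX hF hdel t /andP[at_ tb].
set e := mon_error k s A1 f eps a X x.
pose de u := dmon_error k s A1 f eps a X x u.
have ab u : a <= u <= t -> a <= u <= b by move=> /andP[-> ut]; exact: le_trans ut tb.
have sub : `[a, t] `<=` `[a, b] by apply: subset_itvl; rewrite bnd_simp.
have H := hC0 (c1 * (cX + F)) del eps^-1 a t e de at_.
have cF : 0 <= cX + F by rewrite addr_ge0.
apply: (@le_trans _ _ (C0 * expR (C0 * (c1 * (cX + F)) * (t - a)) *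
    (`|e a| + del * (t - a)))).
  apply: H => //; first by rewrite mulr_ge0.
    move=> u i aut; apply: is_derive_on_subset sub _.
    by apply: is_derive_on_mon_error => //; exact: ab.
  move=> u aut.
  have E : de u - eps^-1 *: (ext1_mx s A1 0 *m e u) =
    eps^-1 *: ((ext1_mx s A1 X - ext1_mx s A1 0) *m e u) + ext0_mx k s f X *m e u
    + defect k s f X x u.
    rewrite /de /dmon_error -/(e u) /ext_mx mulmxDl -scalemxAl mulmxBl scalerBr.
    have aux (p q r z : 'cV[R]_D) : p + q + r - z = p - z + q + r.
      by rewrite addrAC [p + q - z]addrAC.
    exact: aux.
  rewrite E; apply: (le_trans (ler_normD _ _)); apply: lerD; last by apply: hdel; exact: ab.
  apply: (le_trans (ler_normD _ _)).
  have h1 : `|eps^-1 *: ((ext1_mx s A1 X - ext1_mx s A1 0) *m e u)| <=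
      k%:R * (cX * (D%:R * `|e u|)).
    rewrite normrZ normfV (gtr0_norm e0) [leLHS]mulrC ler_pdivrMr//.
    apply: mx_norm_le => [|i j]; first by rewrite !mulr_ge0// ltW.
    have -> : ((ext1_mx s A1 X - ext1_mx s A1 0) *m e u) i j =
        \sum_(l < size (midx i)) (A1 *m X) (tnth (in_tuple (midx i)) l) 0 *
           entry (e u) (chi (midx i) l).
      rewrite (ord1 j) mulmxBl mxE [X in _ + X]mxE (ext1_mul0 sP) addrC addKr.
      by [].
    apply: (le_trans (ler_norm_sum _ _ _)).
    apply: (@le_trans _ _ (\sum_(l < size (midx i)) eps * cX * (D%:R * `|e u|))).
      apply: ler_sum => l _; rewrite normrM; apply: ler_pM => //; last exact: entry_le.
      by apply: (le_trans _ hX); exact: ler_mx_norm_coord.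
    have -> : k%:R * (cX * (D%:R * `|e u|)) * eps = k%:R * (eps * cX * (D%:R * `|e u|)) by ring.
    rewrite sumr_const card_ord -[leLHS]mulr_natl ler_wpM2r//.
      by rewrite !mulr_ge0// ltW.
    by rewrite ler_nat size_midx.
  have h2 := ext0_le (e u) F0 hF.
  apply: (le_trans (lerD h1 h2)).
  have D0 : 0 <= D%:R * `|e u| by rewrite mulr_ge0.
  have -> : c1 * (cX + F) * `|e u| = k%:R * ((1 + tuple_count) * (cX + F) * (D%:R * `|e u|)).
    by rewrite /c1; ring.
  rewrite -mulrDr ler_wpM2l//.
  have -> : cX * (D%:R * `|e u|) + tuple_count * (F * (D%:R * `|e u|)) =
    (cX + tuple_count * F) * (D%:R * `|e u|) by ring.
  rewrite ler_wpM2r//.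
  have := mulr_ge0 c0 cX0; nra.
have ta : t - a <= b - a by rewrite lerD2r.
have ta0 : 0 <= t - a by rewrite subr_ge0.
apply: ler_pM.
- by rewrite mulr_ge0// expR_ge0.
- by rewrite addr_ge0// mulr_ge0.
- apply: ler_pM => //; first by rewrite lerDl mulr_ge0.
  rewrite ler_expR; apply: ler_pM => //.
    by apply: mulr_ge0 => //; apply: mulr_ge0.
  by rewrite mulrDl -mulrA lerDr; apply: mulr_ge0.
- by rewrite lerD2l ler_wpM2l.
Qed.

End ErrorBounds.

(** * The oscillator *)

Section OscEnergy.
Context {R : realType} {d : nat} (M : 'M[R]_d).
Hypothesis hM : sym_posdef M.

(** The Gram matrix of twice the oscillator energy in the scaled variables (y, p). *)
Definition osc_G : 'M[R]_(d + d) := block_mx M 0 0 1%:M.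

Lemma quad_osc_G (v : 'cV[R]_(d + d)) :
  quad osc_G v = quad M (usubmx v) + \sum_i (dsubmx v) i 0 ^+ 2.
Proof.
rewrite /quad -{1 2}(vsubmxK v) tr_col_mx mul_row_block !mulmx0 addr0 add0r mul_row_col.
rewrite mulmx1 mxE; congr (_ + _); rewrite mxE; apply: eq_bigr => i _.
by rewrite mxE expr2.
Qed.

Lemma osc_G_posdef : sym_posdef osc_G.
Proof.
have [MT _] := hM; split.
  by rewrite /osc_G tr_block_mx MT !trmx0 tr_scalar_mx.
move=> v v0; rewrite quad_osc_G.
have s0 : 0 <= \sum_i (dsubmx v) i 0 ^+ 2 by apply: sumr_ge0 => i _; exact: sqr_ge0.
have q0 := quad_ge0 hM (usubmx v).
rewrite lt_neqAle addr_ge0// andbT eq_sym paddr_eq0//; apply: contra v0.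
move=> /andP[/eqP/(quad_eq0 hM) u0 /eqP ds0].
rewrite -(vsubmxK v) u0; have -> : dsubmx v = 0; last by rewrite col_mx0.
apply/colP => i; rewrite [RHS]mxE; apply/eqP; rewrite -sqrf_eq0; apply/eqP.
have /psumr_eq0P : (forall i, true -> 0 <= dsubmx v i 0 ^+ 2) by move=> j _; exact: sqr_ge0.
by move=> /(_ ds0)/(_ i isT).
Qed.

Lemma osc_A_mul (v : 'cV[R]_(d + d)) :
  osc_A M *m v = col_mx (dsubmx v) (- (M *m usubmx v)).
Proof.
by rewrite -{1}(vsubmxK v) mul_block_col !mul0mx add0r addr0 mul1mx mulNmx.
Qed.

Lemma osc_A_skew v : bil osc_G v (osc_A M *m v) = 0.
Proof.
have [MT _] := hM.
rewrite /bil osc_A_mul -{1}(vsubmxK v) tr_col_mx mul_row_block !mulmx0 addr0 add0r.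
rewrite mul_row_col mulmx1 mulmxN mxE [X in _ + X]mxE.
have -> : (usubmx v)^T *m M *m dsubmx v = ((dsubmx v)^T *m (M *m usubmx v))^T.
  by rewrite !trmx_mul trmxK MT.
by rewrite mxE subrr.
Qed.

Lemma osc_A_unit : osc_A M \in unitmx.
Proof.
apply: unitmx_ker => v; rewrite osc_A_mul -[0](vsubmxK 0) => /eq_col_mx[d0 u0].
rewrite linear0 in d0; rewrite linear0 in u0.
rewrite -(vsubmxK v) d0; have -> : usubmx v = 0; last by rewrite !linear0.
have Mu := posdef_unit hM.
by rewrite -[LHS](mulKmx Mu) -[M *m _]opprK u0 oppr0 mulmx0.
Qed.

Lemma osc_A1_mul (v : 'cV[R]_(d + d + 1)) :
  osc_A1 M *m v = col_mx (osc_A M *m usubmx v) 0.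
Proof.
by rewrite -{1}(vsubmxK v) mul_block_col !mul0mx !addr0.
Qed.

Lemma osc_A1_flow_bound (v : 'cV[R]_(d + d + 1)) :
  exists C, forall t, `|expm (t *: osc_A1 M) *m v| <= C.
Proof.
have [c c0 hc] := posdef_coercive osc_G_posdef.
pose q := Num.sqrt (quad osc_G (usubmx v)).
exists (c * q + `|v|) => t.
have q0 : 0 <= c * q by rewrite mulr_ge0// sqrtr_ge0.
(* The growth estimates run forward only; [sg = -1] covers negative times. *)
pose w (sg u : R) := expm ((sg * (u - 0)) *: osc_A1 M) *m v.
have w0 sg : w sg 0 = v by rewrite /w subrr mulr0 scale0r expm0 mul1mx.
have dw sg u b i : is_derive_on `[0, b] (fun u => w sg u i 0) u (sg * (osc_A1 M *m w sg u) i 0).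
  have := @is_derive_on_expm_mul R _ (osc_A1 M) `[0, b] (fun=> v) (fun=> 0) sg 0 u i _.
  rewrite add0r -scalemxAr mxE mulmxA expm_comm -mulmxA; apply => j.
  by rewrite [X in is_derive_on _ _ _ X]mxE; exact: is_derive_on_cst.
have main sg b : 0 <= b -> `|w sg b| <= c * q + `|v|.
  move=> b0; apply: mx_norm_le => [|i j]; first by rewrite addr_ge0.
  rewrite (ord1 j) -(splitK i); case: (fintype.split i) => {}i /=.
    have E : `|usubmx (w sg b)| <= c * q.
      apply: (le_trans (hc _)); rewrite ler_wpM2l//.
      have := @skew_growth R _ osc_G osc_G_posdef (osc_A M) sg 0 b 0 (fun u => usubmx (w sg u))
        (fun u => sg *: (osc_A M *m usubmx (w sg u))) b0 (lexx 0) osc_A_skew.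
      rewrite mul0r addr0 w0; apply.
        move=> u l _; have := dw sg u b (lshift 1 l).
        rewrite osc_A1_mul col_mxEu => H.
        rewrite mxE (_ : (fun _ => _) = fun u => w sg u (lshift 1 l) 0)//.
        by apply/funext => u'; rewrite mxE.
      by move=> u _; rewrite subrr /quad mulmx0 mxE sqrtr0.
    have := ler_mx_norm_coord (usubmx (w sg b)) i 0; rewrite mxE => h.
    by apply: (le_trans h); apply: (le_trans E); rewrite lerDl.
  have := @MVT_on_le R 0 b 0 (fun u => w sg u (rshift (d + d) i) 0)
     (fun u => sg * (osc_A1 M *m w sg u) (rshift (d + d) i) 0) b0.
  rewrite mul0r normr_le0 subr_eq0 => H.
  have -> : w sg b (rshift (d + d) i) 0 = v (rshift (d + d) i) 0.
    rewrite -[in RHS](w0 sg); apply/eqP; apply: H => [u _|u _]; first exact: dw.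
    by rewrite osc_A1_mul col_mxEd mxE mulr0 normr0.
  apply: (le_trans (ler_mx_norm_coord _ _ _)); by rewrite lerDr.
have [t0|t0] := leP 0 t.
  by have := main 1 t t0; rewrite /w subr0 mul1r.
have := main (-1) (- t); rewrite /w subr0 mulN1r opprK; apply.
by rewrite oppr_ge0 ltW.
Qed.

End OscEnergy.

Section OscForce.
Context {R : realType} {d : nat} (g : 'cV[R]_d -> R -> 'cV[R]_d) (eps : R).
Local Notation N := (d + d + 1)%N.
Hypothesis eps0 : 0 < eps.

Definition y_index (i : 'I_d) : 'I_N := lshift 1 (lshift d i).
Definition p_index (i : 'I_d) : 'I_N := lshift 1 (rshift d i).

Lemma index_ind (P : 'I_N -> Prop) : (forall i, P (y_index i)) ->
  (forall i, P (p_index i)) -> P t_index -> forall r, P r.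
Proof.
move=> hy hp ht r; rewrite -(splitK r); case: (fintype.split r) => {}r /=.
  by rewrite -(splitK r); case: (fintype.split r) => {}r /=; [exact: hy|exact: hp].
by rewrite (ord1 r).
Qed.

Definition force (i : 'I_d) : 'cV[R]_N -> R := (fun z => joint g z i 0) \o yt_part.

Lemma forceE i z : force i z = g (ypart z) (tpart z) i 0.
Proof. by rewrite /force /= /joint usub_yt dsub_yt. Qed.

Lemma osc_f_y z i : osc_f g eps z (y_index i) 0 = 0.
Proof. by rewrite /osc_f /y_index !col_mxEu mxE. Qed.

Lemma osc_f_p z i : osc_f g eps z (p_index i) 0 = eps * force i z.
Proof. by rewrite forceE /osc_f /p_index col_mxEu col_mxEd mxE. Qed.

Lemma osc_f_t z : osc_f g eps z t_index 0 = 1.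
Proof. by rewrite /osc_f /t_index col_mxEd mxE eqxx. Qed.

Lemma fjet_y X i be : fjet (osc_f g eps) X (y_index i) be = 0.
Proof.
rewrite /fjet (_ : (fun _ => _) = fun=> 0) ?partial_cst ?mulr0//.
by apply/funext => z; rewrite osc_f_y.
Qed.

Lemma fjet_t X be : fjet (osc_f g eps) X t_index be = (be == [::])%:R.
Proof.
rewrite /fjet (_ : (fun _ => _) = fun=> 1) ?partial_cst ?mulr1//.
by apply/funext => z; rewrite osc_f_t.
Qed.

Lemma fjet_p X i be : fjet (osc_f g eps) X (p_index i) be = eps * jet (force i) [::] X be.
Proof.
rewrite /fjet (_ : (fun _ => _) = fun z => eps * force i z).
  by rewrite partialZ ?gt_eqF// /jet cats0.
by apply/funext => z; rewrite osc_f_p.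
Qed.

Lemma taylor_scale n m c (e : R) (v : 'cV[R]_n) :
  taylor m (fun b => e * c b) v = e * taylor m c v.
Proof.
rewrite /taylor mulr_sumr; apply: eq_bigr => j _; rewrite mulr_sumr.
by apply: eq_bigr => be _; ring.
Qed.

Lemma taylor_eq1 n m (v : 'cV[R]_n) : taylor m (fun be => (be == [::])%:R) v = 1.
Proof.
rewrite /taylor big_ord_recl [X in _ + X]big1 ?addr0 => [|j _]; last first.
  by rewrite big1// => be _; rewrite (tuple_eta be) /= mulr0 mul0r.
by have := @taylor0 R n (fun be => (be == [::])%:R) v; rewrite /taylor big_ord1 /=.
Qed.

Definition force_defect X z (j : nat) i : R :=
  force i z - taylor j (jet (force i) [::] X) (z - X).

Lemma osc_defect_y X z j i :
  osc_f g eps z (y_index i) 0 - taylor j (fjet (osc_f g eps) X (y_index i)) (z - X) = 0.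
Proof.
rewrite osc_f_y (_ : fjet _ _ _ = fun b => 0 * (fun=> 0) b).
  by rewrite taylor_scale mul0r subrr.
by apply/funext => b; rewrite fjet_y mul0r.
Qed.

Lemma osc_defect_t X z j :
  osc_f g eps z t_index 0 - taylor j (fjet (osc_f g eps) X t_index) (z - X) = 0.
Proof.
rewrite osc_f_t (_ : fjet _ _ _ = fun be => (be == [::])%:R) ?taylor_eq1 ?subrr//.
by apply/funext => be; rewrite fjet_t.
Qed.

(** The momentum components are the only ones with a nonzero defect; the factor [eps] here is the
    source of the one in the first error bound. *)
Lemma osc_defect_p X z j i :
  osc_f g eps z (p_index i) 0 - taylor j (fjet (osc_f g eps) X (p_index i)) (z - X) =
  eps * force_defect X z j i.
Proof.
rewrite osc_f_p (_ : fjet _ _ _ = fun b => eps * jet (force i) [::] X b).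
  by rewrite taylor_scale mulrBr.
by apply/funext => b; rewrite fjet_p.
Qed.

End OscForce.

(** * Energy estimate with integration by parts *)

Section FilteredGrowth.
Context {R : realType} {n : nat} (G A : 'M[R]_n).
Hypothesis hG : sym_posdef G.
Local Notation nrm v := (Num.sqrt (quad G v)).

Lemma posdef_norm_triangle (u v : 'cV[R]_n) : nrm (u + v) <= nrm u + nrm v.
Proof.
have s0 : 0 <= nrm u + nrm v by rewrite addr_ge0// sqrtr_ge0.
rewrite -[leRHS]ger0_norm// -sqrtr_sqr ler_wsqrtr//.
have := quadD hG u v 1; rewrite scale1r => ->.
rewrite sqrrD !sqr_sqrtr ?(quad_ge0 hG)// expr1n mul1r mulr1 lerD2r lerD2l.
rewrite -[leRHS]mulr_natl ler_wpM2l//; apply: (le_trans (ler_norm _)); exact: bil_CS.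
Qed.

Lemma posdef_normN (u : 'cV[R]_n) : nrm (- u) = nrm u.
Proof. by rewrite /quad mulmxN [(- u)^T]raddfN !mulNmx opprK. Qed.

Hypothesis skew : forall v, bil G v (A *m v) = 0.
Hypothesis Au : A \in unitmx.

(* The second estimate is an integration by parts: [E + eps A^-1 F] satisfies an
   equation whose forcing no longer contains [F], only [eps A^-1 F']. *)
Lemma filtered_growth : exists2 C, 0 <= C &
  forall (a b eps qb fb dfb : R) (E Q F dF : R -> 'cV[R]_n), a <= b -> 0 < eps ->
    (forall t i, a <= t <= b -> is_derive_on `[a, b] (fun s => E s i 0) t
       ((eps^-1 *: (A *m E t) + Q t + F t) i 0)) ->
    (forall t, a <= t <= b -> `|Q t| <= qb) ->
    (forall t, a <= t <= b -> `|F t| <= fb) ->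
    nrm (E b) <= nrm (E a) + C * (b - a) * (qb + fb) /\
    ((forall t i, a <= t <= b -> is_derive_on `[a, b] (fun s => F s i 0) t (dF t i 0)) ->
     (forall t, a <= t <= b -> `|dF t| <= dfb) ->
     nrm (E b) <= nrm (E a) + C * eps * fb + C * (b - a) * (qb + eps * dfb)).
Proof.
have [c c0 hc] := sqrt_quad_bound G.
pose m := n%:R * `|invmx A|; have m0 : 0 <= m by rewrite mulr_ge0.
(* [c] pays for the direct forcing, [2 c m] for the correction [eps A^-1 F] at the two ends, and
   [c m] for its derivative. *)
exists (c + 2 * c * m + c * m); first by rewrite !addr_ge0// !mulr_ge0.
move=> a b eps qb fb dfb E Q F dF ab e0 dE hQ hF.
have aab : a <= a <= b by rewrite lexx.
have bab : a <= b <= b by rewrite lexx ab.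
have qb0 : 0 <= qb by apply: le_trans (hQ a aab).
have fb0 : 0 <= fb by apply: le_trans (hF a aab).
have ba0 : 0 <= b - a by rewrite subr_ge0.
split.
  have r0 : 0 <= c * (qb + fb) by rewrite mulr_ge0// addr_ge0.
  apply: (le_trans (@skew_growth R n G hG A eps^-1 a b _ E _ ab r0 skew dE _)).
    move=> t tab; have -> : eps^-1 *: (A *m E t) + Q t + F t - eps^-1 *: (A *m E t) = Q t + F t.
      by rewrite -[X in X - _]addrA [LHS]addrC addKr.
    apply: (le_trans (hc _)); rewrite ler_wpM2l//.
    by rewrite (le_trans (ler_normD _ _))// lerD ?hQ ?hF.
  rewrite lerD2l.
  have -> : (c + 2 * c * m + c * m) * (b - a) * (qb + fb) =
    c * (qb + fb) * (b - a) + (2 * c * m + c * m) * (b - a) * (qb + fb) by ring.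
  by rewrite lerDl !mulr_ge0// ?addr_ge0// !mulr_ge0.
move=> ddF hdF.
have dfb0 : 0 <= dfb by apply: le_trans (hdF a aab).
pose J t := eps *: (invmx A *m F t).
have hJ t : a <= t <= b -> nrm (J t) <= c * (eps * (m * fb)).
  move=> tab; apply: (le_trans (hc _)); rewrite ler_wpM2l// normrZ gtr0_norm//.
  rewrite ler_wpM2l ?(ltW e0)// (le_trans (mulmx_norm _ _))// mulrA ler_wpM2l//.
  exact: hF.
pose w t := E t + J t.
have dw t i : a <= t <= b -> is_derive_on `[a, b] (fun s => w s i 0) t
    ((eps^-1 *: (A *m E t) + Q t + F t + eps *: (invmx A *m dF t)) i 0).
  move=> tab.
  rewrite (_ : (fun _ => _) = fun s => E s i 0 + eps * \sum_j invmx A i j * F s j 0).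
    rewrite mxE [X in _ + X]mxE [in X in _ + _ * X]mxE.
    apply: is_derive_onD; first exact: dE.
    apply: is_derive_onZ; apply: is_derive_on_sum => j _; apply: is_derive_onZ.
    exact: ddF.
  by apply/funext => s; rewrite !mxE.
have r0 : 0 <= c * (qb + eps * (m * dfb)).
  by rewrite mulr_ge0// addr_ge0// !mulr_ge0// ltW.
have H := @skew_growth R n G hG A eps^-1 a b _ w _ ab r0 skew dw.
have {}H : nrm (w b) <= nrm (w a) + c * (qb + eps * (m * dfb)) * (b - a).
  apply: H => t tab.
  have -> : eps^-1 *: (A *m E t) + Q t + F t + eps *: (invmx A *m dF t) -
      eps^-1 *: (A *m w t) = Q t + eps *: (invmx A *m dF t).
    rewrite /w mulmxDr scalerDr /J -scalemxAr mulKVmx// scalerA mulVf ?gt_eqF// scale1r.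
    have aux (p q r z : 'cV[R]_n) : p + q + r + z - (p + r) = q + z.
      by apply/colP => l; rewrite !mxE; ring.
    exact: aux.
  apply: (le_trans (hc _)); rewrite ler_wpM2l// (le_trans (ler_normD _ _))//.
  apply: lerD; first exact: hQ.
  rewrite normrZ gtr0_norm// ler_wpM2l ?(ltW e0)// (le_trans (mulmx_norm _ _))// mulrA.
  by rewrite ler_wpM2l// hdF.
have Eb : nrm (E b) <= nrm (w b) + nrm (J b).
  have -> : E b = w b + - J b by rewrite /w addrK.
  by apply: (le_trans (posdef_norm_triangle _ _)); rewrite posdef_normN.
have wa : nrm (w a) <= nrm (E a) + nrm (J a) by exact: posdef_norm_triangle.
have Ja := hJ a aab; have Jb := hJ b bab.
have P1 : 0 <= c * m * eps * fb by rewrite !mulr_ge0// ltW.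
have P2 : 0 <= c * eps * fb by rewrite !mulr_ge0// ltW.
have P3 : 0 <= c * (b - a) * qb by rewrite !mulr_ge0.
have P4 : 0 <= c * m * (b - a) * qb by rewrite !mulr_ge0.
have P5 : 0 <= c * m * (b - a) * (eps * dfb) by rewrite !mulr_ge0// ltW.
have P6 : 0 <= c * (b - a) * (eps * dfb) by rewrite !mulr_ge0// ltW.
have -> : (c + 2 * c * m + c * m) * eps * fb = c * eps * fb + 3 * (c * m * eps * fb) by ring.
have -> : (c + 2 * c * m + c * m) * (b - a) * (qb + eps * dfb) = c * (b - a) * qb +
  c * (b - a) * (eps * dfb) + 3 * (c * m * (b - a) * qb) + 3 * (c * m * (b - a) * (eps * dfb)) by ring.
have E1 : c * (qb + eps * (m * dfb)) * (b - a) = c * (b - a) * qb + c * m * (b - a) * (eps * dfb) by ring.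
have E2 : c * (eps * (m * fb)) = c * m * eps * fb by ring.
rewrite E1 in H; rewrite E2 in Ja Jb; lra.
Qed.

End FilteredGrowth.

(** * The exact solution as a trajectory in phase space *)

Section ExactSolution.
Context {R : realType} {d : nat} (M : 'M[R]_d) (g : 'cV[R]_d -> R -> 'cV[R]_d).
Variables (eps T : R) (y0 dy0 : 'cV[R]_d) (y dy : R -> 'cV[R]_d).
Hypothesis eps0 : 0 < eps.
Hypothesis sol : is_solution M g eps T y0 dy0 y dy.

Definition exact_sol (t : R) : 'cV[R]_(d + d + 1) :=
  col_mx (col_mx (y t) (eps *: dy t)) t%:M.

Lemma exact_sol_ode t r : 0 <= t <= T -> is_derive_on `[0, T] (fun u => exact_sol u r 0) t
  ((eps^-1 *: (osc_A1 M *m exact_sol t) + osc_f g eps (exact_sol t)) r 0).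
Proof.
have [_ _ hs] := sol => tT; have [hy [ddy hdy ddyE]] := hs t tT.
have E : eps^-1 *: (osc_A1 M *m exact_sol t) + osc_f g eps (exact_sol t) =
   col_mx (col_mx (dy t) (eps *: ddy)) 1%:M.
  rewrite osc_A1_mul osc_A_mul /exact_sol !col_mxKu !col_mxKd /osc_f /ypart /tpart.
  rewrite !col_mxKu !col_mxKd !scale_col_mx !add_col_mx scaler0 add0r addr0.
  rewrite scalerA mulVf ?gt_eqF// scale1r mxE eqxx mulr1n -ddyE scalerDr.
  congr (col_mx (col_mx _ _) _).
  move: (M *m y t) => z; apply/colP => i; rewrite !mxE.
  by field; rewrite gt_eqF.
rewrite E; move: r; apply: index_ind => [i|i|].
- rewrite /y_index !col_mxEu (_ : (fun _ => _) = fun u => y u i 0).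
    exact: is_derive_on_coord.
  by apply/funext => u; rewrite !col_mxEu.
- rewrite /p_index col_mxEu col_mxEd mxE (_ : (fun _ => _) = fun u => eps * dy u i 0).
    exact/is_derive_onZ/is_derive_on_coord.
  by apply/funext => u; rewrite col_mxEu col_mxEd mxE.
- rewrite /t_index col_mxEd mxE (_ : (fun _ => _) = id); first exact: is_derive_on_id.
  by apply/funext => u; rewrite col_mxEd mxE.
Qed.

Lemma exact_sol_t t : exact_sol t t_index 0 = t.
Proof. by rewrite /exact_sol /t_index col_mxEd mxE. Qed.

Hypothesis hM : sym_posdef M.
Hypothesis eps1 : eps <= 1.
Variable C0 : R.
Hypothesis energy : forall t, 0 <= t <= T ->
  2^-1 * enorm (dy t) ^+ 2 + (2 * eps ^+ 2)^-1 * quad M (y t) <= C0.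

(** Multiplied by [2 eps^2], the energy condition is a bound on [quad (osc_G M)] at (y, eps y');
    coercivity turns it into smallness of order [eps]. *)
Lemma exact_sol_bound c : 0 <= c -> (forall v, `|v| <= c * Num.sqrt (quad (osc_G M) v)) ->
  forall t, 0 <= t <= T -> `|usubmx (exact_sol t)| <= c * Num.sqrt (2 * C0) * eps.
Proof.
move=> c0 hc t tT; apply: (le_trans (hc _)); rewrite -mulrA ler_wpM2l//.
have e2 : 0 < 2 * eps ^+ 2 by rewrite mulr_gt0// exprn_gt0.
have en := energy tT.
have S0 : 0 <= \sum_i dy t i 0 ^+ 2 by apply: sumr_ge0 => i _; exact: sqr_ge0.
have q0 := quad_ge0 hM (y t).
rewrite /enorm sqr_sqrtr// in en.
have : quad (osc_G M) (usubmx (exact_sol t)) <= 2 * C0 * eps ^+ 2.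
  rewrite quad_osc_G /exact_sol !col_mxKu col_mxKd.
  have -> : \sum_i (eps *: dy t) i 0 ^+ 2 = eps ^+ 2 * \sum_i dy t i 0 ^+ 2.
    by rewrite mulr_sumr; apply: eq_bigr => i _; rewrite mxE exprMn.
  set S := \sum_i _ in en S0 *; set q := quad _ _ in en q0 *.
  have -> : q + eps ^+ 2 * S = 2 * (2^-1 * S + (2 * eps ^+ 2)^-1 * q) * eps ^+ 2.
    by field; rewrite gt_eqF.
  by rewrite ler_wpM2r ?exprn_ge0 ?(ltW eps0)// ler_pM2l.
move=> /(@ler_wsqrtr R); move/le_trans; apply.
have C00 : 0 <= 2 * C0.
  rewrite mulr_ge0//; apply: le_trans en; rewrite addr_ge0// mulr_ge0// invr_ge0 ?ltW//.
by rewrite sqrtrM// sqrtr_sqr gtr0_norm.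
Qed.

End ExactSolution.

(** * One step of the integrator *)

Section StepEstimate.
Context {R : realType} {d : nat} (k : nat) (s : seq (seq 'I_(d + d + 1))).
Hypothesis sP : multi_index_listing k s.
Hypothesis k0 : (0 < k)%N.
Variables (M : 'M[R]_d) (g : 'cV[R]_d -> R -> 'cV[R]_d) (T L gB c1 rho : R).
Hypothesis hM : sym_posdef M.
Hypothesis T0 : 0 < T.
Hypothesis L0 : 0 <= L.
Hypothesis gB0 : 0 <= gB.
Hypothesis c10 : 0 <= c1.
Hypothesis rho0 : 0 <= rho.
Hypothesis forceS : forall i, smooth_on t_index T k L (force g i).
Hypothesis forceB : forall i be, (size be <= k)%N -> `|partial be (force g i) 0| <= gB.

Local Notation N := (d + d + 1)%N.
Local Notation D := (size s).

(** Only a seminorm, as it ignores time; it controls the whole error because the time error is shown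
    to be zero. *)
Definition energy_norm (z : 'cV[R]_N) : R := Num.sqrt (quad (osc_G M) (usubmx z)).

(** A ball containing both the exact and the numerical values: [c1 + rho] for (y, p), using
    [eps <= 1], and [T] for time. *)
Definition radius : R := c1 + rho + T.
Definition force_bound : R := gB + L * radius.
Definition A_bound : R := (d + d)%:R * `|osc_A M|.
(** Bound on the derivative of the exact trajectory: the smallness [c1 * eps] of (y, p) cancels
    [eps^-1] in the stiff term, and 1 accounts for the time component. *)
Definition speed : R := A_bound * c1 + (1 + force_bound).

Lemma radius_ge0 : 0 <= radius.
Proof. by rewrite !addr_ge0// ltW. Qed.

Lemma force_bound_ge0 : 0 <= force_bound.
Proof. by rewrite addr_ge0// mulr_ge0// radius_ge0. Qed.

Lemma A_bound_ge0 : 0 <= A_bound.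
Proof. by rewrite mulr_ge0. Qed.

Lemma speed_ge0 : 0 <= speed.
Proof.
apply: addr_ge0; first by apply: mulr_ge0 => //; exact: A_bound_ge0.
by apply: addr_ge0 => //; exact: force_bound_ge0.
Qed.

Lemma norm_le_usub (z : 'cV[R]_N) al be : `|usubmx z| <= al -> `|z t_index 0| <= be ->
  `|z| <= al + be.
Proof.
move=> za zb; have al0 : 0 <= al by apply: le_trans za.
have be0 : 0 <= be by apply: le_trans zb.
apply: mx_norm_le => [|i j]; first by rewrite addr_ge0.
rewrite (ord1 j) -(splitK i); case: (fintype.split i) => {}i /=.
  have := ler_mx_norm_coord (usubmx z) i 0; rewrite mxE => h.
  by apply: (le_trans h); apply: (le_trans za); rewrite lerDl.
by rewrite (ord1 i); apply: (le_trans zb); rewrite lerDr.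
Qed.

Lemma usub_norm_le (z : 'cV[R]_N) : `|usubmx z| <= `|z|.
Proof. by apply: mx_norm_le => // i j; rewrite mxE; exact: ler_mx_norm_coord. Qed.

Lemma osc_A1_norm (z : 'cV[R]_N) al : `|usubmx z| <= al -> `|osc_A1 M *m z| <= A_bound * al.
Proof.
move=> za; have al0 : 0 <= al by apply: le_trans za.
have b0 := A_bound_ge0.
have H : `|osc_A M *m usubmx z| <= A_bound * al.
  by apply: (le_trans (mulmx_norm _ _)); rewrite mulrA ler_wpM2l.
rewrite osc_A1_mul; apply: mx_norm_le => [|i j]; first by rewrite mulr_ge0.
rewrite -(splitK i); case: (fintype.split i) => {}i /=.
  by rewrite col_mxEu; apply: le_trans H; exact: ler_mx_norm_coord.
by rewrite col_mxEd mxE normr0 mulr_ge0.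
Qed.

Lemma force_partial_le i be (z : 'cV[R]_N) : (size be <= k)%N -> slab t_index T z ->
  `|z| <= radius -> `|partial be (force g i) z| <= force_bound.
Proof.
move=> bk zS zr; have [_ lF] := forceS i.
have S0 : slab t_index T (0 : 'cV[R]_N) by rewrite /slab /= mxE lexx ltW.
have := lF be z 0 bk zS S0; rewrite subr0 => h.
have := forceB i bk => h0.
have -> : partial be (force g i) z =
  partial be (force g i) 0 + (partial be (force g i) z - partial be (force g i) 0) by rewrite addrC subrK.
apply: (le_trans (ler_normD _ _)); apply: lerD => //.
by apply: (le_trans h); apply: ler_wpM2l.
Qed.

Section OneStep.
Variables (eps a b : R) (X : 'cV[R]_N) (x : R -> 'cV[R]_N).
Hypothesis eps0 : 0 < eps.
Hypothesis eps1 : eps <= 1.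
Hypothesis a0 : 0 <= a.
Hypothesis ab : a <= b.
Hypothesis bT : b <= T.
Local Notation f := (osc_f g eps).
Local Notation A1 := (osc_A1 M).
Hypothesis dxP : forall t i, a <= t <= b -> is_derive_on `[a, b] (fun s => x s i 0) t
  ((eps^-1 *: (A1 *m x t) + f (x t)) i 0).
Hypothesis xt : forall t, a <= t <= b -> x t t_index 0 = t.
Hypothesis xb : forall t, a <= t <= b -> `|usubmx (x t)| <= c1 * eps.
Hypothesis Xt : X t_index 0 = a.
Let nu := `|x a - X|.
Hypothesis nub : nu <= rho * eps.

Let aab : a <= a <= b. Proof. by rewrite lexx. Qed.

Lemma step_xS t : a <= t <= b -> slab t_index T (x t).
Proof.
move=> tab; rewrite /slab /= xt//; case/andP: tab => at_ tb.
by rewrite (le_trans a0 at_) (le_trans tb bT).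
Qed.

Lemma step_XS : slab t_index T X.
Proof. by rewrite /slab /= Xt a0 (le_trans ab bT). Qed.

Lemma step_x_radius t : a <= t <= b -> `|x t| <= radius.
Proof.
move=> tab; have := step_xS tab; rewrite /slab /= => /andP[t0 tT].
have -> : radius = (c1 + rho) + T by [].
apply: norm_le_usub; last by rewrite ger0_norm.
apply: (le_trans (xb tab)); rewrite (@le_trans _ _ c1)// ?lerDl//.
by rewrite ler_piMr.
Qed.

Lemma step_usubX : `|usubmx X| <= (c1 + rho) * eps.
Proof.
have -> : usubmx X = usubmx (x a) - usubmx (x a - X).
  by apply/colP => i; rewrite !mxE; ring.
apply: (le_trans (ler_normB _ _)); rewrite mulrDl; apply: lerD; first exact: xb.
by apply: (le_trans (usub_norm_le _)).
Qed.

Lemma step_X_radius : `|X| <= radius.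
Proof.
have := step_XS; rewrite /slab /= => /andP[t0 tT].
have -> : radius = (c1 + rho) + T by [].
apply: norm_le_usub; last by rewrite ger0_norm.
by apply: (le_trans step_usubX); rewrite ler_piMr// addr_ge0.
Qed.

Lemma step_f_le z : slab t_index T z -> `|z| <= radius -> `|f z| <= 1 + force_bound.
Proof.
move=> zS zr; have fb0 := force_bound_ge0.
apply: mx_norm_le => [|i j]; first by rewrite addr_ge0.
rewrite (ord1 j); move: i; apply: index_ind => [i|i|].
- by rewrite osc_f_y normr0 addr_ge0.
- rewrite osc_f_p normrM (gtr0_norm eps0).
  have := @force_partial_le i [::] z isT zS zr => h.
  apply: (@le_trans _ _ (1 * force_bound)); first by apply: ler_pM => //; exact: ltW.
  by rewrite mul1r lerDr.
- by rewrite osc_f_t normr1 lerDl.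
Qed.

Lemma step_dx_le t : a <= t <= b -> `|eps^-1 *: (A1 *m x t) + f (x t)| <= speed.
Proof.
move=> tab; apply: (le_trans (ler_normD _ _)); apply: lerD; last first.
  by apply: step_f_le; [exact: step_xS|exact: step_x_radius].
rewrite normrZ normfV (gtr0_norm eps0) mulrC ler_pdivrMr// -mulrA.
exact/osc_A1_norm/xb.
Qed.

Lemma step_dist t : a <= t <= b -> `|x t - X| <= speed * (b - a) + nu.
Proof.
move=> /andP[at_ tb]; have s0 := speed_ge0.
have -> : x t - X = (x t - x a) + (x a - X) by rewrite addrA subrK.
apply: (le_trans (ler_normD _ _)); rewrite lerD2r.
apply: mx_norm_le => [|i j]; first by rewrite mulr_ge0// subr_ge0.
rewrite (ord1 j) !mxE.
apply: (@le_trans _ _ (speed * (t - a))); last by rewrite ler_wpM2l// lerD2r.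
apply: (@MVT_on_le R a t speed (fun u => x u i 0) (fun u => (eps^-1 *: (A1 *m x u) + f (x u)) i 0)) => //.
  move=> u /andP[au ut]; apply: (@is_derive_on_subset _ `[a, b]).
    by apply: subset_itvl; rewrite bnd_simp.
  by apply: dxP; rewrite au (le_trans ut).
move=> u /andP[au ut]; apply: (le_trans (ler_mx_norm_coord _ _ _)).
by apply: step_dx_le; rewrite au (le_trans ut).
Qed.

Variable v : R.
Hypothesis xv : forall t, a <= t <= b -> `|x t - X| <= v.

Let v0 : 0 <= v. Proof. by apply: le_trans (xv aab). Qed.

Definition rem_const : R := N%:R ^+ k * L.

Lemma rem_const_ge0 : 0 <= rem_const.
Proof. by rewrite mulr_ge0// exprn_ge0. Qed.

Lemma rem_const_le j : (j <= k)%N -> N%:R ^+ j * L <= rem_const.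
Proof.
by move=> jk; rewrite ler_wpM2r// ler_weXn2l// ler1n addn1.
Qed.

Lemma force_defect_le t i j : (j <= k)%N -> a <= t <= b ->
  `|force_defect g X (x t) j i| <= rem_const * v ^+ j.+1.
Proof.
move=> jk tab.
have := @taylor_remainder R N t_index T T0 k L (force g i) L0 (forceS i) j [::] (x t) X jk
  (step_xS tab) step_XS.
move=> /le_trans; apply.
apply: ler_pM => //; last by rewrite lerXn2r ?nnegrE// xv.
- by rewrite mulr_ge0// exprn_ge0.
- exact: rem_const_le.
Qed.

Lemma osc_defect_le t r j : (j <= k)%N -> a <= t <= b ->
  `|f (x t) r 0 - taylor j (fjet f X r) (x t - X)| <= eps * rem_const * v ^+ j.+1.
Proof.
move=> jk tab; have h0 : 0 <= eps * rem_const * v ^+ j.+1.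
  by rewrite mulr_ge0// ?exprn_ge0// mulr_ge0 ?rem_const_ge0// ltW.
move: r; apply: index_ind => [i|i|].
- by rewrite osc_defect_y normr0.
- rewrite osc_defect_p// normrM (gtr0_norm eps0) -mulrA ler_wpM2l ?(ltW eps0)//.
  exact: force_defect_le.
- by rewrite osc_defect_t normr0.
Qed.

Lemma step_defect_le t : a <= t <= b ->
  `|defect k s f X x t| <= k%:R * (eps * rem_const * v ^+ k.+1).
Proof.
move=> tab; apply: (defect_le sP); first by rewrite mulr_ge0 ?rem_const_ge0// ltW.
  exact: xv.
by move=> r j jk; exact: osc_defect_le.
Qed.

Lemma fjet_le r be : (size be <= k)%N -> `|fjet f X r be| <= 1 + force_bound.
Proof.
move=> bk; have fb0 := force_bound_ge0.
move: r; apply: index_ind => [i|i|].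
- by rewrite fjet_y normr0 addr_ge0.
- rewrite fjet_p// /jet cats0 normrM (gtr0_norm eps0).
  apply: (@le_trans _ _ (1 * force_bound)).
    apply: ler_pM => //; first exact: ltW.
    by apply: force_partial_le => //; [exact: step_XS|exact: step_X_radius].
  by rewrite mul1r lerDr.
- rewrite fjet_t; apply: (@le_trans _ _ 1); last by rewrite lerDl.
  by case: eqP => _; rewrite ?normr1 ?normr0.
Qed.

Definition dforce_defect t i : R := \sum_r (eps^-1 *: (A1 *m x t) + f (x t)) r 0 *
  ('D_(delta_mx r 0) (force g i) (x t) -
   taylor k.-1 (fun be => jet (force g i) [::] X (r :: be)) (x t - X)).

Lemma is_derive_on_force_defect t i : a <= t <= b ->
  is_derive_on `[a, b] (fun u => force_defect g X (x u) k i) t (dforce_defect t i).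
Proof.
move=> tab.
have tin : `[a, b]%classic t by rewrite /= in_itv.
have h1 := @is_derive_on_smooth R N t_index T T0 k L (force g i) L0 (forceS i)
  `[a, b] x (fun t => eps^-1 *: (A1 *m x t) + f (x t)) t k0 tin.
have h2 := @is_derive_on_taylor R N `[a, b] k.-1 (jet (force g i) [::] X)
  (fun u => x u - X) (fun t => eps^-1 *: (A1 *m x t) + f (x t)) t.
have h1' := h1 _ (fun j => @dxP t j tab).
have h2' := h2 _ _.
have {h1 h2}H := is_derive_onB (h1' _) (h2' _ _).
rewrite prednK// in H.
have -> : dforce_defect t i = \sum_r (eps^-1 *: (A1 *m x t) + f (x t)) r 0 *
     'D_(delta_mx r 0) (force g i) (x t) -
   \sum_r (eps^-1 *: (A1 *m x t) + f (x t)) r 0 *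
     taylor k.-1 (fun be => jet (force g i) [::] X (r :: be)) (x t - X).
  by rewrite -sumrB; apply: eq_bigr => r _; rewrite mulrBr.
apply: H.
- by move=> u; rewrite /= in_itv /= => uab; exact: step_xS.
- move=> be bk; apply: (@jet_sort R N t_index T T0 k L (force g i) (forceS i)) => //.
    exact: step_XS.
  by rewrite addn0.
- move=> j; rewrite (_ : (fun _ => _) = fun u => x u j 0 - X j 0).
    rewrite -[X in is_derive_on _ _ _ X]subr0; apply: is_derive_onB; first exact: dxP.
    exact: is_derive_on_cst.
  by apply/funext => u; rewrite !mxE.
Qed.

(** The derivative is a combination of degree [k - 1] remainders of first partial derivatives,
    weighted by the velocity. The velocity is bounded despite its [eps^-1], so only one power of [v]
    is lost. *)
Lemma dforce_defect_le t i : a <= t <= b ->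
  `|dforce_defect t i| <= N%:R * (speed * (rem_const * v ^+ k)).
Proof.
move=> tab; apply: (le_trans (ler_norm_sum _ _ _)).
apply: (@le_trans _ _ (\sum_(r < N) speed * (rem_const * v ^+ k))); last first.
  by rewrite sumr_const card_ord mulr_natl.
apply: ler_sum => r _; rewrite normrM; apply: ler_pM => //.
  by apply: (le_trans (ler_mx_norm_coord _ _ _)); exact: step_dx_le.
rewrite (@taylor_ext _ _ _ _ (jet (force g i) [:: r] X)) => [|be bk]; last first.
  have H := @partial_move R N t_index T T0 k L (force g i) (forceS i) r be [::] X.
  rewrite cats0 in H; rewrite /jet cats0; apply: H; last exact: step_XS.
  by rewrite -(prednK k0) ltnS.
have := @taylor_remainder R N t_index T T0 k L (force g i) L0 (forceS i) k.-1 [:: r] (x t) X _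
  (step_xS tab) step_XS.
rewrite prednK//; move=> /(_ _)/le_trans; apply; first by rewrite /= add1n prednK.
apply: ler_pM => //; last by rewrite lerXn2r ?nnegrE// xv.
- by rewrite mulr_ge0// exprn_ge0.
- by apply: rem_const_le; exact: leq_pred.
Qed.

End OneStep.

Definition step_data (eps a b : R) (X : 'cV[R]_N) (x : R -> 'cV[R]_N) : Prop :=
  [/\ 0 < eps, eps <= 1, 0 <= a, a <= b & b <= T] /\
  [/\ forall t i, a <= t <= b -> is_derive_on `[a, b] (fun s => x s i 0) t
        ((eps^-1 *: (osc_A1 M *m x t) + osc_f g eps (x t)) i 0),
      forall t, a <= t <= b -> x t t_index 0 = t,
      forall t, a <= t <= b -> `|usubmx (x t)| <= c1 * eps,
      X t_index 0 = a &
      `|x a - X| <= rho * eps].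

Lemma step_speed eps a b X x : step_data eps a b X x ->
  forall t, a <= t <= b -> `|x t - X| <= speed * (b - a) + `|x a - X|.
Proof.
move=> [[e0 e1 a0 ab bT] [dxP xt xb Xt nub]] t tab.
exact: (@step_dist eps a b X x e0 e1 a0 ab bT dxP xt xb _ tab).
Qed.

(** In the time row the stiff part and the defect vanish, and the only nonzero jet multiplies the
    constant entry, which is 0; the time error is therefore constant, and it starts at 0. *)
Lemma step_time eps a b X x : step_data eps a b X x ->
  LLE_step k s (osc_A1 M) (osc_f g eps) eps (b - a) X t_index 0 = b.
Proof.
move=> [[e0 e1 a0 ab bT] [dxP xt xb Xt nub]].
have aab : a <= a <= b by rewrite lexx.
have bab : a <= b <= b by rewrite lexx ab.
pose e := mon_error k s (osc_A1 M) (osc_f g eps) eps a X x.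
have dE t (tab : a <= t <= b) := @is_derive_on_point_error R _ k s sP _ _ _ _ _ X _ dxP k0 t_index t tab.
have d0 t : a <= t <= b -> eps^-1 * (osc_A1 M *m (Pi2 s *m e t)) t_index 0 +
    lin_rest k s (osc_A1 M) (osc_f g eps) eps a X x t_index t +
    point_defect k (osc_f g eps) X x t_index t = 0.
  move=> tab; rewrite /point_defect osc_defect_t addr0 osc_A1_mul /t_index col_mxEd mxE.
  rewrite mulr0 add0r /lin_rest big1// => m _; rewrite big1// => be _.
  rewrite -/t_index fjet_t; case: eqP => [be0|_]; last by rewrite mulr0 mul0r.
  by rewrite be0 (mon_error_nil sP X dxP tab) mulr0.
have := @MVT_on_le R a b 0 (fun u => (Pi2 s *m e u) t_index 0) _ ab dE.
rewrite mul0r normr_le0 subr_eq0 => H.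
have Eb : (Pi2 s *m e b) t_index 0 = (Pi2 s *m e a) t_index 0.
  by apply/eqP; apply: H => t tab; rewrite d0// normr0.
have Ea : Pi2 s *m e a = x a - X.
  by rewrite /e mon_error_init mulmxBr Pi2_e1 subr0 (Pi2_monvec sP).
have hb : x b - LLE_step k s (osc_A1 M) (osc_f g eps) eps (b - a) X = Pi2 s *m e b.
  exact: LLE_step_error.
have {}Eb : (x b - LLE_step k s (osc_A1 M) (osc_f g eps) eps (b - a) X) t_index 0 =
    (x a - X) t_index 0 by rewrite hb Eb Ea.
move: Eb; rewrite !mxE xt// xt// Xt subrr => /eqP; rewrite subr_eq0 => /eqP <-.
by [].
Qed.

(** [mon_error_growth] bounds the whole error vector, which then acts as a forcing on the degree-one
    components; the two conclusions of [filtered_growth] yield the two estimates. The distance bound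
    [v] stays free because the two error bounds choose it differently. *)
Lemma step_estimate : exists2 C, 0 <= C & forall eps a b v X x,
  step_data eps a b X x -> (forall t, a <= t <= b -> `|x t - X| <= v) ->
  let Y := LLE_step k s (osc_A1 M) (osc_f g eps) eps (b - a) X in
  let nu := `|x a - X| in
  energy_norm (x b - Y) <= energy_norm (x a - X) + C * (b - a) * (eps * nu + eps * v ^+ k.+1) /\
  energy_norm (x b - Y) <= energy_norm (x a - X) +
    C * (eps ^+ 2 * v ^+ k.+1 + (b - a) * (eps * nu + eps ^+ 2 * v ^+ k)).
Proof.
have [kap hkap] := bounded_expm_ext1 sP (osc_A1_flow_bound hM).
have [Cg Cg0 hg] := mon_error_growth sP hkap.
have [Cf Cf0 hf] := filtered_growth (osc_G_posdef hM) (osc_A_skew hM) (osc_A_unit hM).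
pose cX := A_bound * (c1 + rho); pose F := 1 + force_bound.
pose Ce := Cg * expR (Cg * (cX + F) * T).
pose rk := (1 + rho) ^+ k; pose rc := rem_const; pose kr := k%:R * rc.
pose q1 := tuple_count (R := R) (n := N) k * (force_bound * (D%:R * Ce)).
have fb0 := force_bound_ge0; have tc0 := @tuple_count_ge0 R N k.
have rc0 : 0 <= rc by exact: rem_const_ge0.
have kr0 : 0 <= kr by rewrite mulr_ge0.
have sp0 := speed_ge0.
have cX0 : 0 <= cX by rewrite mulr_ge0// ?A_bound_ge0// addr_ge0.
have F0 : 0 <= F by rewrite addr_ge0.
have Ce0 : 0 <= Ce by rewrite mulr_ge0// expR_ge0.
have rk0 : 0 <= rk by rewrite exprn_ge0// addr_ge0.
have q10 : 0 <= q1 by rewrite !mulr_ge0.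
have T0' := ltW T0.
(* [q1 * rk] carries the initial error, the terms with [q1 * kr] the defect fed back through the
   monomials (with [T] in the first estimate and [T ^+ 2] in the second), [rc] the direct defect,
   and the last term its time derivative. *)
exists (Cf * (q1 * (rk + kr * T) + rc + q1 * kr * T ^+ 2 + N%:R * (speed * rc))).
  by rewrite mulr_ge0// !addr_ge0// !mulr_ge0// ?addr_ge0// ?mulr_ge0// ?exprn_ge0.
move=> eps a b v X x sd xv Y nu.
have [[e0 e1 a0 ab bT] [dxP xt xb Xt nub]] := sd.
have aab : a <= a <= b by rewrite lexx.
have bab : a <= b <= b by rewrite lexx ab.
have v0 : 0 <= v by apply: le_trans (xv a aab).
have h0 : 0 <= b - a by rewrite subr_ge0.
have hT : b - a <= T by rewrite lerBlDr (le_trans bT)// lerDl.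
have nu0 : 0 <= nu by exact: normr_ge0.
pose e := mon_error k s (osc_A1 M) (osc_f g eps) eps a X x.
pose V := v ^+ k.+1; have V0 : 0 <= V by exact: exprn_ge0.
pose W := Ce * (rk * nu + k%:R * (eps * rc * V) * (b - a)).
have nu_rho : `|x a - X| <= rho by apply: (le_trans nub); rewrite ler_piMr.
have ea : `|e a| <= rk * nu by rewrite /e mon_error_init; exact: (monvec_e1 sP).
have del0 : 0 <= k%:R * (eps * rc * V) by rewrite !mulr_ge0// ltW.
have eW t : a <= t <= b -> `|e t| <= W.
  move=> tab.
  have hX : `|osc_A1 M *m X| <= eps * cX.
    rewrite mulrC /cX -mulrA; apply: osc_A1_norm.
    exact: (@step_usubX eps a b X x ab xb nub).
  have := hg (osc_f g eps) eps a b X x cX F (k%:R * (eps * rc * V)) dxP e0 cX0 F0 del0 hX.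
  move=> /(_ _ _ t tab)/le_trans; apply.
  - move=> r be bk; exact: (@fjet_le eps a b X x e0 e1 a0 ab bT xb Xt nub r be bk).
  - move=> u uab; exact: (@step_defect_le eps a b X x e0 a0 ab bT xt Xt v xv u uab).
  apply: ler_pM.
  + by rewrite mulr_ge0// expR_ge0.
  + by rewrite addr_ge0// mulr_ge0.
  + rewrite ler_wpM2l// ler_expR ler_wpM2l//.
    by rewrite mulr_ge0// addr_ge0.
  + by rewrite lerD2r.
pose E t := usubmx (Pi2 s *m e t).
pose Q t : 'cV[R]_(d + d) := \col_l lin_rest k s (osc_A1 M) (osc_f g eps) eps a X x (lshift 1 l) t.
pose Fd t : 'cV[R]_(d + d) := \col_l point_defect k (osc_f g eps) X x (lshift 1 l) t.
pose dF t : 'cV[R]_(d + d) := col_mx 0 (\col_i (eps * dforce_defect eps X x t i)).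
have dE t i : a <= t <= b -> is_derive_on `[a, b] (fun u => E u i 0) t
    ((eps^-1 *: (osc_A M *m E t) + Q t + Fd t) i 0).
  move=> tab; have := @is_derive_on_point_error R _ k s sP _ _ _ _ _ X _ dxP k0 (lshift 1 i) t tab.
  rewrite osc_A1_mul col_mxEu => H.
  rewrite !mxE (_ : (fun _ => _) = fun u => (Pi2 s *m e u) (lshift 1 i) 0); last first.
    by apply/funext => u; rewrite mxE.
  by move: H; rewrite mxE.
(* The factor [eps] is available because [usubmx] drops the time row: in the other rows every jet
   vanishes or carries [eps]. *)
pose qb := tuple_count (R := R) (n := N) k * (eps * force_bound * (D%:R * W)).
have W0 : 0 <= W by apply: le_trans (eW a aab).
have ef0 : 0 <= eps * force_bound by rewrite mulr_ge0// ltW.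
have hQ t : a <= t <= b -> `|Q t| <= qb.
  move=> tab; apply: mx_norm_le => [|i j].
    by apply: mulr_ge0 => //; apply: mulr_ge0 => //; apply: mulr_ge0.
  rewrite mxE; apply: (@le_trans _ _ (tuple_count (R := R) (n := N) k *
      (eps * force_bound * (D%:R * `|e t|)))).
    apply: lin_rest_le => // be bk; rewrite -(splitK i); case: (fintype.split i) => {}i /=.
      by rewrite fjet_y normr0.
    rewrite fjet_p// normrM (gtr0_norm e0) ler_wpM2l ?(ltW e0)// /jet cats0.
    apply: force_partial_le => //; first exact: (@step_XS a b X a0 ab bT Xt).
    exact: (@step_X_radius eps a b X x e1 a0 ab bT xb Xt nub).
  by rewrite ler_wpM2l// ler_wpM2l// ler_wpM2l// eW.
have hF t : a <= t <= b -> `|Fd t| <= eps * rc * V.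
  move=> tab; apply: mx_norm_le => [|i j]; first by rewrite !mulr_ge0// ltW.
  rewrite mxE; exact: (@osc_defect_le eps a b X x e0 a0 ab bT xt Xt v xv t _ k (leqnn k) tab).
have dFd t i : a <= t <= b -> is_derive_on `[a, b] (fun u => Fd u i 0) t (dF t i 0).
  move=> tab; rewrite -(splitK i); case: (fintype.split i) => {}i /=.
    rewrite /dF col_mxEu mxE (_ : (fun _ => _) = fun=> 0); first exact: is_derive_on_cst.
    by apply/funext => u; rewrite mxE /point_defect osc_defect_y.
  rewrite /dF col_mxEd mxE (_ : (fun _ => _) = fun u => eps * force_defect g X (x u) k i).
    apply: is_derive_onZ.
    exact: (@is_derive_on_force_defect eps a b X x a0 ab bT dxP xt Xt t i tab).
  by apply/funext => u; rewrite mxE /point_defect osc_defect_p.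
pose v1 := N%:R * (speed * (rc * v ^+ k)).
have v10 : 0 <= v1 by rewrite !mulr_ge0// exprn_ge0.
have hdF t : a <= t <= b -> `|dF t| <= eps * v1.
  move=> tab; apply: mx_norm_le => [|i j]; first by rewrite mulr_ge0// ltW.
  rewrite (ord1 j) -(splitK i); case: (fintype.split i) => {}i /=.
    by rewrite /dF col_mxEu mxE normr0 mulr_ge0// ltW.
  rewrite /dF col_mxEd mxE normrM (gtr0_norm e0) ler_wpM2l ?(ltW e0)//.
  exact: (@dforce_defect_le eps a b X x e0 e1 a0 ab bT xt xb Xt v xv t i tab).
have Ea : E a = usubmx (x a - X).
  by rewrite /E /e mon_error_init mulmxBr Pi2_e1 subr0 (Pi2_monvec sP).
have Eb : E b = usubmx (x b - Y).
  have hb : x b - Y = Pi2 s *m e b by exact: LLE_step_error.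
  by rewrite hb.
have [I1 I2] := hf a b eps qb (eps * rc * V) (eps * v1) E Q Fd dF ab e0 dE hQ hF.
have {}I2 := I2 dFd hdF.
rewrite Eb Ea in I1 I2.
have eh : eps * (b - a) <= T.
  by rewrite -[T]mul1r ler_pM// ltW.
have qbE : qb = q1 * (rk * (eps * nu) + kr * V * (eps * (eps * (b - a)))).
  rewrite /qb /q1 /W /kr; ring.
have en0 : 0 <= eps * nu by rewrite mulr_ge0// ltW.
have eV0 : 0 <= eps * V by rewrite mulr_ge0// ltW.
have e2 : 0 <= eps ^+ 2 by rewrite exprn_ge0// ltW.
have vk0 : 0 <= v ^+ k by exact: exprn_ge0.
split.
- apply: (le_trans I1); rewrite lerD2l -/V qbE -/rc.
  have -> : Cf * (q1 * (rk + kr * T) + rc + q1 * kr * T ^+ 2 + N%:R * (speed * rc)) *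
      (b - a) * (eps * nu + eps * V) = Cf * (b - a) * ((q1 * (rk + kr * T) + rc +
      q1 * kr * T ^+ 2 + N%:R * (speed * rc)) * (eps * nu + eps * V)) by ring.
  apply: ler_wpM2l; first exact: mulr_ge0.
  have -> : q1 * (rk * (eps * nu) + kr * V * (eps * (eps * (b - a)))) + eps * rc * V =
     q1 * rk * (eps * nu) + q1 * kr * (eps * (b - a)) * (eps * V) + rc * (eps * V) by ring.
  have S0 : 0 <= eps * nu + eps * V by rewrite addr_ge0.
  have h1 : q1 * rk * (eps * nu) <= q1 * rk * (eps * nu + eps * V).
    by rewrite ler_wpM2l ?mulr_ge0// lerDl.
  have h2 : q1 * kr * (eps * (b - a)) * (eps * V) <= q1 * kr * T * (eps * nu + eps * V).
    by rewrite ler_pM ?mulr_ge0// ?(ltW e0)// ?ler_wpM2l ?mulr_ge0// lerDr.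
  have h3 : rc * (eps * V) <= rc * (eps * nu + eps * V) by rewrite ler_wpM2l// lerDr.
  have h4 : 0 <= (q1 * kr * T ^+ 2 + N%:R * (speed * rc)) * (eps * nu + eps * V).
    by rewrite mulr_ge0// addr_ge0// !mulr_ge0// exprn_ge0.
  lra.
- apply: (le_trans I2); rewrite -addrA lerD2l -/V qbE -/rc /v1.
  set m := N%:R * (speed * rc).
  have m0 : 0 <= m by rewrite !mulr_ge0.
  pose P := eps ^+ 2 * V; pose Qa := (b - a) * (eps * nu).
  pose Rk := (b - a) * (eps ^+ 2 * v ^+ k).
  have P0 : 0 <= P by exact: mulr_ge0.
  have Qa0 : 0 <= Qa by exact: mulr_ge0.
  have Rk0 : 0 <= Rk by apply: mulr_ge0 => //; exact: mulr_ge0.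
  have -> : Cf * eps * (eps * rc * V) + Cf * (b - a) * (q1 * (rk * (eps * nu) +
      kr * V * (eps * (eps * (b - a)))) + eps * (eps * (N%:R * (speed * (rc * v ^+ k))))) =
    Cf * (rc * P + q1 * rk * Qa + q1 * kr * ((b - a) ^+ 2 * P) + m * Rk).
    by rewrite /P /Qa /Rk /m; ring.
  have -> : Cf * (q1 * (rk + kr * T) + rc + q1 * kr * T ^+ 2 + m) *
      (P + (b - a) * (eps * nu + eps ^+ 2 * v ^+ k)) =
    Cf * ((q1 * (rk + kr * T) + rc + q1 * kr * T ^+ 2 + m) * (P + (Qa + Rk))).
    by rewrite /Qa /Rk; ring.
  apply: ler_wpM2l => //.
  have hh : (b - a) ^+ 2 * P <= T ^+ 2 * P by rewrite ler_wpM2r// lerXn2r ?nnegrE.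
  have h1 : q1 * kr * ((b - a) ^+ 2 * P) <= q1 * kr * (T ^+ 2 * P).
    by rewrite ler_wpM2l// mulr_ge0.
  pose S := P + (Qa + Rk); have S0 : 0 <= S by rewrite !addr_ge0.
  have c2 : 0 <= q1 * rk by rewrite mulr_ge0.
  have c3 : 0 <= q1 * kr * T by rewrite !mulr_ge0.
  have c4 : 0 <= q1 * kr * T ^+ 2 by rewrite !mulr_ge0// exprn_ge0.
  have PS : P <= S by rewrite /S lerDl addr_ge0.
  have QS : Qa <= S by rewrite /S addrCA lerDl addr_ge0.
  have RS : Rk <= S by rewrite /S addrA lerDr addr_ge0.
  have k1 : rc * P <= rc * S by rewrite ler_wpM2l.
  have k2 : q1 * rk * Qa <= q1 * rk * S by rewrite ler_wpM2l.
  have k3 : q1 * kr * (T ^+ 2 * P) <= q1 * kr * T ^+ 2 * S by rewrite mulrA ler_wpM2l.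
  have k4 : m * Rk <= m * S by rewrite ler_wpM2l.
  have k5 : 0 <= q1 * kr * T * S by rewrite mulr_ge0.
  rewrite -/S; lra.
Qed.

End StepEstimate.

(** * Accumulation of the error *)

(** Each factor [1 + c] is at most [expR c], and the [n] contributions [c * B] are amplified by at
    most the full exponential. *)
Lemma discrete_gronwall (R : realType) (u : nat -> R) (c B : R) n : 0 <= c -> 0 <= B ->
  u 0%N = 0 -> (forall m, (m < n)%N -> u m.+1 <= u m + c * (u m + B)) ->
  u n <= n%:R * c * expR (n%:R * c) * B.
Proof.
move=> c0 B0 u0; elim: n => [|n IH] h; first by rewrite u0 !mul0r.
have {}IH := IH (fun m mn => h m (ltnW mn)).
apply: (le_trans (h n (ltnSn n))).
have -> : u n + c * (u n + B) = (1 + c) * u n + c * B by ring.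
have c1 : 0 <= 1 + c by rewrite addr_ge0.
have e1 := expR_ge1Dx c.
have -> : n.+1%:R * c * expR (n.+1%:R * c) * B =
   n%:R * c * (expR (n%:R * c) * expR c) * B + c * B * expR (n.+1%:R * c).
  by rewrite -expRD -[n.+1]addn1 natrD mulrDl mul1r; ring.
apply: lerD.
  apply: (@le_trans _ _ (expR c * (n%:R * c * expR (n%:R * c) * B))); last first.
    by rewrite le_eqVlt; apply/orP; left; apply/eqP; ring.
  apply: (le_trans (ler_wpM2l c1 IH)); apply: ler_wpM2r => //.
  by rewrite !mulr_ge0// expR_ge0.
rewrite -[leLHS]mulr1; apply: ler_wpM2l; first exact: mulr_ge0.
by rewrite -expR0 ler_expR mulr_ge0.
Qed.

Section ErrorRecursion.
Context {R : realType} (T cc : R) (k : nat) (u : R -> nat -> nat -> R).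
Hypothesis T0 : 0 < T.
Hypothesis cc0 : 0 <= cc.
Hypothesis u0 : forall eps N, 0 < eps <= 1 -> u eps N 0 = 0.
Hypothesis u_ge0 : forall eps N n, 0 <= u eps N n.
Local Notation h N := (T / N%:R).
Hypothesis step1 : forall rho, 0 <= rho -> exists2 K, 0 <= K &
  forall eps N n, 0 < eps <= 1 -> (n < N)%N -> cc * u eps N n <= rho * eps ->
  u eps N n.+1 <= u eps N n + K * h N * (u eps N n + eps * h N ^+ k.+1).
Hypothesis step2 : forall rho, 0 <= rho -> exists2 K, 0 <= K &
  forall eps N n, 0 < eps <= 1 -> (n < N)%N -> cc * u eps N n <= rho * eps ->
  cc * u eps N n <= rho * h N ->
  u eps N n.+1 <= u eps N n + K * h N * (u eps N n + eps ^+ 2 * h N ^+ k).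

Lemma step_size_ge0 N : 0 <= h N.
Proof. by rewrite divr_ge0// ltW. Qed.

Lemma step_size_le N : h N <= T.
Proof.
case: N => [|N]; first by rewrite invr0 mulr0 ltW.
by rewrite ler_pdivrMr ?ltr0n// ler_peMr ?(ltW T0)// ler1n.
Qed.

Lemma steps_le_T n N : (n <= N)%N -> n%:R * h N <= T.
Proof.
case: N => [|N] nN; first by move: nN; rewrite leqn0 => /eqP->; rewrite mul0r ltW.
by rewrite mulrCA -[leRHS]mulr1 ler_pM2l// ler_pdivrMr ?ltr0n// mul1r ler_nat.
Qed.

Lemma gronwall_steps (w : nat -> R) K B n N : 0 <= K -> 0 <= B -> w 0%N = 0 ->
  (n <= N)%N -> (forall m, (m < n)%N -> w m.+1 <= w m + K * h N * (w m + B)) ->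
  w n <= K * T * expR (K * T) * B.
Proof.
move=> K0 B0 w0 nN hw; have h0 := step_size_ge0 N.
have Kh0 : 0 <= K * h N by rewrite mulr_ge0.
apply: (le_trans (discrete_gronwall Kh0 B0 w0 hw)).
have nK : n%:R * (K * h N) <= K * T.
  by rewrite mulrCA ler_wpM2l// steps_le_T.
apply: ler_wpM2r => //; apply: ler_pM => //; first by rewrite mulr_ge0.
by rewrite ler_expR.
Qed.

(* [step1] only applies as long as the error is at most [rho * eps / cc]. For
   small [h] this is bootstrapped in [error_bound]; the finitely many larger
   values of [h] allow finitely many steps, for which the constant may grow with
   the number [n] of steps. *)
Lemma bound_few_steps n : exists2 C, 0 <= C & forall eps N, 0 < eps <= 1 -> (n <= N)%N ->
  u eps N n <= C * eps * h N ^+ k.+1.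
Proof.
elim: n => [|n [C C0 IH]]; first by exists 0 => // eps N e01 _; rewrite u0// !mul0r.
have rho0 : 0 <= cc * (C * T ^+ k.+1) by rewrite !mulr_ge0// exprn_ge0// ltW.
have [K K0 hK] := step1 rho0.
exists (C + K * T * (C + 1)); first by rewrite addr_ge0// !mulr_ge0 ?addr_ge0// ltW.
move=> eps N eps01 nN; have /andP[e0 _] := eps01; have h0 := step_size_ge0 N.
have un := IH eps N eps01 (ltnW nN).
have hk0 : 0 <= h N ^+ k.+1 by rewrite exprn_ge0.
apply: (le_trans (hK eps N n eps01 nN _)).
  rewrite -mulrA ler_wpM2l//; apply: (le_trans un).
  rewrite [leLHS]mulrAC; apply: ler_wpM2r; first exact: ltW.
  by apply: ler_wpM2l => //; rewrite lerXn2r ?nnegrE ?(ltW T0)// step_size_le.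
have B0 : 0 <= eps * h N ^+ k.+1 by rewrite mulr_ge0// ltW.
have -> : (C + K * T * (C + 1)) * eps * h N ^+ k.+1 = C * eps * h N ^+ k.+1 +
    K * T * (C * eps * h N ^+ k.+1 + eps * h N ^+ k.+1) by ring.
apply: lerD => //; apply: ler_pM.
- exact: mulr_ge0.
- exact: addr_ge0.
- by apply: ler_wpM2l => //; exact: step_size_le.
- by rewrite lerD2r.
Qed.

Lemma error_bound : exists2 C, 0 <= C & forall eps N n, 0 < eps <= 1 -> (n <= N)%N ->
  u eps N n <= C * eps * h N ^+ k.+1.
Proof.
have [K K0 hK] := step1 ler01.
pose C1 := K * T * expR (K * T).
have C10 : 0 <= C1 by rewrite !mulr_ge0 ?expR_ge0// ltW.
(* Beyond [N0] steps [h] is so small that the bound to be proved itself implies the condition of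
   [step1] with [rho = 1]. *)
pose N0 := Num.bound (cc * C1 * T ^+ k.+1).
have /choice[C hC] : forall n, exists C, 0 <= C /\ forall eps N, 0 < eps <= 1 -> (n <= N)%N ->
    u eps N n <= C * eps * h N ^+ k.+1.
  by move=> n; have [C ? ?] := bound_few_steps n; exists C.
exists (C1 + \sum_(n < N0.+1) C n).
  by rewrite addr_ge0// sumr_ge0// => n _; case: (hC n).
move=> eps N n eps01 nN; have /andP[e0 _] := eps01; have h0 := step_size_ge0 N.
have hk0 : 0 <= h N ^+ k.+1 by rewrite exprn_ge0.
have [NN0|N0N] := leqP N N0.
  have nN0 : (n < N0.+1)%N by rewrite ltnS (leq_trans nN).
  apply: (le_trans ((hC n).2 eps N eps01 nN)); rewrite ler_wpM2r// ler_wpM2r ?(ltW e0)//.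
  rewrite (bigD1 (Ordinal nN0))//= addrCA lerDl addr_ge0// sumr_ge0// => i _.
  by case: (hC i).
have B0 : 0 <= eps * h N ^+ k.+1 by rewrite mulr_ge0// ltW.
have small : cc * (C1 * h N ^+ k.+1) <= 1.
  have hT : h N ^+ k.+1 <= h N * T ^+ k.
    by rewrite exprS ler_wpM2l// lerXn2r ?nnegrE ?(ltW T0)// step_size_le.
  apply: (@le_trans _ _ (cc * (C1 * (h N * T ^+ k)))); first by rewrite !ler_wpM2l.
  have NR : 0 < N%:R :> R by rewrite ltr0n (leq_ltn_trans _ N0N).
  have -> : cc * (C1 * (h N * T ^+ k)) = cc * C1 * T ^+ k.+1 / N%:R by rewrite exprS; ring.
  rewrite ler_pdivrMr// mul1r; apply: ltW.
  apply: (@lt_trans _ _ N0%:R); last by rewrite ltr_nat.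
  by apply: archi_boundP; apply: mulr_ge0; [exact: mulr_ge0|apply: exprn_ge0; exact: ltW].
suff H m : (m <= N)%N -> u eps N m <= C1 * (eps * h N ^+ k.+1).
  apply: (le_trans (H n nN)); rewrite mulrA ler_wpM2r// ler_wpM2r ?(ltW e0)//.
  by rewrite lerDl sumr_ge0// => i _; case: (hC i).
(* Strong induction, because Gronwall uses the recursion at all earlier steps, and the bound already
   known there is what admits [step1]. *)
elim/ltn_ind: m => m IH mN.
apply: (gronwall_steps K0 B0 (u0 N eps01) mN) => l lm.
apply: hK => //; first exact: leq_trans lm mN.
apply: (le_trans (ler_wpM2l cc0 (IH l lm (leq_trans (ltnW lm) mN)))).
have -> : cc * (C1 * (eps * h N ^+ k.+1)) = cc * (C1 * h N ^+ k.+1) * eps by ring.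
by rewrite ler_wpM2r// ltW.
Qed.

(** The first bound certifies both smallness conditions of [step2] at every step, so a second
    bootstrap is avoided and Gronwall applies at once. *)
Lemma error_bound_improved : exists2 C, 0 <= C & forall eps N n, 0 < eps <= 1 -> (n <= N)%N ->
  u eps N n <= C * eps ^+ 2 * h N ^+ k.
Proof.
have [C C0 hC] := error_bound.
(* [T ^+ k.+1] serves the comparison with [eps]; [T ^+ k] serves the one with [h], where one power
   of [h] is split off and [eps <= 1] is used. *)
have rho0 : 0 <= cc * C * (T ^+ k + T ^+ k.+1).
  apply: mulr_ge0; first exact: mulr_ge0.
  by apply: addr_ge0; apply: exprn_ge0; exact: ltW.
have [K K0 hK] := step2 rho0.
exists (K * T * expR (K * T)); first by rewrite !mulr_ge0 ?expR_ge0// ltW.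
move=> eps N n eps01 nN; have /andP[e0 e1] := eps01; have h0 := step_size_ge0 N.
have hk0 : 0 <= h N ^+ k by rewrite exprn_ge0.
have B0 : 0 <= eps ^+ 2 * h N ^+ k by rewrite mulr_ge0// exprn_ge0// ltW.
rewrite -mulrA; apply: (gronwall_steps K0 B0 (u0 N eps01) nN) => m mn.
have mN : (m < N)%N by exact: leq_trans mn nN.
have um := ler_wpM2l cc0 (hC eps N m eps01 (ltnW mN)).
have hT := step_size_le N.
have hk : h N ^+ k <= T ^+ k by rewrite lerXn2r ?nnegrE ?(ltW T0).
have hk1 : h N ^+ k.+1 <= T ^+ k.+1 by rewrite lerXn2r ?nnegrE ?(ltW T0).
have Tk : 0 <= T ^+ k by rewrite exprn_ge0// ltW.
have Tk1 : 0 <= T ^+ k.+1 by rewrite exprn_ge0// ltW.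
have ccC : 0 <= cc * C by rewrite mulr_ge0.
apply: hK => //; apply: (le_trans um).
  have -> : cc * (C * eps * h N ^+ k.+1) = cc * C * h N ^+ k.+1 * eps by ring.
  rewrite ler_wpM2r ?(ltW e0)// ler_wpM2l//; apply: (le_trans hk1).
  by rewrite lerDr.
have -> : cc * (C * eps * h N ^+ k.+1) = cc * C * (eps * h N ^+ k) * h N by rewrite exprS; ring.
rewrite ler_wpM2r// ler_wpM2l//; apply: (@le_trans _ _ (1 * T ^+ k)).
  by apply: ler_pM => //; exact: ltW.
by rewrite mul1r lerDl.
Qed.

End ErrorRecursion.

Lemma exprD_le (R : realType) (a b : R) m : 0 <= a -> 0 <= b ->
  (a + b) ^+ m <= 2 ^+ m * (a ^+ m + b ^+ m).
Proof.
move=> a0 b0; have am := exprn_ge0 m a0; have bm := exprn_ge0 m b0.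
wlog ab : a b a0 b0 am bm / a <= b.
  move=> H; case: (leP a b) => [|/ltW] h; first exact: H.
  by rewrite [a + b]addrC [a ^+ m + _]addrC; apply: H.
apply: (@le_trans _ _ ((2 * b) ^+ m)).
  by rewrite lerXn2r ?nnegrE ?addr_ge0 ?mulr_ge0//; lra.
by rewrite exprMn ler_wpM2l ?exprn_ge0// lerDr.
Qed.

Lemma enorm_le (R : realType) n (v : 'cV[R]_n) : enorm v <= n%:R * `|v|.
Proof.
have nv : 0 <= n%:R * `|v| by rewrite mulr_ge0.
rewrite -[leRHS]ger0_norm// -sqrtr_sqr /enorm ler_wsqrtr//.
apply: (@le_trans _ _ (\sum_(i < n) `|v| ^+ 2)).
  apply: ler_sum => i _; rewrite -real_normK ?num_real// lerXn2r ?nnegrE//.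
  exact: ler_mx_norm_coord.
rewrite sumr_const card_ord -[leLHS]mulr_natl exprMn ler_wpM2r ?exprn_ge0//.
by rewrite expr2 -natrM ler_nat; case: (n) => // n'; rewrite leq_pmulr.
Qed.

(** * Convergence of the integrator *)

Section Convergence.
Context {R : realType} {d k : nat} (k0 : (0 < k)%N).
Context (s : seq (seq 'I_(d + d + 1))).
Hypothesis sP : multi_index_listing k s.
Variables (T C0 c L gB : R) (M : 'M[R]_d) (g : 'cV[R]_d -> R -> 'cV[R]_d).
Hypothesis T0 : 0 < T.
Hypothesis hM : sym_posdef M.
Hypothesis L0 : 0 <= L.
Hypothesis gB0 : 0 <= gB.
Hypothesis c0 : 0 <= c.
Hypothesis hc : forall v, `|v| <= c * Num.sqrt (quad (osc_G M) v).
Hypothesis forceS : forall i, smooth_on t_index T k L (force g i).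
Hypothesis forceB : forall i be, (size be <= k)%N -> `|partial be (force g i) 0| <= gB.
Variables (y0 dy0 : R -> 'cV[R]_d) (y dy : R -> R -> 'cV[R]_d).
Hypothesis hy : forall eps, 0 < eps <= 1 ->
  is_solution M g eps T (y0 eps) (dy0 eps) (y eps) (dy eps).
Hypothesis hC0 : forall eps t, 0 < eps <= 1 -> 0 <= t <= T ->
  2^-1 * enorm (dy eps t) ^+ 2 + (2 * eps ^+ 2)^-1 * quad M (y eps t) <= C0.

Local Notation h N := (T / N%:R).
Let c1 : R := c * Num.sqrt (2 * C0).
Let c10 : 0 <= c1. Proof. by rewrite mulr_ge0// sqrtr_ge0. Qed.

Let exact eps t := exact_sol eps (y eps) (dy eps) t.
Let X eps N n := LLE k s M g eps (h N) (y0 eps) (dy0 eps) n.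
Let E eps (N n : nat) := exact eps (n%:R * h N) - X eps N n.

Lemma step_length (N n : nat) : n.+1%:R * h N - n%:R * h N = h N.
Proof. by rewrite -mulrBl -natrB// subSnn mul1r. Qed.

Lemma XS eps N n : X eps N n.+1 = LLE_step k s (osc_A1 M) (osc_f g eps) eps
   (n.+1%:R * h N - n%:R * h N) (X eps N n).
Proof.
by rewrite step_length.
Qed.

Lemma step_data_exact eps (N n : nat) rho : 0 < eps <= 1 -> (n < N)%N ->
  X eps N n t_index 0 = n%:R * h N -> `|E eps N n| <= rho * eps ->
  step_data M g T c1 rho eps (n%:R * h N) (n.+1%:R * h N) (X eps N n) (exact eps).
Proof.
move=> eps01 nN Xt Er; have /andP[e0 e1] := eps01.
have h0 := step_size_ge0 T0 N.
have a0 : 0 <= n%:R * h N by rewrite mulr_ge0.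
have ab : n%:R * h N <= n.+1%:R * h N by rewrite ler_wpM2r// ler_nat.
have bT := steps_le_T T0 nN.
have sub t : n%:R * h N <= t <= n.+1%:R * h N -> 0 <= t <= T.
  by move=> /andP[at_ tb]; rewrite (le_trans a0 at_) (le_trans tb bT).
split; first by split.
split=> //.
- move=> t i tab; apply: (@is_derive_on_subset _ `[0, T]).
    by move=> u; rewrite /= !in_itv /=; exact: sub.
  exact: (@exact_sol_ode R d M g eps T _ _ _ _ e0 (hy eps01) t i (sub t tab)).
- by move=> t _; exact: exact_sol_t.
- move=> t tab.
  exact: (exact_sol_bound e0 hM (fun u hu => hC0 eps01 hu) c0 hc (sub _ tab)).
Qed.

Lemma X_time eps N n : 0 < eps <= 1 -> (n <= N)%N -> X eps N n t_index 0 = n%:R * h N.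
Proof.
move=> eps01; elim: n => [|n IH] nN.
  by rewrite mul0r /X /LLE /= /osc_x0 /t_index col_mxEd mxE.
have /andP[e0 _] := eps01.
(* Exactness in time holds whatever the size of the error, so [rho] may be the actual ratio. *)
have sd := @step_data_exact eps N n (`|E eps N n| / eps) eps01 nN (IH (ltnW nN)).
rewrite XS; apply: (step_time sP k0 (sd _)).
by rewrite divfK ?gt_eqF.
Qed.

Lemma E_energy_norm eps N n : 0 < eps <= 1 -> (n <= N)%N -> `|E eps N n| <= c * energy_norm M (E eps N n).
Proof.
move=> eps01 nN; rewrite -[leRHS]addr0; apply: norm_le_usub; first exact: hc.
by rewrite /E mxE exact_sol_t mxE X_time// subrr normr0.
Qed.

Lemma E0 eps N : 0 < eps <= 1 -> E eps N 0 = 0.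
Proof.
move=> eps01; have [y00 dy00 _] := hy eps01.
rewrite /E /X /exact /exact_sol mul0r /LLE /= /osc_x0 y00 dy00 raddf0 subrr//.
Qed.

Lemma LLE_error_le eps N n : 0 < eps <= 1 -> (n <= N)%N ->
  LLE_error k s M g eps (h N) (y0 eps) (dy0 eps) (y eps) (dy eps) n <=
  2 * d%:R * c * energy_norm M (E eps N n).
Proof.
move=> eps01 nN; have /andP[e0 _] := eps01; have hE := E_energy_norm eps01 nN.
have Y : `|ypart (X eps N n) - y eps (n%:R * h N)| <= `|E eps N n|.
  have EY : usubmx (usubmx (E eps N n)) = y eps (n%:R * h N) - ypart (X eps N n).
    by rewrite /E 2!raddfB /= /exact /exact_sol !col_mxKu.
  rewrite distrC -EY; apply: mx_norm_le => // i j; rewrite 2!mxE.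
  exact: ler_mx_norm_coord.
have P : `|ppart (X eps N n) - eps *: dy eps (n%:R * h N)| <= `|E eps N n|.
  have EP : dsubmx (usubmx (E eps N n)) = eps *: dy eps (n%:R * h N) - ppart (X eps N n).
    by rewrite /E 2!raddfB /= /exact /exact_sol col_mxKu col_mxKd.
  rewrite distrC -EP; apply: mx_norm_le => // i j; rewrite 2!mxE.
  exact: ler_mx_norm_coord.
rewrite /LLE_error -/(X eps N n).
have -> : eps^-1 *: ppart (X eps N n) - dy eps (n%:R * h N) =
   eps^-1 *: (ppart (X eps N n) - eps *: dy eps (n%:R * h N)).
  by rewrite scalerBr scalerA mulVf ?gt_eqF// scale1r.
have d0 : 0 <= d%:R :> R by [].
apply: (@le_trans _ _ (d%:R * `|E eps N n| + d%:R * `|E eps N n|)).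
  apply: lerD.
    by apply: (le_trans (enorm_le _)); apply: ler_wpM2l.
  apply: (@le_trans _ _ (eps * (d%:R * (eps^-1 * `|ppart (X eps N n) - eps *: dy eps (n%:R * h N)|)))).
    apply: ler_wpM2l; first exact: ltW.
    apply: (le_trans (enorm_le _)); rewrite normrZ normfV (gtr0_norm e0)//.
  by rewrite mulrCA mulVKf ?gt_eqF//; apply: ler_wpM2l.
have -> : 2 * d%:R * c * energy_norm M (E eps N n) = d%:R * (c * energy_norm M (E eps N n)) +
   d%:R * (c * energy_norm M (E eps N n)) by ring.
by apply: lerD; apply: ler_wpM2l.
Qed.

Let u eps N n : R := energy_norm M (E eps N n).

Let u_ge0 eps N n : 0 <= u eps N n. Proof. exact: sqrtr_ge0. Qed.

Let u0 eps N : 0 < eps <= 1 -> u eps N 0 = 0.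
Proof. by move=> eps01; rewrite /u /energy_norm E0// linear0 /quad mulmx0 mxE sqrtr0. Qed.

Lemma E_step rho : 0 <= rho -> exists2 C, 0 <= C & forall eps N n v,
  0 < eps <= 1 -> (n < N)%N -> `|E eps N n| <= rho * eps ->
  (forall t, n%:R * h N <= t <= n.+1%:R * h N -> `|exact eps t - X eps N n| <= v) ->
  u eps N n.+1 <= u eps N n + C * h N * (eps * `|E eps N n| + eps * v ^+ k.+1) /\
  u eps N n.+1 <= u eps N n +
    C * (eps ^+ 2 * v ^+ k.+1 + h N * (eps * `|E eps N n| + eps ^+ 2 * v ^+ k)).
Proof.
move=> rho0.
have [C C_ge0 hC] := step_estimate sP k0 hM T0 L0 gB0 c10 rho0 forceS forceB.
exists C => // eps N n v eps01 nN nur sp.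
have sd := step_data_exact eps01 nN (X_time eps01 (ltnW nN)) nur.
have := hC _ _ _ _ _ _ sd sp.
have ES : exact eps (n.+1%:R * h N) - LLE_step k s (osc_A1 M) (osc_f g eps) eps
   (n.+1%:R * h N - n%:R * h N) (X eps N n) = E eps N n.+1 by rewrite /E XS.
rewrite /= ES -/(E eps N n); have -> := step_length N n.
exact.
Qed.

Lemma E_speed rho eps N n t : 0 <= rho -> 0 < eps <= 1 -> (n < N)%N ->
  `|E eps N n| <= rho * eps -> n%:R * h N <= t <= n.+1%:R * h N ->
  `|exact eps t - X eps N n| <= speed M T L gB c1 rho * h N + `|E eps N n|.
Proof.
move=> rho0 eps01 nN nur tab.
have sd := step_data_exact eps01 nN (X_time eps01 (ltnW nN)) nur.
have := step_speed T0 L0 gB0 c10 rho0 forceS forceB sd tab.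
by have -> := step_length N n.
Qed.

Let step1 rho : 0 <= rho -> exists2 K, 0 <= K &
  forall eps N n, 0 < eps <= 1 -> (n < N)%N -> c * u eps N n <= rho * eps ->
  u eps N n.+1 <= u eps N n + K * h N * (u eps N n + eps * h N ^+ k.+1).
Proof.
move=> rho0.
have [C C_ge0 hC] := E_step rho0.
pose sg := speed M T L gB c1 rho.
have sg0 : 0 <= sg by exact: speed_ge0.
pose p : R := 2 ^+ k.+1; have p0 : 0 <= p by rewrite exprn_ge0.
have sgk : 0 <= sg ^+ k.+1 by rewrite exprn_ge0.
have rk : 0 <= rho ^+ k by rewrite exprn_ge0.
exists (C * (c + p * (sg ^+ k.+1 + rho ^+ k * c))).
  by rewrite mulr_ge0// addr_ge0// mulr_ge0// addr_ge0// mulr_ge0.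
move=> eps N n eps01 nN hr; have /andP[e0 e1] := eps01.
have h0 := step_size_ge0 T0 N.
have nuu := E_energy_norm eps01 (ltnW nN).
have nur := le_trans nuu hr.
have [H _] := hC _ _ _ _ eps01 nN nur (fun t => E_speed rho0 eps01 nN nur (t := t)).
move: H; rewrite -/sg.
set nu := `|_| in nuu nur *; set v := sg * _ + nu => H.
have nu0 : 0 <= nu by exact: normr_ge0.
apply: (le_trans H); rewrite lerD2l.
have hk0 : 0 <= h N ^+ k.+1 by rewrite exprn_ge0.
have uu := u_ge0 eps N n.
(* The recursion must be linear in the error: of the [k + 1] powers of [nu] one is kept and the
   others are bounded by [rho]. *)
have vk : v ^+ k.+1 <= p * (sg ^+ k.+1 * h N ^+ k.+1 + rho ^+ k * nu).
  apply: (le_trans (exprD_le _ _ _)) => //; first by rewrite mulr_ge0.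
  apply: ler_wpM2l => //; rewrite exprMn lerD2l exprSr; apply: ler_wpM2r => //.
  rewrite lerXn2r ?nnegrE//; apply: (le_trans nur); by rewrite ler_piMr.
have -> : C * (c + p * (sg ^+ k.+1 + rho ^+ k * c)) * h N * (u eps N n + eps * h N ^+ k.+1) =
  C * h N * ((c + p * (sg ^+ k.+1 + rho ^+ k * c)) * (u eps N n + eps * h N ^+ k.+1)) by ring.
apply: ler_wpM2l; first exact: mulr_ge0.
have en : eps * nu <= c * u eps N n.
  by apply: le_trans nuu; rewrite ler_piMl.
have ev : eps * v ^+ k.+1 <= p * (sg ^+ k.+1 * (eps * h N ^+ k.+1) + rho ^+ k * (c * u eps N n)).
  apply: (le_trans (ler_wpM2l (ltW e0) vk)).
  have -> : eps * (p * (sg ^+ k.+1 * h N ^+ k.+1 + rho ^+ k * nu)) =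
    p * (sg ^+ k.+1 * (eps * h N ^+ k.+1) + rho ^+ k * (eps * nu)) by ring.
  by apply: ler_wpM2l => //; rewrite lerD2l ler_wpM2l.
set B := eps * h N ^+ k.+1 in ev *.
have B0 : 0 <= B by rewrite mulr_ge0// ltW.
apply: (le_trans (lerD en ev)).
set U := u eps N n in uu *.
have a1 : 0 <= p * sg ^+ k.+1 * U by rewrite !mulr_ge0.
have a2 : 0 <= p * (rho ^+ k * c) * B by apply: mulr_ge0 => //; apply: mulr_ge0 => //; apply: mulr_ge0.
have a3 : 0 <= c * B by exact: mulr_ge0.
rewrite -subr_ge0.
have -> : (c + p * (sg ^+ k.+1 + rho ^+ k * c)) * (U + B) -
   (c * U + p * (sg ^+ k.+1 * B + rho ^+ k * (c * U))) =
   p * sg ^+ k.+1 * U + p * (rho ^+ k * c) * B + c * B by ring.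
by rewrite !addr_ge0.
Qed.

(** With the error at most [rho h], the distance to the centre is at most [(sg + rho) h] over the
    step. The boundary term [eps^2 v^(k+1)] is then O(eps^2 h^(k+1)) and has the same factor [h] as
    the integrated terms. *)
Let step2 rho : 0 <= rho -> exists2 K, 0 <= K &
  forall eps N n, 0 < eps <= 1 -> (n < N)%N -> c * u eps N n <= rho * eps ->
  c * u eps N n <= rho * h N ->
  u eps N n.+1 <= u eps N n + K * h N * (u eps N n + eps ^+ 2 * h N ^+ k).
Proof.
move=> rho0.
have [C C_ge0 hC] := E_step rho0.
pose sg := speed M T L gB c1 rho.
have sg0 : 0 <= sg by exact: speed_ge0.
pose w := sg + rho; have w0 : 0 <= w by rewrite addr_ge0.
have wk : 0 <= w ^+ k by rewrite exprn_ge0.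
have wk1 : 0 <= w ^+ k.+1 by rewrite exprn_ge0.
exists (C * (w ^+ k.+1 + c + w ^+ k)); first by rewrite mulr_ge0// !addr_ge0.
move=> eps N n eps01 nN hr hrh; have /andP[e0 e1] := eps01.
have h0 := step_size_ge0 T0 N.
have nuu := E_energy_norm eps01 (ltnW nN).
have nur := le_trans nuu hr; have nurh := le_trans nuu hrh.
have sp t : n%:R * h N <= t <= n.+1%:R * h N -> `|exact eps t - X eps N n| <= w * h N.
  move=> tab; apply: (le_trans (E_speed rho0 eps01 nN nur tab)).
  by rewrite [leRHS]mulrDl lerD2l.
have [_ H] := hC _ _ _ _ eps01 nN nur sp.
move: H.
set nu := `|_| in nuu nur nurh * => H.
have nu0 : 0 <= nu by exact: normr_ge0.
apply: (le_trans H); rewrite lerD2l [(w * _) ^+ k.+1]exprMn [(w * _) ^+ k]exprMn.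
have hk0 : 0 <= h N ^+ k by rewrite exprn_ge0.
have uu := u_ge0 eps N n.
have en : eps * nu <= c * u eps N n.
  by apply: le_trans nuu; rewrite ler_piMl.
set B := eps ^+ 2 * h N ^+ k.
have B0 : 0 <= B by rewrite mulr_ge0// exprn_ge0// ltW.
set U := u eps N n in uu en *.
have -> : C * (eps ^+ 2 * (w ^+ k.+1 * h N ^+ k.+1) + h N * (eps * nu + eps ^+ 2 * (w ^+ k * h N ^+ k)))
  = C * h N * (w ^+ k.+1 * B + eps * nu + w ^+ k * B).
  by rewrite /B [h N ^+ k.+1]exprS; ring.
have -> : C * (w ^+ k.+1 + c + w ^+ k) * h N * (U + B) =
  C * h N * ((w ^+ k.+1 + c + w ^+ k) * (U + B)) by ring.
apply: ler_wpM2l; first exact: mulr_ge0.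
have a1 : 0 <= (w ^+ k.+1 + w ^+ k) * U by rewrite mulr_ge0// addr_ge0.
have a2 : 0 <= c * B by exact: mulr_ge0.
rewrite -subr_ge0.
have -> : (w ^+ k.+1 + c + w ^+ k) * (U + B) - (w ^+ k.+1 * B + eps * nu + w ^+ k * B) =
  (w ^+ k.+1 + w ^+ k) * U + c * B + (c * U - eps * nu) by ring.
by rewrite addr_ge0 ?subr_ge0// addr_ge0.
Qed.

Lemma convergence : exists C, forall eps N n, 0 < eps <= 1 -> (n <= N)%N ->
  LLE_error k s M g eps (h N) (y0 eps) (dy0 eps) (y eps) (dy eps) n <= C * eps * h N ^+ k.+1.
Proof.
have [C _ hC] := error_bound T0 c0 u0 u_ge0 step1.
exists (2 * d%:R * c * C) => eps N n eps01 nN.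
apply: (le_trans (LLE_error_le eps01 nN)).
by rewrite -!(mulrA (2 * d%:R * c)); apply: ler_wpM2l; [rewrite !mulr_ge0|exact: hC].
Qed.

Lemma convergence_improved : exists C, forall eps N n, 0 < eps <= 1 -> (n <= N)%N ->
  LLE_error k s M g eps (h N) (y0 eps) (dy0 eps) (y eps) (dy eps) n <= C * eps ^+ 2 * h N ^+ k.
Proof.
have [C _ hC] := error_bound_improved T0 c0 u0 u_ge0 step1 step2.
exists (2 * d%:R * c * C) => eps N n eps01 nN.
apply: (le_trans (LLE_error_le eps01 nN)).
by rewrite -!(mulrA (2 * d%:R * c)); apply: ler_wpM2l; [rewrite !mulr_ge0|exact: hC].
Qed.

End Convergence.

Theorem theorem4p4 (R : realType) (d k : nat) (hd : (1 <= d)%N) (hk : (1 <= k)%N)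
    (s : seq (seq 'I_(d + d + 1))) (hs : multi_index_listing k s)
    (nu T C0 : R) (hT : 0 < T)
    (M : 'M[R]_d) (hM : sym_posdef M)
    (g : 'cV[R]_d -> R -> 'cV[R]_d)
    (hg : forall i : 'I_d,
       derivs_lipschitz k (strip d T) (fun z => joint g z i 0))
    (yin dyin : 'cV[R]_d)
    (y dy : R -> R -> 'cV[R]_d)
    (hy : forall eps, 0 < eps <= 1 ->
       is_solution M g eps T (eps `^ nu *: yin) (eps `^ (nu - 1) *: dyin)
         (y eps) (dy eps))
    (hC0 : forall eps t, 0 < eps <= 1 -> 0 <= t <= T ->
       2^-1 * enorm (dy eps t) ^+ 2
         + (2 * eps ^+ 2)^-1 * quad M (y eps t) <= C0) :
  (exists C : R, forall (eps : R) (N : nat), 0 < eps <= 1 -> (0 < N)%N ->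
     let h := T / N%:R in
     forall n : nat, (n <= N)%N ->
       LLE_error k s M g eps h (eps `^ nu *: yin) (eps `^ (nu - 1) *: dyin)
         (y eps) (dy eps) n
       <= C * eps * h ^+ k.+1) /\
  (forall c0 : R, 0 < c0 ->
   exists C : R, forall (eps : R) (N : nat), 0 < eps <= 1 -> (0 < N)%N ->
     let h := T / N%:R in
     c0 * eps < h ->
     forall n : nat, (n <= N)%N ->
       LLE_error k s M g eps h (eps `^ nu *: yin) (eps `^ (nu - 1) *: dyin)
         (y eps) (dy eps) n
       <= C * eps ^+ 2 * h ^+ k).
Proof.
have [L L0 hL] : exists2 L, 0 <= L & forall i, smooth_on t_index T k L (force g i).
  apply: fin_uniform_bound => [i|i L L' LL' [dF lF]]; first exact: smooth_on_yt.
  split=> // al x z ak xS zS; apply: (le_trans (lF al x z ak xS zS)).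
  exact: ler_wpM2r.
(* Lipschitz bounds control only differences; the finitely many derivatives at the origin supply the
   missing reference values. *)
have [gB gB0 hgB] : exists2 gB, 0 <= gB & forall i be, (size be <= k)%N ->
    `|partial be (force g i) 0| <= gB.
  apply: (@fin_uniform_bound _ 'I_d (fun i B => forall be, (size be <= k)%N ->
    `|partial be (force g i) 0| <= B)) => [i|i B B' BB' hB be bk].
    apply: (@seq_uniform_bound _ _ k (fun be B => `|partial be (force g i) 0| <= B)).
      by move=> be _; exists `|partial be (force g i) 0|.
    by move=> be B B' BB' /le_trans; exact.
  exact: le_trans (hB be bk) BB'.
have [c c_ge0 hc] := posdef_coercive (osc_G_posdef hM).
split=> [|c0 _].
  have [C hC] := @convergence R d k hk s hs T C0 c L gB M g hT hM L0 gB0 c_ge0 hc hL hgB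
    (fun eps => eps `^ nu *: yin) (fun eps => eps `^ (nu - 1) *: dyin) y dy hy hC0.
  by exists C => eps N eps01 _ /= n; exact: hC.
have [C hC] := @convergence_improved R d k hk s hs T C0 c L gB M g hT hM L0 gB0 c_ge0 hc hL hgB
  (fun eps => eps `^ nu *: yin) (fun eps => eps `^ (nu - 1) *: dyin) y dy hy hC0.
by exists C => eps N eps01 _ /= _ n; exact: hC.
Qed.
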